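(* (1) Let $y:M\to S^{n+2}$ be a conformal immersion of a Riemann surface $M$, let $U\subset M$ be a contractible open set with complex coordinate $z$, let $Y$ be the canonical lift of $y$ on $U$ with respect to $z$, and let $\psi_1,\dots,\psi_n$ be an oriented orthonormal frame of $V^\perp$ over $U$. Set $$\phi_1=\tfrac{1}{\sqrt2}(Y+N),\quad \phi_2=\tfrac1{\sqrt2}(-Y+N),\quad \phi_3=Y_z+Y_{\bar z},\quad \phi_4=i(Y_z-Y_{\bar z}),\quad F=(\phi_1,\phi_2,\phi_3,\phi_4,\psi_1,\dots,\psi_n).$$ Then $F$ takes values in $SO^+(1,n+3)$, and its Maurer–Cartan form $\alpha=F^{-1}dF$ has the form $$\alpha=\begin{pmatrix}A_1&B_1\\ B_2&A_2\end{pmatrix}dz+\begin{pmatrix}\bar A_1&\bar B_1\\ \bar B_2&\bar A_2\end{pmatrix}d\bar z, \qquad ( * )$$ where $$A_1=\begin{pmatrix}0&0&s_1&s_2\\ 0&0&s_3&s_4\\ s_1&-s_3&0&0\\ s_2&-s_4&0&0\end{pmatrix},\qquad A_2=\begin{pmatrix}b_{11}&\cdots&b_{n1}\\ \vdots&&\vdots\\ b_{1n}&\cdots&b_{nn}\end{pmatrix},$$ $$s_1=\tfrac{1}{2\sqrt2}(1-s-2k^2),\quad s_2=-\tfrac{i}{2\sqrt2}(1+s-2k^2),\quad s_3=\tfrac1{2\sqrt2}(1+s+2k^2),\quad s_4=-\tfrac{i}{2\sqrt2}(1-s+2k^2),$$ $$B_1=\begin{pmatrix}\sqrt2\beta_1&\cdots&\sqrt2\beta_n\\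 -\sqrt2\beta_1&\cdots&-\sqrt2\beta_n\\ -k_1&\cdots&-k_n\\ -ik_1&\cdots&-ik_n\end{pmatrix},\qquad B_2=\begin{pmatrix}\sqrt2\beta_1&\sqrt2\beta_1&k_1&ik_1\\ \vdots&\vdots&\vdots&\vdots\\ \sqrt2\beta_n&\sqrt2\beta_n&k_n&ik_n\end{pmatrix}=-B_1^tI_{1,3}.$$ (2) Conversely, let $U$ be a contractible open Riemann surface with complex coordinate $z$ and let $f:U\to SO^+(1,n+3)/SO^+(1,3)\times SO(n)$ be a conformal map. If $f$ has a frame $F=(\phi_1,\dots,\phi_4,\psi_1,\dots,\psi_n):U\to SO^+(1,n+3)$ whose Maurer–Cartan form is of the form $( * )$ (with the displayed $A_1,A_2,B_1,B_2$) for some complex-valued functions $s,k_j,\beta_j,b_{jl}$ with $b_{jl}+b_{lj}=0$ and $k^2=\sum_j|k_j|^2$, then $$y=[\phi_1-\phi_2]$$ is a conformal immersion from $U$ into $S^{n+2}$ whose conformal Gauss map is $f$.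
   Context: $\mathbb R^{n+4}_1$ is $\mathbb R^{n+4}$ with $\langle x,y\rangle=-x_0y_0+\sum_{j=1}^{n+3}x_jy_j$, extended complex bilinearly; $I_{1,m}=\mathrm{diag}(-1,1,\dots,1)$ with $m$ ones. $SO^+(1,m)$ is the identity component of the isometry group of $\mathbb R^{m+1}_1$. $\mathcal C_+^{n+3}=\{x:\langle x,x\rangle=0,\ x_0>0\}$ is the forward light cone; $S^{n+2}$ is identified conformally with the projectivized light cone $\{[x]: x\in\mathcal C^{n+3}_+\}$. A point of $SO^+(1,n+3)/SO^+(1,3)\times SO(n)$ is identified with an oriented 4-dimensional Lorentzian subspace of $\mathbb R^{n+4}_1$: the coset of $F$ corresponds to the span of the first four columns of $F$, oriented by these columns. A frame of a map $f$ into this space is a lift $F$ of $f$ to $SO^+(1,n+3)$. A local lift of $y:M\to S^{n+2}$ is a map $Y:U\to\mathcal C_+^{n+3}$ with $[Y]=y$. The map $y$ is a conformal immersion if $\langle Y_z,Y_z\rangle=0$ and $\langle Y_z,Y_{\bar z}\rangle>0$ for any local lift and any complex coordinate $z=u+iv$. The canonical lift with respect to $z$ is the unique lift $Y$ with $\langle Y_z,Y_{\bar z}\rangle=\frac12$. $V=\mathrm{Span}_{\mathbb R}\{Y,\mathrm{Re}\,Y_z,\mathrm{Im}\,Y_z,Y_{z\bar z}\}$ is a rank-4 Lorentzian bundle, and $V^\perp$ is its orthogonal complement with induced orientation. For the canonical lift $Y$, $N$ is the unique section of $V$ with $\langle N,Y_z\rangle=\langle N,Y_{\bar z}\rangle=\langle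 N,N\rangle=0$, $\langle N,Y\rangle=-1$. $V$ is oriented by $\{Y,N,Y_u,Y_v\}$. The conformal Gauss map of $y$ is $Gr_y:p\mapsto V_p$ (oriented). For the canonical lift $Y$, write $Y_{zz}=-\frac s2Y+\kappa$ with $s$ complex valued (the Schwarzian) and $\kappa\in\Gamma(V^\perp_{\mathbb C})$ (the conformal Hopf differential). $D$ is the normal connection on $V^\perp_{\mathbb C}$ (the $V^\perp_{\mathbb C}$-part of the flat derivative). In part (1): $D_z\psi_j=\sum_l b_{jl}\psi_l$ with $b_{jl}+b_{lj}=0$, $\kappa=\sum_jk_j\psi_j$, $D_{\bar z}\kappa=\sum_j\beta_j\psi_j$ (so $\beta_j=k_{j\bar z}-\sum_{l}\bar b_{jl}k_l$), and $k=\sqrt{\sum_j|k_j|^2}$. *)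

(* Defs.v *)
From HB Require Import structures.
From mathcomp Require Import all_boot all_order all_algebra.
From mathcomp Require Import complex.
From mathcomp Require Import all_classical all_reals all_analysis.
Set Implicit Arguments.
Unset Strict Implicit.
Unset Printing Implicit Defensive.
Import Order.TTheory GRing.Theory Num.Theory.
Import numFieldNormedType.Exports.
Local Open Scope classical_set_scope.
Local Open Scope complex_scope.
Local Open Scope ring_scope.

Fixpoint Ck (R : realType) (V W : normedModType R) (k : nat) (A : set V)
    (f : V -> W) : Prop :=
  if k is k'.+1 then
    (forall x, A x -> differentiable f x) /\
    (forall v, Ck k' A (fun x => 'D_v f x))
  else forall x, A x -> {for x, continuous f}.

Definition smooth (R : realType) (V W : normedModType R) (A : set V)
    (f : V -> W) : Prop :=
  forall k, Ck k A f.

(** The complex plane is [R * R], the pair [(u, v)] standing for [u + iv].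
    Complex differentiability: the real differential commutes with
    multiplication by [i], that is, with [(a, b) |-> (- b, a)]. *)
Definition holomorphic_at (R : realType) (h : R * R -> R * R) (q : R * R) :
    Prop :=
  differentiable h q /\
  'D_((0, 1) : R * R) h q =
    (- ('D_((1, 0) : R * R) h q).2, ('D_((1, 0) : R * R) h q).1).

(** [cinv] is only meaningful on the image of [cdom]. *)
Record chart (R : realType) (M : topologicalType) := Chart {
  cdom : set M;
  cmap :> M -> R * R;
  cinv : R * R -> M;
  cdom_open : open cdom;
  cimg_open : open (cmap @` cdom);
  cmapK : forall p, cdom p -> cinv (cmap p) = p;
  cmap_continuous : forall p, cdom p -> {for p, continuous cmap};
  cinv_continuous : forall q, (cmap @` cdom) q -> {for q, continuous cinv}
}.

Definition compatible (R : realType) (M : topologicalType) (c d : chart R M) :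
    Prop :=
  forall p, cdom c p -> cdom d p ->
    holomorphic_at (d \o cinv c) (c p) /\ holomorphic_at (c \o cinv d) (d p).

Record riemann_surface (R : realType) := RiemannSurface {
  rs_space :> topologicalType;
  rs_atlas : set (chart R rs_space);
  rs_hausdorff : hausdorff_space rs_space;
  rs_connected : connected [set: rs_space];
  rs_cover : forall p, exists2 c, rs_atlas c & cdom c p;
  rs_compatible : forall c d, rs_atlas c -> rs_atlas d -> compatible c d
}.

Definition coordinate (R : realType) (M : riemann_surface R)
    (z : chart R M) : Prop :=
  forall c, rs_atlas c -> compatible c z.

(** Smoothness is required in every coordinate of the maximal atlas. *)
Definition smooth_on (R : realType) (M : riemann_surface R)
    (W : normedModType R) (A : set M) (g : M -> W) : Prop :=
  forall z : chart R M, coordinate z ->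
    smooth (z @` (cdom z `&` A)) (g \o cinv z).

Definition contractible (R : realType) (T : topologicalType) (A : set T) :
    Prop :=
  exists (p0 : T) (H : R * T -> T),
    [/\ A p0,
        {within `[0, 1] `*` A, continuous H},
        forall t p, t \in `[0, 1] -> A p -> A (H (t, p)),
        forall p, A p -> H (0, p) = p &
        forall p, A p -> H (1, p) = p0].

Section Derivatives.
Variables (R : realType) (M : riemann_surface R) (z : chart R M).

Definition dreal (W : normedModType R) (v : R * R) (g : M -> W) (p : M) : W :=
  'D_v (g \o cinv z) (z p).

Definition du (W : normedModType R) (g : M -> W) : M -> W := dreal (1, 0) g.
Definition dv (W : normedModType R) (g : M -> W) : M -> W := dreal (0, 1) g.

Definition dcplx (a b : nat) (v : R * R) (g : M -> 'M[R[i]]_(a, b)) (p : M) :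
    'M[R[i]]_(a, b) :=
  \matrix_(i, j) (dreal v (fun q => complex.Re (g q i j)) p +i*
                  dreal v (fun q => complex.Im (g q i j)) p).

Definition Dz (a b : nat) (g : M -> 'M[R[i]]_(a, b)) (p : M) :
    'M[R[i]]_(a, b) :=
  2^-1 *: (dcplx (1, 0) g p - 'i *: dcplx (0, 1) g p).

Definition Dzbar (a b : nat) (g : M -> 'M[R[i]]_(a, b)) (p : M) :
    'M[R[i]]_(a, b) :=
  2^-1 *: (dcplx (1, 0) g p + 'i *: dcplx (0, 1) g p).

End Derivatives.

Definition cplx (R : realType) (a b : nat) (A : 'M[R]_(a, b)) :
    'M[R[i]]_(a, b) := map_mx (fun x => x%:C) A.
Arguments cplx {R a b} A.

Definition Remx (R : realType) (a b : nat) (A : 'M[R[i]]_(a, b)) :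
    'M[R]_(a, b) := map_mx (@complex.Re R) A.

Definition Immx (R : realType) (a b : nat) (A : 'M[R[i]]_(a, b)) :
    'M[R]_(a, b) := map_mx (@complex.Im R) A.

Definition conjmx (R : realType) (a b : nat) (A : 'M[R[i]]_(a, b)) :
    'M[R[i]]_(a, b) := map_mx (@conjc R) A.

Definition I1 (T : nzRingType) (m : nat) : 'M[T]_m.+1 :=
  diag_mx (\row_i (if i == 0 then -1 else 1)).

(** Used both for [T = R] and, as the complex bilinear extension, for
    [T = R[i]]. *)
Definition lip (T : nzRingType) (m : nat) (x y : 'cV[T]_m.+1) : T :=
  - (x 0 0 * y 0 0) + \sum_(j < m) x (lift 0 j) 0 * y (lift 0 j) 0.

Definition isometries (R : realType) (m : nat) : set 'M[R]_m.+1 :=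
  [set A | forall x y : 'cV[R]_m.+1, lip (A *m x) (A *m y) = lip x y].

Definition SOplus (R : realType) (m : nat) : set 'M[R]_m.+1 :=
  connected_component (@isometries R m) 1%:M.

Definition lightcone (R : realType) (m : nat) : set 'cV[R]_m.+1 :=
  [set x | lip x x = 0 /\ 0 < x 0 0].

(** The projective class [[x]]; the sphere is the set of classes of points of
    the forward light cone. *)
Definition pclass (R : realType) (m : nat) (x : 'cV[R]_m) : set 'cV[R]_m :=
  [set t *: x | t in [set t : R | t != 0]].

Definition sphere (R : realType) (n : nat) : set (set 'cV[R]_(4 + n)) :=
  @pclass R (4 + n) @` @lightcone R (3 + n).

(** An oriented 4-dimensional subspace is represented by the set of all its
    positively oriented bases, a basis being the list of columns of a
    matrix. *)
Definition ospan (R : realType) (m : nat) (E : 'M[R]_(m, 4)) :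
    set 'M[R]_(m, 4) :=
  [set E *m A | A in [set A : 'M[R]_4 | 0 < \det A]].

(** The points of SO^+(1,n+3)/SO^+(1,3) x SO(n), the coset of [F] being
    [ospan (lsubmx F)]. *)
Definition oriented_lorentz4 (R : realType) (n : nat) :
    set (set 'M[R]_(4 + n, 4)) :=
  @ospan R (4 + n) @`
    [set E : 'M[R]_(4 + n, 4) | E^T *m I1 R (3 + n) *m E = I1 R 3].

Definition cols4 (T : Type) (m : nat) (a b c d : 'cV[T]_m) : 'M[T]_(m, 4) :=
  row_mx (row_mx a b) (row_mx c d).

Section ConformalImmersions.
Variables (R : realType) (n : nat) (M : riemann_surface R).
Local Notation vec := 'cV[R]_(4 + n).
Local Notation ip := (@lip _ (3 + n)).
Implicit Types (y : M -> set vec) (Y N : M -> vec) (z : chart R M) (p : M).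

Definition local_lift y (A : set M) Y : Prop :=
  [/\ open A, smooth_on A Y &
      forall p, A p -> @lightcone R (3 + n) (Y p) /\ y p = pclass (Y p)].

(** The first clause says that [y] is a smooth map into the sphere. *)
Definition conformal_immersion y : Prop :=
  (forall p, @sphere R n (y p) /\ exists A Y, A p /\ local_lift y A Y) /\
  (forall A Y z, local_lift y A Y -> coordinate z ->
    forall p, A p -> cdom z p ->
      ip (Dz z (cplx \o Y) p) (Dz z (cplx \o Y) p) = 0 /\
      0 < ip (Dz z (cplx \o Y) p) (Dzbar z (cplx \o Y) p)).

Definition canonical_lift y z Y : Prop :=
  local_lift y (cdom z) Y /\
  forall p, cdom z p ->
    ip (Dz z (cplx \o Y) p) (Dzbar z (cplx \o Y) p) = 2^-1.

(** [Y_{z zbar}] has real entries. *)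
Definition Vspan z Y p : {vspace vec} :=
  <<[:: Y p; Remx (Dz z (cplx \o Y) p); Immx (Dz z (cplx \o Y) p);
        Remx (Dzbar z (Dz z (cplx \o Y)) p)]>>%VS.

Definition lift_dual z Y N : Prop :=
  forall p, cdom z p ->
    [/\ N p \in Vspan z Y p,
        ip (cplx (N p)) (Dz z (cplx \o Y) p) = 0,
        ip (cplx (N p)) (Dzbar z (cplx \o Y) p) = 0,
        ip (N p) (N p) = 0 &
        ip (N p) (Y p) = -1].

Definition Vbasis z Y N p : 'M[R]_(4 + n, 4) :=
  cols4 (Y p) (N p) (du z Y p) (dv z Y p).

(** [V_p] with its orientation; the union is over all coordinates around [p],
    on which this oriented space does not depend. *)
Definition gauss_map y p : set 'M[R]_(4 + n, 4) :=
  [set E | exists z Y N,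
     [/\ coordinate z, cdom z p, canonical_lift y z Y, lift_dual z Y N &
         ospan (Vbasis z Y N p) E]].

Definition perp (V : {vspace vec}) : set vec :=
  [set x | forall w, w \in V -> ip x w = 0].

Definition in_cplx (A : set vec) (x : 'cV[R[i]]_(4 + n)) : Prop :=
  A (Remx x) /\ A (Immx x).

(** [w] is the component in the complexification of the orthogonal complement
    of [V] of the vector [x]. *)
Definition normal_part (V : {vspace vec}) (x w : 'cV[R[i]]_(4 + n)) : Prop :=
  in_cplx (perp V) w /\ in_cplx [set a | a \in V] (x - w).

(** The [j]-th section of the frame is the [j]-th column of [psi]. *)
Definition oriented_normal_frame z Y N (psi : M -> 'M[R]_(4 + n, n)) : Prop :=
  smooth_on (cdom z) psi /\
  forall p, cdom z p ->
    [/\ forall j, perp (Vspan z Y p) (col j (psi p)),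
        forall i j,
          ip (col i (psi p)) (col j (psi p)) = (i == j)%:R &
        0 < \det (row_mx (Vbasis z Y N p) (psi p))].

Definition schwarzian_hopf z Y (s : M -> R[i]) (kappa : M -> 'cV[R[i]]_(4 + n)) :
    Prop :=
  forall p, cdom z p ->
    Dz z (Dz z (cplx \o Y)) p = (- (s p / 2)) *: cplx (Y p) + kappa p /\
    in_cplx (perp (Vspan z Y p)) (kappa p).

(** [kappa = sum_j k_j psi_j], [D_zbar kappa = sum_j beta_j psi_j] and
    [D_z psi_j = sum_l b_jl psi_l]; the relation [b_jl + b_lj = 0] follows. *)
Definition structure_functions z Y (psi : M -> 'M[R]_(4 + n, n))
    (kappa : M -> 'cV[R[i]]_(4 + n)) (k beta : M -> 'I_n -> R[i])
    (b : M -> 'I_n -> 'I_n -> R[i]) : Prop :=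
  forall p, cdom z p ->
    [/\ kappa p = \sum_j k p j *: cplx (col j (psi p)),
        normal_part (Vspan z Y p) (Dzbar z kappa p)
          (\sum_j beta p j *: cplx (col j (psi p))) &
        forall j, normal_part (Vspan z Y p)
          (Dz z (fun q => cplx (col j (psi q))) p)
          (\sum_l b p j l *: cplx (col l (psi p)))].

(** The last two vectors of [cols4] are real before taking [Remx]. *)
Definition adapted_frame z Y N (psi : M -> 'M[R]_(4 + n, n)) p :
    'M[R]_(4 + n) :=
  let Yz := Dz z (cplx \o Y) p in
  let Yzbar := Dzbar z (cplx \o Y) p in
  row_mx (cols4 ((Num.sqrt 2)^-1 *: (Y p + N p))
                ((Num.sqrt 2)^-1 *: (- Y p + N p))
                (Remx (Yz + Yzbar))
                (Remx ('i *: (Yz - Yzbar))))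
         (psi p).

Definition frame_on (A : set M) (f : M -> set 'M[R]_(4 + n, 4))
    (F : M -> 'M[R]_(4 + n)) : Prop :=
  smooth_on A F /\
  forall p, A p -> @SOplus R (3 + n) (F p) /\ f p = ospan (lsubmx (F p)).

(** The metric of the symmetric space is, up to a constant, the trace form
    on the off-diagonal blocks [(0, B; - B^t I_{1,3}, 0)] of the Maurer-Cartan
    form of a frame: conformality is [<f_z, f_z> = 0]. *)
Definition conformal_map (f : M -> set 'M[R]_(4 + n, 4)) : Prop :=
  (forall p, @oriented_lorentz4 R n (f p) /\
     exists A F, [/\ open A, A p & frame_on A f F]) /\
  (forall A F z, open A -> frame_on A f F -> coordinate z ->
    forall p, A p -> cdom z p ->
      let B : 'M[R[i]]_(4, n) :=
        ursubmx (invmx (cplx (F p)) *m Dz z (cplx \o F) p) in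
      \tr (B^T *m I1 R[i] 3 *m B) = 0).

End ConformalImmersions.

Section MaurerCartan.
Variables (R : realType) (n : nat).
Implicit Types (s : R[i]) (k beta : 'I_n -> R[i]).

Definition sqrt2 : R[i] := (Num.sqrt 2)%:C.

Definition knorm k : R[i] :=
  (Num.sqrt (\sum_j ComplexField.Normc.normc (k j) ^+ 2))%:C.

Definition s1 s k : R[i] := (1 - s - 2 * knorm k ^+ 2) / (2 * sqrt2).
Definition s2 s k : R[i] := - ('i / (2 * sqrt2)) * (1 + s - 2 * knorm k ^+ 2).
Definition s3 s k : R[i] := (1 + s + 2 * knorm k ^+ 2) / (2 * sqrt2).
Definition s4 s k : R[i] := - ('i / (2 * sqrt2)) * (1 - s + 2 * knorm k ^+ 2).

Definition mxA1 s k : 'M[R[i]]_4 :=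
  \matrix_(i, j)
    (nth [::] [:: [:: 0; 0; s1 s k; s2 s k];
                  [:: 0; 0; s3 s k; s4 s k];
                  [:: s1 s k; - s3 s k; 0; 0];
                  [:: s2 s k; - s4 s k; 0; 0]] i)`_j.

Definition mxA2 (b : 'I_n -> 'I_n -> R[i]) : 'M[R[i]]_n :=
  \matrix_(i, j) b j i.

Definition mxB1 k beta : 'M[R[i]]_(4, n) :=
  \matrix_(i, j)
    [:: sqrt2 * beta j; - (sqrt2 * beta j); - k j; - ('i * k j)]`_i.

Definition mxB2 k beta : 'M[R[i]]_(n, 4) :=
  \matrix_(i, j)
    [:: sqrt2 * beta i; sqrt2 * beta i; k i; 'i * k i]`_j.

Definition mxA s k beta b : 'M[R[i]]_(4 + n) :=
  block_mx (mxA1 s k) (mxB1 k beta) (mxB2 k beta) (mxA2 b).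

(** [F^{-1} dF] evaluated on the tangent vector at [p] with coordinates [v]. *)
Definition maurer_cartan (M : riemann_surface R) (z : chart R M)
    (F : M -> 'M[R]_(4 + n)) (p : M) (v : R * R) : 'M[R]_(4 + n) :=
  invmx (F p) *m dreal z v F p.

Definition mc_form (M : riemann_surface R) (z : chart R M)
    (F : M -> 'M[R]_(4 + n)) (s : M -> R[i]) (k beta : M -> 'I_n -> R[i])
    (b : M -> 'I_n -> 'I_n -> R[i]) : Prop :=
  forall p, cdom z p ->
    (forall j l, b p j l + b p l j = 0) /\
    (forall v : R * R,
       let dz := v.1 +i* v.2 in
       let dzbar := conjc dz in
       let A := mxA (s p) (k p) (beta p) (b p) in
       cplx (maurer_cartan z F p v) = dz *: A + dzbar *: conjmx A).

End MaurerCartan.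

(* Main.v *)
Require Import Defs.
From HB Require Import structures.
From mathcomp Require Import all_boot all_order all_algebra.
From mathcomp Require Import complex.
From mathcomp Require Import all_classical all_reals all_analysis.
From mathcomp Require Import ring lra zify.
Set Implicit Arguments.
Unset Strict Implicit.
Unset Printing Implicit Defensive.
Import Order.TTheory GRing.Theory Num.Theory.
Import numFieldNormedType.Exports.
Local Open Scope classical_set_scope.
Local Open Scope complex_scope.
Local Open Scope ring_scope.

(** Both directions come from one device: when a Lorentz product of two fields is
    constant, a derivative may be moved from one factor to the other with a
    change of sign ([lip_mdir_cst], [lip_derive_cst]).

    From the immersion to the frame.  The products of [Y], [N], [Y_z], [Y_zbar]
    and [psi_j] make the adapted frame [F] an isometry.  It has positive
    determinant because [V] and its complement carry compatible orientations, and
    its first column points to the future because [Y] and [N] are null with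
    negative product; these two signs characterize the identity component of the
    isometry group ([SOplus_criterion]).  Since the inverse of an isometry is its
    Lorentz adjoint, the entries of [F^-1 F_z] are, up to sign, the products of a
    column of [F] with the derivative of another one.  Moving derivatives reduces
    each of them to the defining relations and to the single computation
    [<Y_zzbar, Y_zzbar> = sum_j |k_j|^2] ([lip_yzb_yzb]), which rests on the
    symmetry of second derivatives.  It yields [N = 2 Y_zzbar + 2 k^2 Y] ([nE]), so
    that [N_z] has normal components [2 beta_j]; this explains the entries
    [sqrt 2 beta_j].  As [F] is real, the [dzbar] part of the form is the
    conjugate of the [dz] part.

    From the frame to the immersion.  The vector [x = phi_1 - phi_2] is null, and
    it cannot leave the forward cone along the identity component
    ([SOplus_null_lightcone]).  The Maurer-Cartan form says that
    [dx = sqrt 2 (phi_3 du + phi_4 dv)] and that [x] is orthogonal to the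
    derivatives of the [psi_j].  Any lift of the class of [x] is a positive
    multiple [t x]; in any coordinate its derivative is read off from its products
    with the frame, without differentiating [t] ([lift_derivative]): up to a
    multiple of [x] it is [t] times [dx], so conformality follows from the
    Cauchy-Riemann equations of the change of coordinate.  The same products show
    that [Y_zzbar] is orthogonal to the [psi_j] ([lip_laplacian_psi]), hence that [N]
    is, and [V] is spanned by the [phi_a].  The basis [Y, N, Y_u, Y_v] arises from
    the [phi_a] by a block triangular matrix of positive determinant
    ([ospan_lightlike_basis]), which settles the orientation.  Finally
    [(phi_1 - phi_2) / sqrt 2] is a canonical lift with dual
    [(phi_1 + phi_2) / sqrt 2], so that the conformal Gauss map is not empty. *)

(** * The Lorentz form and its isometries *)

Section LorentzForm.
Variables (T : comNzRingType) (m : nat).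
Implicit Types (x y u : 'cV[T]_m.+1) (a : T).

Lemma lipC x y : lip x y = lip y x.
Proof. by rewrite /lip mulrC; congr (_ + _); apply: eq_bigr => j _; rewrite mulrC. Qed.

Lemma lipDl x y u : lip (x + y) u = lip x u + lip y u.
Proof.
rewrite /lip mxE mulrDl opprD addrACA -big_split/=; congr (_ + _).
by apply: eq_bigr => j _; rewrite mxE mulrDl.
Qed.

Lemma lipZl a x u : lip (a *: x) u = a * lip x u.
Proof.
rewrite /lip mxE mulrDr mulrN mulrA mulr_sumr; congr (_ + _).
by apply: eq_bigr => j _; rewrite mxE mulrA.
Qed.

Lemma lipDr x y u : lip u (x + y) = lip u x + lip u y.
Proof. by rewrite lipC lipDl !(lipC u). Qed.

Lemma lipZr a x u : lip u (a *: x) = a * lip u x.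
Proof. by rewrite lipC lipZl (lipC u). Qed.

Lemma lipNl x u : lip (- x) u = - lip x u.
Proof. by rewrite -scaleN1r lipZl mulN1r. Qed.

Lemma lipNr x u : lip u (- x) = - lip u x.
Proof. by rewrite -scaleN1r lipZr mulN1r. Qed.

Lemma lipBl x y u : lip (x - y) u = lip x u - lip y u.
Proof. by rewrite lipDl lipNl. Qed.

Lemma lipBr x y u : lip u (x - y) = lip u x - lip u y.
Proof. by rewrite lipDr lipNr. Qed.

Lemma lip0l u : lip 0 u = 0.
Proof. by rewrite -(scale0r (0 : 'cV[T]_m.+1)) lipZl mul0r. Qed.

Lemma lip0r u : lip u 0 = 0.
Proof. by rewrite lipC lip0l. Qed.

Lemma lip_suml (I : Type) (r : seq I) (P : pred I) (f : I -> 'cV[T]_m.+1) u :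
  lip (\sum_(i <- r | P i) f i) u = \sum_(i <- r | P i) lip (f i) u.
Proof.
by elim/big_rec2: _ => [|i a x _ <-]; rewrite ?lip0l // lipDl.
Qed.

Lemma lip_sumr (I : Type) (r : seq I) (P : pred I) (f : I -> 'cV[T]_m.+1) u :
  lip u (\sum_(i <- r | P i) f i) = \sum_(i <- r | P i) lip u (f i).
Proof. by rewrite lipC lip_suml; apply: eq_bigr => i _; rewrite lipC. Qed.

Lemma lip_orthonormal n (p : 'I_n -> 'cV[T]_m.+1) (c : 'I_n -> T) j :
  (forall l, lip (p j) (p l) = (j == l)%:R) -> lip (p j) (\sum_l c l *: p l) = c j.
Proof.
move=> pp; rewrite lip_sumr (bigD1 j) //= big1 => [|l lj].
  by rewrite lipZr pp eqxx mulr1 addr0.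
by rewrite lipZr pp eq_sym (negPf lj) mulr0.
Qed.

Lemma I1_sqr : I1 T m *m I1 T m = 1%:M.
Proof.
rewrite /I1 mulmx_diag -diag_const_mx; congr diag_mx.
by apply/rowP => j; rewrite !mxE; case: ifP => _; rewrite ?mulrNN mulr1.
Qed.

Lemma I1_mulE p (B : 'M[T]_(m.+1, p)) i j :
  (I1 T m *m B) i j = (if i == 0 then -1 else 1) * B i j.
Proof. by rewrite mul_diag_mx !mxE. Qed.

Lemma lip_gram p q (A : 'M[T]_(m.+1, p)) (B : 'M[T]_(m.+1, q)) i j :
  (A^T *m I1 T m *m B) i j = lip (col i A) (col j B).
Proof.
rewrite -mulmxA mxE big_ord_recl I1_mulE eqxx mulN1r mulrN /lip !mxE.
by congr (_ + _); apply: eq_bigr => l _; rewrite I1_mulE /= mul1r !mxE.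
Qed.

Lemma lipE x y : lip x y = (x^T *m I1 T m *m y) 0 0.
Proof. by rewrite lip_gram !col_id. Qed.

Lemma lip_delta_l i x :
  lip (delta_mx i 0) x = (if i == 0 then -1 else 1) * x i 0.
Proof.
rewrite lipE trmx_delta -mulmxA mxE (bigD1 i)//= big1 => [|j ji]; last first.
  by rewrite mxE (negPf ji) mul0r.
by rewrite I1_mulE mxE !eqxx mul1r addr0.
Qed.

End LorentzForm.

Lemma mulmx_ext (T : nzRingType) p q (A B : 'M[T]_(p, q)) :
  (forall x : 'cV[T]_q, A *m x = B *m x) -> A = B.
Proof.
by move=> AB; apply/matrixP => i j; have := AB (delta_mx j 0);
  rewrite -!colE => /colP/(_ i); rewrite !mxE.
Qed.

Section Isometries.
Variables (R : realType) (m : nat).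
Implicit Types (A B : 'M[R]_m.+1) (x y v : 'cV[R]_m.+1).

Lemma isometriesP A : isometries A <-> A^T *m I1 R m *m A = I1 R m.
Proof.
split=> [AI|AI x y].
  apply/matrixP => i j; rewrite lip_gram !colE AI lip_delta_l !mxE eqxx andbT.
  by case: (i == j); rewrite ?mulr1 ?mulr0.
by rewrite !lipE trmx_mul -!mulmxA (mulmxA A^T) (mulmxA _ A) AI mulmxA.
Qed.

Lemma isometries1 : isometries (1%:M : 'M[R]_m.+1).
Proof. by move=> x y; rewrite !mul1mx. Qed.

Lemma isometriesM A B : isometries A -> isometries B -> isometries (A *m B).
Proof. by move=> AI BI x y; rewrite -!mulmxA AI BI. Qed.

Lemma det_isometry A : isometries A -> \det A ^+ 2 = 1.
Proof.
move=> /isometriesP/(congr1 determinant); rewrite !det_mulmx det_tr.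
have J2 : \det (I1 R m) * \det (I1 R m) = 1 by rewrite -det_mulmx I1_sqr det1.
by move=> e; rewrite -[RHS]J2 -[X in _ = X * _]e -[LHS]mulr1 -J2; ring.
Qed.

Lemma isometry_unit A : isometries A -> A \in unitmx.
Proof.
move=> /det_isometry d; rewrite unitmxE unitfE.
by apply/eqP => d0; move: d; rewrite d0 expr0n/= => /esym/eqP; rewrite oner_eq0.
Qed.

(** The inverse of an isometry is its adjoint for the Lorentz form. *)
Lemma invmx_isometry A : isometries A -> invmx A = I1 R m *m A^T *m I1 R m.
Proof.
move=> AI; have /isometriesP e := AI; have u := isometry_unit AI.
by rewrite -[RHS](mulmxK u) -!mulmxA (mulmxA A^T) (mulmxA _ A) e mulmxA I1_sqr mul1mx.
Qed.

Lemma isometriesV A : isometries A -> isometries (invmx A).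
Proof.
move=> AI x y; rewrite -(AI (invmx A *m x)) !mulmxA mulmxV ?mul1mx //.
exact: isometry_unit.
Qed.

Definition reflection v : 'M[R]_m.+1 :=
  1%:M - (2 / lip v v) *: (v *m (v^T *m I1 R m)).

Lemma reflectionE v x : reflection v *m x = x - (2 * lip v x / lip v v) *: v.
Proof.
rewrite mulmxBl mul1mx -scalemxAl; congr (_ - _).
rewrite -mulmxA [v^T *m _ *m x]mx11_scalar -lipE.
by rewrite mul_mx_scalar scalerA; congr (_ *: _); rewrite mulrAC.
Qed.

Lemma reflection_isometry v : lip v v != 0 -> isometries (reflection v).
Proof.
move=> v0 x y; rewrite !reflectionE !(lipBl, lipBr, lipZl, lipZr) (lipC x v).
by field.
Qed.

Lemma reflectionK v : lip v v != 0 -> reflection v *m reflection v = 1%:M.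
Proof.
move=> v0; apply: mulmx_ext => x; rewrite mul1mx -mulmxA !reflectionE.
rewrite lipBr lipZr -addrA -opprD -scalerDl.
rewrite [X in X *: _](_ : _ = 0) ?scale0r ?subr0 //; by field.
Qed.

Lemma reflection_entry v i j : reflection v i j =
  (i == j)%:R - 2 / lip v v * (v i 0 * (v j 0 * (if j == 0 then -1 else 1))).
Proof.
rewrite !mxE; congr (_ - _ * _); rewrite big_ord1; congr (_ * _).
by rewrite mul_mx_diag !mxE.
Qed.

End Isometries.

(** * Continuity of matrix-valued functions *)

Section Continuity.
Variables (R : realType) (T : topologicalType).

Lemma continuous_mx p q (f : T -> 'M[R]_(p, q)) x :
  (forall i j, {for x, continuous (fun t => f t i j)}) -> {for x, continuous f}.
Proof.
move=> fc; apply/cvgrPdist_le => /= e e0; near=> t.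
rewrite /Num.Def.normr/= mx_normrE (bigmax_le _ (ltW e0))//= => i _.
rewrite !mxE; move: i; near: t; apply: filter_forall => /= i.
exact: ((cvgrPdist_le _ _).1 (fc i.1 i.2)).
Unshelve. all: by end_near. Qed.

Lemma continuous_entry p q (f : T -> 'M[R]_(p, q)) x i j :
  {for x, continuous f} -> {for x, continuous (fun t => f t i j)}.
Proof.
move=> fc; apply: (@continuous_comp _ _ _ f (fun M => M i j)) => //.
exact: coord_continuous.
Qed.

Lemma continuous_sumr (I : Type) (r : seq I) (F : I -> T -> R) x :
  (forall i, {for x, continuous (F i)}) ->
  {for x, continuous (fun t => \sum_(i <- r) F i t)}.
Proof. by move=> Fc; apply: (cvg_big _ _ (fun i _ => Fc i)); exact: add_continuous. Qed.

Lemma continuous_prodr (I : Type) (r : seq I) (F : I -> T -> R) x :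
  (forall i, {for x, continuous (F i)}) ->
  {for x, continuous (fun t => \prod_(i <- r) F i t)}.
Proof. by move=> Fc; apply: (cvg_big _ _ (fun i _ => Fc i)); exact: mul_continuous. Qed.

Lemma continuous_mulmx p q r (f : T -> 'M[R]_(p, q)) (g : T -> 'M[R]_(q, r)) x :
  {for x, continuous f} -> {for x, continuous g} ->
  {for x, continuous (fun t => f t *m g t)}.
Proof.
move=> fc gc; apply: continuous_mx => i j.
rewrite (_ : (fun _ => _) = (fun t => \sum_k f t i k * g t k j)); last first.
  by apply/funext => t; rewrite mxE.
apply: continuous_sumr => k; apply: continuousM.
  exact: continuous_entry.
exact: continuous_entry.
Qed.

Lemma continuous_det p (f : T -> 'M[R]_p) x :
  {for x, continuous f} -> {for x, continuous (fun t => \det (f t))}.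
Proof.
move=> fc; apply: continuous_sumr => s; apply: continuousM.
  exact: cst_continuous.
by apply: continuous_prodr => i; exact: continuous_entry.
Qed.

Lemma continuous_lip m (v : T -> 'cV[R]_m.+1) x :
  {for x, continuous v} -> {for x, continuous (fun t => lip (v t) (v t))}.
Proof.
move=> vc; have vic i : {for x, continuous (fun t => v t i 0)}.
  exact: continuous_entry.
apply: continuousD; first by apply: continuousN; exact: continuousM.
by apply: continuous_sumr => i; exact: continuousM.
Qed.

Lemma continuous_reflection m (v : T -> 'cV[R]_m.+1) x :
  lip (v x) (v x) != 0 -> {for x, continuous v} ->
  {for x, continuous (fun t => reflection (v t))}.
Proof.
move=> v0 vc; have vic i : {for x, continuous (fun t => v t i 0)}.
  exact: continuous_entry.
apply: continuous_mx => i j.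
rewrite (_ : (fun _ => _) = (fun t => (i == j)%:R - 2 / lip (v t) (v t) *
    (v t i 0 * (v t j 0 * (if j == 0 then -1 else 1))))); last first.
  by apply/funext => t; rewrite reflection_entry.
apply: continuousB; first exact: cst_continuous.
apply: continuousM.
  apply: continuousM; first exact: cst_continuous.
  by apply: continuousV => //; exact: continuous_lip.
apply: continuousM => //; apply: continuousM => //; exact: cst_continuous.
Qed.

End Continuity.

(** * The identity component of the isometry group *)

Lemma connected_gt0 (R : realType) (T : topologicalType) (C : set T) (h : T -> R) x0 x :
  connected C -> continuous h -> (forall y, C y -> h y != 0) ->
  C x0 -> 0 < h x0 -> C x -> 0 < h x.
Proof.
move=> Cc hc h0 Cx0 hx0 Cx; have := h0 x Cx; rewrite neq_lt => /orP[hx|//].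
have /connected_intervalP hI : connected (h @` C).
  by apply: connected_continuous_connected => //; exact: continuous_subspaceT.
have /hI : (h @` C) (h x) by exists x.
move=> /(_ (h x0)) /(_ (ex_intro2 _ _ x0 Cx0 erefl)) /(_ 0).
by rewrite !ltW// => /(_ isT)[y /h0/eqP].
Qed.

Section IdentityComponent.
Variables (R : realType) (m : nat).
Implicit Types (A B : 'M[R]_m.+1) (a b : 'cV[R]_m.+1).

Lemma SOplus_isometry A : SOplus A -> isometries A.
Proof. exact: connected_component_sub. Qed.

Lemma SOplus1 : SOplus (1%:M : 'M[R]_m.+1).
Proof. exact/connected_component_refl/isometries1. Qed.

(** Left translation by [A] maps the identity component onto a connected set of
    isometries that contains [A]. *)
Lemma SOplusM A B : SOplus A -> SOplus B -> SOplus (A *m B).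
Proof.
move=> SA SB; apply: (connected_component_trans SA).
have : (mulmx A @` @SOplus R m) (A *m B) by exists B.
apply: connected_component_max.
- by exists 1%:M; [exact: SOplus1 | rewrite mulmx1].
- move=> _ [C SC <-].
  by apply: isometriesM; exact: SOplus_isometry.
- apply: connected_continuous_connected; first exact: component_connected.
  apply: continuous_subspaceT => C; apply: continuous_mulmx.
    exact: cst_continuous.
  exact: cvg_id.
Qed.

Lemma SOplus_path (g : R -> 'M[R]_m.+1) :
  (forall t, 0 <= t <= 1 -> {for t, continuous g} /\ isometries (g t)) ->
  g 0 = 1%:M -> SOplus (g 1).
Proof.
move=> gP g0; have : (g @` [set` `[0, 1]]) (g 1).
  by exists 1 => //=; rewrite in_itv/= ler01 lexx.
apply: connected_component_max.
- by exists 0 => //=; rewrite in_itv/= ler01 lexx.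
- by move=> _ [t ti <-]; move: ti; rewrite /= in_itv/= => /gP[].
- apply: connected_continuous_connected; first exact: segment_connected.
  apply: continuous_in_subspaceT => t; rewrite inE/= in_itv/= => /gP[gc _].
  exact: gc.
Qed.

Lemma det_SOplus A : SOplus A -> 0 < \det A.
Proof.
apply: (@connected_gt0 _ _ _ (fun A : 'M[R]_m.+1 => \det A) 1%:M).
- exact: component_connected.
- by move=> B; apply: continuous_det; exact: cvg_id.
- move=> B /SOplus_isometry/det_isometry d.
  by apply/eqP => d0; move: d; rewrite d0 expr0n/= => /esym/eqP; rewrite oner_eq0.
- exact: SOplus1.
- by rewrite det1 ltr01.
Qed.

(** The vector [v t] runs through the segment from [a] to [b]; the bound on
    [e * lip a b] keeps it away from the null cone.  The product of the reflections
    in [v t] and in [v (t / 2)] starts at the identity; at [t = 1] the reflection in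
    [(a + b) / 2] takes [a] to [- b], which the reflection in [b] takes to [b]. *)
Lemma SOplus_transport a b e :
  e * e = 1 -> lip a a = e -> lip b b = e -> -1 < e * lip a b ->
  exists B, [/\ SOplus B, B *m a = b &
    forall x : 'cV[R]_m.+1, lip a x = 0 -> lip b x = 0 -> B *m x = x].
Proof.
move=> ee aa bb ab.
pose v (t : R) := (1 - t) *: a + t *: b.
have vv t : e * lip (v t) (v t) = (1 - 2 * t) ^+ 2 + 2 * t * (1 - t) * (1 + e * lip a b).
  rewrite /v !(lipDl, lipDr, lipZl, lipZr) aa bb (lipC b a) mulrDr.
  transitivity (e * e * ((1 - t) ^+ 2 + t ^+ 2) + 2 * t * (1 - t) * (e * lip a b)); first by ring.
  by rewrite ee; ring.
have v0 (t : R) : 0 <= t <= 1 -> lip (v t) (v t) != 0.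
  move=> /andP[t0 t1]; apply/eqP => vt0.
  have := vv t; rewrite vt0 mulr0 => /esym h.
  have [t12|t12] := eqVneq (1 - 2 * t) 0.
    have t2 : t = 2^-1 by lra.
    by rewrite t2 in h; lra.
  have : 0 < (1 - 2 * t) ^+ 2 by rewrite exprn_even_gt0.
  have : 0 <= 2 * t * (1 - t) * (1 + e * lip a b) by rewrite !mulr_ge0 //; lra.
  by lra.
have vc (f : R -> R) t : {for t, continuous f} -> {for t, continuous (fun u => v (f u))}.
  move=> fc; apply: continuous_mx => i j.
  rewrite (_ : (fun _ => _) = (fun u => (1 - f u) * a i j + f u * b i j)); last first.
    by apply/funext => u; rewrite !mxE.
  apply: continuousD; apply: continuousM => //; try exact: cst_continuous.
  by apply: continuousB => //; exact: cst_continuous.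
pose g t := reflection (v t) *m reflection (v (t / 2)).
exists (g 1); split.
- apply: SOplus_path.
    move=> t t01; have t201 : 0 <= t / 2 <= 1 by lra.
    split; last by apply: isometriesM; apply: reflection_isometry; exact: v0.
    apply: continuous_mulmx; apply: continuous_reflection; try exact: v0.
      by apply: (vc id); exact: cvg_id.
    by apply: vc; apply: continuousM; [exact: cvg_id | exact: cst_continuous].
  by rewrite /g mul0r reflectionK // v0 // lexx ler01.
- rewrite /g -mulmxA !reflectionE.
  have h1 : lip (v (1 / 2)) a = lip (v (1 / 2)) (v (1 / 2)).
    rewrite /v !(lipDl, lipDr, lipZl, lipZr) aa bb (lipC b a); by field.
  have h01 : 0 <= (1 / 2 : R) <= 1 by lra.
  rewrite h1 mulfK ?v0 //.
  have -> : a - 2 *: v (1 / 2) = - b.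
    rewrite /v scalerDr !scalerA opprD addrA.
    have -> : 2 * (1 - 1 / 2) = 1 :> R by field.
    have -> : 2 * (1 / 2) = 1 :> R by field.
    by rewrite !scale1r subrr sub0r.
  have -> : v 1 = b by rewrite /v subrr scale0r add0r scale1r.
  rewrite lipNr mulrN mulNr scaleNr opprK mulfK; last first.
    by rewrite bb; apply/eqP => e0; move: ee; rewrite e0 mul0r => /esym/eqP; rewrite oner_eq0.
  by rewrite scaler_nat mulr2n addrA addNr add0r.
- move=> x ax bx; have vx t : lip (v t) x = 0.
    by rewrite lipDl !lipZl ax bx !mulr0 addr0.
  by rewrite /g -mulmxA !reflectionE !(vx, mulr0, mul0r, scale0r, subr0).
Qed.

(** The form is positive definite on the vectors without time component. *)
Lemma lip_self_le0 (x : 'cV[R]_m.+1) : x 0 0 = 0 -> lip x x <= 0 -> x = 0.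
Proof.
move=> x0; rewrite /lip x0 mulr0 oppr0 add0r => xle.
have xx0 j : 0 <= x (lift 0 j) 0 * x (lift 0 j) 0 by rewrite -expr2 sqr_ge0.
have /eqP : \sum_(j < m) x (lift 0 j) 0 * x (lift 0 j) 0 = 0.
  by apply/eqP; rewrite eq_le xle sumr_ge0.
rewrite psumr_eq0 // => /allP h; apply/colP => i; rewrite mxE.
have [-> //|i0] := eqVneq i 0.
have [j ->] : exists j, i = lift 0 j.
  by case: (unliftP 0 i) i0 => [j -> _|->]; [exists j | rewrite eqxx].
by have := h j (mem_index_enum j); rewrite mulf_eq0 orbb => /eqP.
Qed.

Let e (i : 'I_m.+1) : 'cV[R]_m.+1 := delta_mx i 0.
Let sg (i : 'I_m.+1) : R := if i == 0 then -1 else 1.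

Let lip_e i j : lip (e i) (e j) = sg i * (i == j)%:R.
Proof. by rewrite lip_delta_l mxE eqxx andbT. Qed.

Let lip_ee i : lip (e i) (e i) = sg i.
Proof. by rewrite lip_e eqxx mulr1. Qed.

Let lip_ne i j : i != j -> lip (e i) (e j) = 0.
Proof. by move=> ij; rewrite lip_e (negPf ij) mulr0. Qed.

Let sg2 i : sg i * sg i = 1.
Proof. by rewrite /sg; case: ifP; rewrite ?mulrNN mulr1. Qed.

(** The direct transport of [e j] to [A *m e j] fails only if [A *m e j = - e j],
    which the sign of [A 0 0] excludes for [j = 0].  It is then made in two steps
    through the next basis vector; for the last index there is none, but [A] would
    be the reflection [diag (1, .., 1, -1)], of negative determinant. *)
Lemma SOplus_column A (j : 'I_m.+1) :
  isometries A -> 0 < \det A -> (j = 0 -> 0 < A 0 0) ->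
  (forall i : 'I_m.+1, (i < j)%N -> A *m e i = e i) ->
  exists B, [/\ SOplus B, B *m e j = A *m e j &
    forall i : 'I_m.+1, (i < j)%N -> B *m e i = e i].
Proof.
move=> AI dA A00 Aei; set b := A *m e j.
have eb (i : 'I_m.+1) : (i < j)%N -> lip b (e i) = 0.
  by move=> ij; rewrite -(Aei _ ij) AI lip_ne // -val_eqE/= gtn_eqF.
have bb : lip b b = sg j by rewrite AI lip_ee.
have je (i : 'I_m.+1) : (i < j)%N -> lip (e j) (e i) = 0.
  by move=> ij; rewrite lip_ne // -val_eqE/= gtn_eqF.
have [jb|jb] := ltP (-1) (sg j * lip (e j) b).
  have [B [SB Bj Bf]] := SOplus_transport (sg2 j) (lip_ee j) bb jb.
  by exists B; split=> // i ij; apply: Bf; [exact: je | exact: eb].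
have j0 : j != 0.
  apply/eqP => j0; move: jb; rewrite lip_delta_l /sg j0 eqxx mulrA mulrNN !mul1r.
  by rewrite /b -colE mxE j0; have := A00 j0; lra.
have sj : sg j = 1 by rewrite /sg (negPf j0).
have j0' : (0 < j)%N by rewrite lt0n.
have bE : b = - e j.
  apply/eqP; rewrite -addr_eq0; apply/eqP; apply: lip_self_le0.
    have := eb 0 j0'; rewrite lipC lip_delta_l eqxx mulN1r => /eqP; rewrite oppr_eq0 => /eqP b0.
    by rewrite mxE b0 add0r mxE eq_sym (negPf j0).
  rewrite !(lipDl, lipDr) bb lip_ee (lipC b) sj; move: jb; rewrite sj mul1r; lra.
have [jm|jm] := ltnP j m.
  pose c := e (inord j.+1).
  have jc : inord j.+1 != j :> 'I_m.+1.
    by rewrite -val_eqE/= inordK ?ltnS// gtn_eqF.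
  have sc : sg (inord j.+1) = 1 by rewrite /sg -val_eqE/= inordK ?ltnS.
  have cc : lip c c = sg j by rewrite lip_ee sc sj.
  have ejc : lip (e j) c = 0 by rewrite lip_ne // eq_sym.
  have cb : lip c b = 0 by rewrite bE lipNr lipC ejc oppr0.
  have ce (i : 'I_m.+1) : (i < j)%N -> lip c (e i) = 0.
    move=> ij; rewrite lip_ne // -val_eqE/= inordK ?ltnS//.
    by rewrite gtn_eqF // (leq_trans ij).
  have [|B1 [S1 B1j B1f]] := SOplus_transport (sg2 j) (lip_ee j) cc.
    by rewrite ejc mulr0; lra.
  have [|B2 [S2 B2j B2f]] := SOplus_transport (sg2 j) cc bb.
    by rewrite cb mulr0; lra.
  exists (B2 *m B1); split; first exact: SOplusM.
    by rewrite -mulmxA B1j B2j.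
  by move=> i ij; rewrite -mulmxA B1f ?B2f ?je ?ce ?eb.
have jM : j = ord_max by apply/val_inj/eqP; rewrite eqn_leq jm -ltnS ltn_ord.
exfalso; move: dA.
rewrite (_ : A = diag_mx (\row_i (if i == ord_max then -1 else 1))).
  rewrite det_diag big_ord_recr/= mxE eqxx big1 => [|i _]; first by rewrite mul1r; lra.
  rewrite mxE ifF //; apply/negbTE; rewrite -val_eqE/=; have := ltn_ord i; lia.
apply/matrixP => p q.
have -> : A p q = (A *m e q) p 0 by rewrite -colE mxE.
have [qj|qj] := eqVneq q j.
  rewrite qj -/b bE jM !mxE; have [pm|pm] := boolP (p == ord_max).
    by rewrite eqxx.
  by rewrite /= mulr0n oppr0.
rewrite Aei; last by move: qj; rewrite jM -val_eqE/=; have := ltn_ord q; lia.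
rewrite -jM !mxE eqxx andbT; have [pq|//] := boolP (p == q).
by rewrite (eqP pq) (negPf qj).
Qed.

(** Composing [A] with elements of the identity component makes it fix the basis
    vectors one after the other. *)
Lemma SOplus_criterion A :
  isometries A -> 0 < \det A -> 0 < A 0 0 -> SOplus A.
Proof.
move=> AI dA A00.
suff H : forall d (j : nat), (j + d = m.+1)%N -> forall A, isometries A -> 0 < \det A ->
    (j = 0%N -> 0 < A 0 0) -> (forall i : 'I_m.+1, (i < j)%N -> A *m e i = e i) -> SOplus A.
  by apply: (H m.+1 0%N).
elim=> [|d IH] j jd {}A {}AI {}dA {}A00 Ae.
  rewrite (_ : A = 1%:M); first exact: SOplus1.
  apply/matrixP => p q; have := Ae q; rewrite -colE => /(_ _)/colP/(_ p).
  by rewrite !mxE eqxx andbT => -> //; have := ltn_ord q; lia.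
have jm : (j < m.+1)%N by lia.
have [|B [SB Bj Bi]] := @SOplus_column A (Ordinal jm) AI dA _ Ae.
  by move=> /(congr1 val)/= /A00.
have BI := SOplus_isometry SB; have Bu := isometry_unit BI.
rewrite -(mul1mx A) -(mulmxV Bu) -mulmxA; apply: SOplusM => //.
have fixB x : A *m x = B *m x -> invmx B *m A *m x = x.
  by move=> ABx; rewrite -mulmxA ABx mulmxA mulVmx // mul1mx.
have fixe (i : 'I_m.+1) : (i < j.+1)%N -> invmx B *m A *m e i = e i.
  rewrite ltnS leq_eqVlt => /orP[/eqP ij|ij]; apply: fixB; last by rewrite Ae // Bi.
  by rewrite (_ : i = Ordinal jm) //; exact: val_inj.
apply: (IH j.+1) => //.
- by lia.
- by apply: isometriesM => //; exact: isometriesV.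
- rewrite det_mulmx det_inv mulr_gt0 // invr_gt0; exact: det_SOplus.
Qed.

End IdentityComponent.

(** * Symmetry of second derivatives *)

Section MixedDerivatives.
Variables (R : realType) (V : normedModType R).
Implicit Types (f g : V -> R) (a v w q x : V).

Lemma differentiable_estimate g q (eps : R) : differentiable g q -> 0 < eps ->
  exists2 d, 0 < d & forall x, `|x| < d ->
    `|g (x + q) - g q - 'd g q x| <= eps * `|x|.
Proof.
move=> /diff_locally/eqaddoP/(_ eps) h e0.
have /nbhs_ballP[d d0 dh] := h e0.
exists d => // x xd; have /dh : ball 0 d x by rewrite -ball_normE/= sub0r normrN.
rewrite /= !fctE opprD addrA; exact.
Qed.

Lemma is_derive_line f a v (t : R) : differentiable f (t *: v + a) ->
  is_derive t 1 (fun u : R => f (u *: v + a)) ('D_v f (t *: v + a)).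
Proof.
move=> df.
have e : (fun h : R => h^-1 *: (f ((h *: 1 + t) *: v + a) - f (t *: v + a))) =
    (fun h : R => h^-1 *: (f (h *: v + (t *: v + a)) - f (t *: v + a))).
  by apply/funext => h; rewrite addrA -scalerDl [h *: 1]mulr1.
have dv : derivable f (t *: v + a) v by exact: diff_derivable.
apply: DeriveDef; first by rewrite /derivable e.
by rewrite /derive e.
Qed.

Let second_difference f q v w (h : R) :=
  f (h *: v + (h *: w + q)) - f (h *: v + q) - (f (h *: w + q) - f q).

(** The mean value theorem in the direction [v] turns the second difference into a
    difference of two values of ['D_v f], which are compared through the value of
    the differential of ['D_v f] at [q]. *)
Lemma second_difference_estimate f q v (w : V) (eps : R) :
  (\forall x \near q, differentiable f x) ->
  differentiable (fun x => 'D_v f x) q -> 0 < eps ->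
  exists2 d, 0 < d & forall h, 0 < h < d ->
    `|second_difference f q v w h - h ^+ 2 * 'D_w (fun x => 'D_v f x) q| <=
    eps * h ^+ 2.
Proof.
move=> /nbhs_ballP[r r0 fr] + e0; have [g gE] : exists g, g = (fun x => 'D_v f x) by eexists.
rewrite -gE => dg; have gx x : g x = 'D_v f x by rewrite gE.
set N : R := `|v| + `|w| + 1.
have N0 : 0 < N by rewrite ltr_wpDl // addr_ge0.
have [|d d0 dP] := differentiable_estimate dg (_ : 0 < eps / (2 * N)).
  by rewrite divr_gt0 // mulr_gt0.
exists (Num.min (d / N) (r / N)); first by rewrite lt_min !divr_gt0.
move=> h /andP[h0]; rewrite lt_min !ltr_pdivlMr // => /andP[hd hr].
have small (t s : R) : 0 <= t <= h -> 0 <= s <= h -> `|t *: v + s *: w| <= h * N.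
  move=> /andP[t0 th] /andP[s0 sh]; rewrite (le_trans (ler_normD _ _)) // !normrZ !ger0_norm //.
  rewrite /N !mulrDr mulr1 -[leLHS]addr0 lerD ?(ltW h0)//.
  by rewrite lerD // ler_wpM2r.
have dfr (t s : R) : 0 <= t <= h -> 0 <= s <= h -> differentiable f (t *: v + (s *: w + q)).
  move=> th sh; apply: fr; rewrite -ball_normE/= addrA addrC opprD addrA subrr sub0r normrN.
  exact: le_lt_trans (small _ _ th sh) hr.
pose phi t := f (t *: v + (h *: w + q)) - f (t *: v + q).
have dphi t : 0 <= t <= h -> is_derive t 1 phi (g (t *: v + (h *: w + q)) - g (t *: v + q)).
  move=> th; rewrite !gx; apply: is_deriveB; apply: is_derive_line.
    by apply: dfr => //; rewrite (ltW h0) lexx.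
  by have := @dfr t 0 th; rewrite scale0r add0r; apply; rewrite lexx ltW.
have [||t th phiE] := @MVT_segment _ phi (fun t => g (t *: v + (h *: w + q)) - g (t *: v + q)) 0 h (ltW h0).
- by move=> t; rewrite in_itv/= => /andP[/ltW ? /ltW ?]; apply: dphi; apply/andP.
- apply: continuous_in_subspaceT => t; rewrite inE/= in_itv/= => th.
  apply: differentiable_continuous; apply/derivable1_diffP.
  exact: (@ex_derive _ _ _ _ _ _ _ (dphi t th)).
have {}th : 0 <= t <= h by move: th; rewrite in_itv.
have -> : second_difference f q v w h = phi h - phi 0.
  by rewrite /phi /second_difference !scale0r !add0r.
rewrite phiE subr0 (deriveE _ dg).
have hh : 0 <= h <= h by rewrite (ltW h0) lexx.
have h00 : 0 <= (0 : R) <= h by rewrite (ltW h0) lexx.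
have P1 := dP (t *: v + h *: w) (le_lt_trans (small _ _ th hh) hd).
have P2 := dP (t *: v + 0 *: w) (le_lt_trans (small _ _ th h00) hd).
have B1 : eps / (2 * N) * `|t *: v + h *: w| <= eps / 2 * h.
  have -> : eps / 2 * h = eps / (2 * N) * (h * N) by field; lra.
  by rewrite ler_pM2l ?divr_gt0 ?mulr_gt0 // small.
have B2 : eps / (2 * N) * `|t *: v + 0 *: w| <= eps / 2 * h.
  have -> : eps / 2 * h = eps / (2 * N) * (h * N) by field; lra.
  by rewrite ler_pM2l ?divr_gt0 ?mulr_gt0 // small.
have Ld s : 'd g q (t *: v + s *: w) = 'd g q (t *: v) + s * 'd g q w.
  by rewrite linearD; congr (_ + _); exact: linearZZ.
have {}P1 := le_trans P1 B1; have {}P2 := le_trans P2 B2.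
move: P1 P2; rewrite !Ld -!(addrA (t *: v)) scale0r add0r mul0r addr0.
 set x1 := g _; set x0 := g q; set x2 := g _.
set l := 'd g q (t *: v); set L := 'd g q w.
rewrite !ler_norml => /andP[P1 P1'] /andP[P2 P2'].
have -> : (x1 - x2) * h - h ^+ 2 * L = h * (x1 - x2 - h * L) by ring.
have -> : eps * h ^+ 2 = h * (eps * h) by ring.
by rewrite -mulrN !(ler_pM2l h0); apply/andP; split; lra.
Qed.

(** Both orders of differentiation compute the limit of the same symmetric
    second difference quotient. *)
Lemma mixed_derivatives f q v w :
  (\forall x \near q, differentiable f x) ->
  differentiable (fun x => 'D_v f x) q -> differentiable (fun x => 'D_w f x) q ->
  'D_w (fun x => 'D_v f x) q = 'D_v (fun x => 'D_w f x) q.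
Proof.
move=> df dv dw; apply/eqP; rewrite -subr_eq0 -normr_le0; apply/ler_addgt0Pr => eps e0.
rewrite add0r.
have e20 : 0 < eps / 2 by rewrite divr_gt0.
have [d d0 P] := @second_difference_estimate f q v w _ df dv e20.
have [d' d0' P'] := @second_difference_estimate f q w v _ df dw e20.
pose h := Num.min d d' / 2.
have m0 : 0 < Num.min d d' by rewrite lt_min d0.
have h0 : 0 < h by rewrite divr_gt0.
have : h < Num.min d d' by rewrite /h; lra.
rewrite lt_min => /andP[hd hd'].
have := P h; rewrite h0 hd => /(_ isT); have := P' h; rewrite h0 hd' => /(_ isT).
have -> : second_difference f q w v h = second_difference f q v w h.
  have swap (x1 x2 x3 x4 : R) : x1 - x2 - (x3 - x4) = x1 - x3 - (x2 - x4) by ring.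
  by rewrite /second_difference (addrCA (h *: w)) swap.
move: ('D_w _ q) ('D_v _ q) (second_difference _ _ _ _ _) => a b s.
rewrite !ler_norml => /andP[A1 A2] /andP[B1 B2].
have h2 : 0 < h ^+ 2 by rewrite exprn_gt0.
by apply/andP; split; rewrite -(ler_pM2l h2); lra.
Qed.

End MixedDerivatives.

(** * Functions of class C^k *)

Section ClassCk.
Variables (R : realType) (V W : normedModType R).
Implicit Types (U : set V) (f g : V -> W).

Lemma near_eq_differentiable f g q :
  (\near q, f q = g q) -> differentiable f q -> differentiable g q.
Proof.
move=> fg df; have L := diff_continuous df.
have /diff_locally/eqaddoP h := df.
have gE : g \o shift q = cst (g q) + 'd f q +o_ 0 id.
  apply/eqaddoP => eps e0; have := h eps e0.
  have fgq := nbhs_singleton fg.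
  apply: filter_app; have : \forall x \near 0, f (x + q) = g (x + q).
    by have := fg; rewrite (near_shift (0 : V) q)/= subr0.
  apply: filterS => x /= fgx.
  by rewrite !fctE /= fgx fgq.
by apply/diff_locallyP; rewrite (diff_unique L gE).
Qed.

Lemma Ck_eq_on k U f g : open U -> (forall x, U x -> f x = g x) ->
  Ck k U f -> Ck k U g.
Proof.
move=> oU; elim: k f g => [|k IH] f g fg /=.
  move=> fc x Ux; have nfg : \near x, f x = g x.
    by near=> y; apply: fg; near: y; exact: open_nbhs_nbhs.
  rewrite /prop_for /continuous_at -(fg x Ux); apply: cvg_trans (fc x Ux).
  by apply: near_eq_cvg; apply: filterS nfg.
move=> [df dk]; split=> [x Ux|v].
  apply: near_eq_differentiable (df x Ux).
  by near=> y; apply: fg; near: y; exact: open_nbhs_nbhs.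
apply: IH (dk v) => x Ux; apply: near_eq_derive.
by near=> y; apply: fg; near: y; exact: open_nbhs_nbhs.
Unshelve. all: by end_near. Qed.

Lemma Ck_differentiable k U f x : Ck k.+1 U f -> U x -> differentiable f x.
Proof. by move=> [df _] /df. Qed.

Lemma Ck_derive k U f v : Ck k.+1 U f -> Ck k U (fun x => 'D_v f x).
Proof. by case=> _; apply. Qed.

Lemma CkW k U f : Ck k.+1 U f -> Ck k U f.
Proof.
elim: k f => [|k IH] f [df dk].
  by move=> x Ux; apply: differentiable_continuous; exact: df.
by split=> // v; apply: IH; exact: dk.
Qed.

Lemma CkD k U f g : open U -> Ck k U f -> Ck k U g -> Ck k U (fun x => f x + g x).
Proof.
move=> oU; elim: k f g => [|k IH] f g /=.
  by move=> fc gc x Ux; apply: continuousD; [exact: fc | exact: gc].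
move=> [df dkf] [dg dkg]; split=> [x Ux|v].
  by apply: differentiableD; [exact: df | exact: dg].
apply: Ck_eq_on (IH _ _ (dkf v) (dkg v)) => // x Ux.
by rewrite [RHS]deriveD //; apply: diff_derivable; [exact: df | exact: dg].
Qed.

End ClassCk.

Section LinearMaps.
Variables (R : realType) (V W W' : normedModType R).
Implicit Types (U : set V) (f : V -> W).

Lemma derive_linear (L : {linear W -> W'}) f x v : continuous L ->
  differentiable f x -> 'D_v (fun y => L (f y)) x = L ('D_v f x).
Proof.
move=> Lc df; have dL y : differentiable L y by exact: linear_differentiable.
rewrite !deriveE //; last exact: differentiable_comp.
have -> : 'd (fun y => L (f y)) x v = ('d L (f x) \o 'd f x) v.
  by rewrite -diff_comp.
by rewrite /= diff_lin.
Qed.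

Lemma Ck_linear (L : {linear W -> W'}) k U f : continuous L -> open U ->
  Ck k U f -> Ck k U (fun x => L (f x)).
Proof.
move=> Lc oU; elim: k f => [|k IH] f /=.
  by move=> fc x Ux; apply: continuous_comp; [exact: fc | exact: Lc].
move=> [df dk]; split=> [x Ux|v].
  by apply: differentiable_comp; [exact: df | exact: linear_differentiable].
by apply: Ck_eq_on (IH _ (dk v)) => // x Ux; rewrite derive_linear //; exact: df.
Qed.

End LinearMaps.

Section MatrixValued.
Variables (R : realType) (V : normedModType R).
Implicit Types (U : set V).

Lemma Ck_mulmxr p q r k U (f : V -> 'M[R]_(p, q)) (C : 'M[R]_(q, r)) :
  open U -> Ck k U f -> Ck k U (fun x => f x *m C).
Proof.
move=> oU fk; apply: (@Ck_linear _ _ _ _ (mulmxr C)) => // A.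
by apply: continuous_mulmx; [exact: cvg_id | exact: cst_continuous].
Qed.

Lemma Ck_scale (W : normedModType R) k U (f : V -> W) (c : R) :
  open U -> Ck k U f -> Ck k U (fun x => c *: f x).
Proof.
move=> oU fk; apply: (@Ck_linear _ _ _ _ ( *:%R c)) => //; exact: scaler_continuous.
Qed.

Lemma Ck_entry p q k U (f : V -> 'M[R]_(p, q)) i j :
  open U -> Ck k U f -> Ck k U (fun x => f x i j).
Proof.
move=> oU fk.
have @L : {linear 'M[R]_(p, q) -> R}.
  by exists (fun N : 'M[R]_(_, _) => N i j); do 2![eexists]; do ?[constructor];
     rewrite ?mxE// => ? *; rewrite ?mxE//; move=> ?; rewrite !mxE.
apply: (@Ck_linear _ _ _ _ L) => //; exact: coord_continuous.
Qed.

Lemma derive_entry p q (f : V -> 'M[R]_(p, q)) x v i j : differentiable f x ->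
  'D_v f x i j = 'D_v (fun y => f y i j) x.
Proof. by move=> df; rewrite derive_mx ?mxE //; exact: diff_derivable. Qed.

Lemma differentiable_entry p q (f : V -> 'M[R]_(p, q)) x i j : differentiable f x ->
  differentiable (fun y => f y i j) x.
Proof.
move=> df; apply: (@differentiable_comp _ _ _ _ f (fun N : 'M[R]_(_, _) => N i j)) => //.
exact: differentiable_coord.
Qed.

End MatrixValued.

(** * Complex-valued functions on the plane *)

Section ComplexDerivatives.
Variable R : realType.
Local Notation plane := (R * R)%type.
Implicit Types (h g : plane -> R[i]) (q : plane) (w : R[i] * R[i]).

Definition cdiff h q :=
  differentiable (fun x => complex.Re (h x)) q /\
  differentiable (fun x => complex.Im (h x)) q.

Definition cderive (v : plane) h q : R[i] :=
  'D_v (fun x => complex.Re (h x)) q +i* 'D_v (fun x => complex.Im (h x)) q.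

(** The derivative along the complexified tangent vector
    [w.1 d/du + w.2 d/dv]. *)
Definition cdir w h q : R[i] :=
  w.1 * cderive (1, 0) h q + w.2 * cderive (0, 1) h q.

Definition cCk k (U : set plane) h :=
  Ck k U (fun x => complex.Re (h x)) /\ Ck k U (fun x => complex.Im (h x)).

Lemma ReD (a b : R[i]) : complex.Re (a + b) = complex.Re a + complex.Re b.
Proof. by case: a b => [? ?] [? ?]. Qed.
Lemma ImD (a b : R[i]) : complex.Im (a + b) = complex.Im a + complex.Im b.
Proof. by case: a b => [? ?] [? ?]. Qed.
Lemma ReM (a b : R[i]) : complex.Re (a * b) =
  complex.Re a * complex.Re b - complex.Im a * complex.Im b.
Proof. by case: a b => [? ?] [? ?]. Qed.
Lemma ImM (a b : R[i]) : complex.Im (a * b) =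
  complex.Re a * complex.Im b + complex.Im a * complex.Re b.
Proof. by case: a b => [? ?] [? ?]. Qed.
Lemma conjcD (a b : R[i]) : conjc (a + b) = conjc a + conjc b.
Proof. exact: rmorphD. Qed.
Lemma conjcM (a b : R[i]) : conjc (a * b) = conjc a * conjc b.
Proof. exact: rmorphM. Qed.
Lemma conjcN (a : R[i]) : conjc (- a) = - conjc a.
Proof. exact: rmorphN. Qed.
Lemma conjc_sum (I : Type) (r : seq I) (F : I -> R[i]) :
  conjc (\sum_(i <- r) F i) = \sum_(i <- r) conjc (F i).
Proof. exact: rmorph_sum. Qed.
Lemma complex_ext (a b : R[i]) :
  complex.Re a = complex.Re b -> complex.Im a = complex.Im b -> a = b.
Proof. by case: a b => [? ?] [? ?] /= -> ->. Qed.

Lemma cdiff_near_eq h g q : (\near q, h q = g q) -> cdiff h q -> cdiff g q.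
Proof.
by move=> hg [h1 h2]; split; [apply: near_eq_differentiable h1 | apply: near_eq_differentiable h2];
  apply: filterS hg => x ->.
Qed.

Lemma cdiff_cst (c : R[i]) q : cdiff (fun=> c) q.
Proof. by split; exact: differentiable_cst. Qed.

Lemma cdiffD h g q : cdiff h q -> cdiff g q -> cdiff (fun x => h x + g x) q.
Proof.
move=> [h1 h2] [g1 g2]; split.
  rewrite (_ : (fun _ => _) = (fun x => complex.Re (h x)) + (fun x => complex.Re (g x))).
    exact: differentiableD.
  by apply/funext => x; rewrite ReD.
rewrite (_ : (fun _ => _) = (fun x => complex.Im (h x)) + (fun x => complex.Im (g x))).
  exact: differentiableD.
by apply/funext => x; rewrite ImD.
Qed.

Lemma cdiffM h g q : cdiff h q -> cdiff g q -> cdiff (fun x => h x * g x) q.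
Proof.
move=> [h1 h2] [g1 g2]; split.
  rewrite (_ : (fun _ => _) = (fun x => complex.Re (h x)) * (fun x => complex.Re (g x)) -
    (fun x => complex.Im (h x)) * (fun x => complex.Im (g x))).
    by apply: differentiableB; exact: differentiableM.
  by apply/funext => x; rewrite ReM.
rewrite (_ : (fun _ => _) = (fun x => complex.Re (h x)) * (fun x => complex.Im (g x)) +
    (fun x => complex.Im (h x)) * (fun x => complex.Re (g x))).
  by apply: differentiableD; exact: differentiableM.
by apply/funext => x; rewrite ImM.
Qed.

Lemma cdiff_sum (I : Type) (r : seq I) (F : I -> plane -> R[i]) q :
  (forall i, cdiff (F i) q) -> cdiff (fun x => \sum_(i <- r) F i x) q.
Proof.
move=> FP; elim: r => [|i r IH].
  rewrite (_ : (fun _ => _) = fun=> 0); first exact: cdiff_cst.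
  by apply/funext => x; rewrite big_nil.
rewrite (_ : (fun _ => _) = fun x => F i x + \sum_(i <- r) F i x); first exact: cdiffD.
by apply/funext => x; rewrite big_cons.
Qed.

Lemma cderive_near_eq v h g q : (\near q, h q = g q) -> cderive v h q = cderive v g q.
Proof.
move=> hg; congr (_ +i* _); apply: near_eq_derive; by apply: filterS hg => x ->.
Qed.

Lemma cderive_cst v (c : R[i]) q : cderive v (fun=> c) q = 0.
Proof. by rewrite /cderive !derive_cst. Qed.

Lemma cderiveD v h g q : cdiff h q -> cdiff g q ->
  cderive v (fun x => h x + g x) q = cderive v h q + cderive v g q.
Proof.
move=> [h1 h2] [g1 g2]; apply: complex_ext; rewrite (ReD, ImD) /=.
  rewrite -deriveD; try exact: diff_derivable.
  by congr ('D_v _ q); apply/funext => x; rewrite ReD.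
rewrite -deriveD; try exact: diff_derivable.
by congr ('D_v _ q); apply/funext => x; rewrite ImD.
Qed.

Lemma derive_Leibniz (V : normedModType R) (f1 f2 : V -> R) x v :
  derivable f1 x v -> derivable f2 x v ->
  'D_v (f1 * f2) x = 'D_v f1 x * f2 x + f1 x * 'D_v f2 x.
Proof. by move=> d1 d2; rewrite (deriveM d1 d2) addrC; congr (_ + _); exact: mulrC. Qed.

Lemma cderiveM v h g q : cdiff h q -> cdiff g q ->
  cderive v (fun x => h x * g x) q = cderive v h q * g q + h q * cderive v g q.
Proof.
move=> [h1 h2] [g1 g2].
have d1 := diff_derivable (v := v) h1; have d2 := diff_derivable (v := v) h2.
have d3 := diff_derivable (v := v) g1; have d4 := diff_derivable (v := v) g2.
apply: complex_ext; rewrite !(ReD, ImD, ReM, ImM) /=.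
  rewrite (_ : (fun _ => _) = (fun x => complex.Re (h x)) * (fun x => complex.Re (g x)) -
    (fun x => complex.Im (h x)) * (fun x => complex.Im (g x))); last first.
    by apply/funext => x; rewrite ReM.
  rewrite (deriveB (derivableM d1 d3) (derivableM d2 d4)).
  rewrite (derive_Leibniz d1 d3) (derive_Leibniz d2 d4).
  by move: ('D_v _ q) ('D_v _ q) ('D_v _ q) ('D_v _ q) => a b c d; ring.
rewrite (_ : (fun _ => _) = (fun x => complex.Re (h x)) * (fun x => complex.Im (g x)) +
    (fun x => complex.Im (h x)) * (fun x => complex.Re (g x))); last first.
  by apply/funext => x; rewrite ImM.
rewrite (deriveD (derivableM d1 d4) (derivableM d2 d3)).
rewrite (derive_Leibniz d1 d4) (derive_Leibniz d2 d3).
by move: ('D_v _ q) ('D_v _ q) ('D_v _ q) ('D_v _ q) => a b c d; ring.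
Qed.

Lemma cdir_near_eq w h g q : (\near q, h q = g q) -> cdir w h q = cdir w g q.
Proof. by move=> hg; rewrite /cdir !(cderive_near_eq _ hg). Qed.

Lemma cdir_cst w (c : R[i]) q : cdir w (fun=> c) q = 0.
Proof. by rewrite /cdir !cderive_cst !mulr0 addr0. Qed.

Lemma cdirD w h g q : cdiff h q -> cdiff g q ->
  cdir w (fun x => h x + g x) q = cdir w h q + cdir w g q.
Proof. by move=> dh dg; rewrite /cdir !cderiveD //; ring. Qed.

Lemma cdirM w h g q : cdiff h q -> cdiff g q ->
  cdir w (fun x => h x * g x) q = cdir w h q * g q + h q * cdir w g q.
Proof. by move=> dh dg; rewrite /cdir !cderiveM //; ring. Qed.

Lemma cdirZ w (c : R[i]) h q : cdiff h q ->
  cdir w (fun x => c * h x) q = c * cdir w h q.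
Proof.
by move=> dh; rewrite (cdirM w (cdiff_cst c q) dh) cdir_cst mul0r add0r.
Qed.

Lemma cdir_sum w (I : Type) (r : seq I) (F : I -> plane -> R[i]) q :
  (forall i, cdiff (F i) q) ->
  cdir w (fun x => \sum_(i <- r) F i x) q = \sum_(i <- r) cdir w (F i) q.
Proof.
move=> FP; elim: r => [|i r IH].
  rewrite big_nil (_ : (fun _ => _) = fun=> 0); first exact: cdir_cst.
  by apply/funext => x; rewrite big_nil.
rewrite big_cons -IH -cdirD //; last exact: cdiff_sum.
by congr (cdir w _ q); apply/funext => x; rewrite big_cons.
Qed.

Lemma derive_plane (W : normedModType R) (f : plane -> W) v q : differentiable f q ->
  'D_v f q = v.1 *: 'D_(1, 0) f q + v.2 *: 'D_(0, 1) f q.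
Proof.
move=> df; rewrite (deriveE v df) (deriveE ((1, 0) : plane) df) (deriveE ((0, 1) : plane) df).
have vE : v = v.1 *: (1, 0) + v.2 *: (0, 1).
  rewrite [LHS]surjective_pairing; congr (_, _).
    by rewrite -[RHS]/(v.1 * 1 + v.2 * 0) mulr1 mulr0 addr0.
  by rewrite -[RHS]/(v.1 * 0 + v.2 * 1) mulr1 mulr0 add0r.
by rewrite {1}vE linearD; congr (_ + _); exact: linearZZ.
Qed.

Lemma cderive_cdir v h q : cdiff h q ->
  cderive v h q = cdir (v.1%:C, v.2%:C) h q.
Proof.
move=> [h1 h2]; rewrite /cdir /cderive (derive_plane v h1) (derive_plane v h2).
move: ('D_(1, 0) _ q) ('D_(0, 1) _ q) ('D_(1, 0) _ q) ('D_(0, 1) _ q) => a b c d.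
by apply: complex_ext; rewrite !(ReD, ImD, ReM, ImM) /= !mul0r ?subr0 ?addr0.
Qed.

Lemma cderive_conj v h q : cdiff h q ->
  cderive v (fun x => conjc (h x)) q = conjc (cderive v h q).
Proof.
move=> [h1 h2]; apply: complex_ext => /=.
  by congr ('D_v _ q); apply/funext => x; case: (h x).
rewrite -deriveN; last exact: diff_derivable.
by congr ('D_v _ q); apply/funext => x; rewrite -[RHS]/(- complex.Im (h x)); case: (h x).
Qed.

Lemma cdir_conj w h q : cdiff h q ->
  cdir w (fun x => conjc (h x)) q = conjc (cdir (conjc w.1, conjc w.2) h q).
Proof.
move=> dh; rewrite /cdir !cderive_conj //.
move: (cderive _ _ _) (cderive _ _ _) w => [a1 a2] [b1 b2] [[c1 c2] [d1 d2]].
by apply: complex_ext => /=; ring.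
Qed.

Lemma cCk_cdiff k U h q : cCk k.+1 U h -> U q -> cdiff h q.
Proof. by move=> [h1 h2] Uq; split; [exact: Ck_differentiable h1 Uq | exact: Ck_differentiable h2 Uq]. Qed.

Lemma cCk_cderive k U v h : cCk k.+1 U h -> cCk k U (cderive v h).
Proof. by move=> [h1 h2]; split; [exact: Ck_derive h1 | exact: Ck_derive h2]. Qed.

Lemma cCkD k U h g : open U -> cCk k U h -> cCk k U g -> cCk k U (fun x => h x + g x).
Proof.
move=> oU [h1 h2] [g1 g2]; split.
  by apply: Ck_eq_on (CkD oU h1 g1) => // x Ux; rewrite ReD.
by apply: Ck_eq_on (CkD oU h2 g2) => // x Ux; rewrite ImD.
Qed.

Lemma cCkZ k U (c : R[i]) h : open U -> cCk k U h -> cCk k U (fun x => c * h x).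
Proof.
move=> oU [h1 h2]; split.
  apply: Ck_eq_on (CkD oU (Ck_scale (complex.Re c) oU h1) (Ck_scale (- complex.Im c) oU h2)) => // x Ux.
  by rewrite ReM /GRing.scale/= mulNr.
apply: Ck_eq_on (CkD oU (Ck_scale (complex.Re c) oU h2) (Ck_scale (complex.Im c) oU h1)) => // x Ux.
by rewrite ImM /GRing.scale/=.
Qed.

Lemma cCk_cdir k U w h : open U -> cCk k.+1 U h -> cCk k U (cdir w h).
Proof. by move=> oU hk; apply: cCkD => //; apply: cCkZ => //; exact: cCk_cderive. Qed.

Lemma cderiveC v v' U h q : open U -> cCk 2 U h -> U q ->
  cderive v (cderive v' h) q = cderive v' (cderive v h) q.
Proof.
move=> oU [h1 h2] Uq; have nU : \forall x \near q, U x by exact: open_nbhs_nbhs.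
apply: complex_ext => /=; apply: mixed_derivatives.
- by apply: filterS nU => x Ux; exact: Ck_differentiable h1 Ux.
- by case: h1 => _ h1; case: (h1 v') => + _; apply.
- by case: h1 => _ h1; case: (h1 v) => + _; apply.
- by apply: filterS nU => x Ux; exact: Ck_differentiable h2 Ux.
- by case: h2 => _ h2; case: (h2 v') => + _; apply.
- by case: h2 => _ h2; case: (h2 v) => + _; apply.
Qed.

Lemma cdirC w w' U h q : open U -> cCk 2 U h -> U q ->
  cdir w (cdir w' h) q = cdir w' (cdir w h) q.
Proof.
move=> oU hk Uq.
have d v : cdiff (cderive v h) q by exact: cCk_cdiff (cCk_cderive v hk) Uq.
have E w1 w2 : cdir w1 (cdir w2 h) q =
    w2.1 * cdir w1 (cderive (1, 0) h) q + w2.2 * cdir w1 (cderive (0, 1) h) q.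
  rewrite {2}/cdir cdirD; try by apply: cdiffM => //; exact: cdiff_cst.
  by rewrite (cdirZ w1 _ (d _)) (cdirZ w1 _ (d _)).
rewrite !E /cdir (cderiveC (0, 1) (1, 0) oU hk Uq).
by move: (cderive _ _ q) (cderive _ _ q) (cderive _ _ q) => a b c; ring.
Qed.

End ComplexDerivatives.

(** * Functions with values in complex matrices *)

Section VectorDerivatives.
Variable R : realType.
Local Notation plane := (R * R)%type.
Implicit Types (q : plane) (w : R[i] * R[i]) (U : set plane).

Definition mdiff a b (g : plane -> 'M[R[i]]_(a, b)) q :=
  forall i j, cdiff (fun x => g x i j) q.

Definition mdir a b w (g : plane -> 'M[R[i]]_(a, b)) q : 'M[R[i]]_(a, b) :=
  \matrix_(i, j) cdir w (fun x => g x i j) q.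

Definition mCk a b k U (g : plane -> 'M[R[i]]_(a, b)) :=
  forall i j, cCk k U (fun x => g x i j).

Section Rules.
Variables (a b : nat).
Implicit Types (g h : plane -> 'M[R[i]]_(a, b)) (c : plane -> R[i]).

Lemma mdiff_near_eq g h q : (\near q, g q = h q) -> mdiff g q -> mdiff h q.
Proof.
by move=> gh dg i j; apply: cdiff_near_eq (dg i j); apply: filterS gh => x ->.
Qed.

Lemma mdir_near_eq w g h q : (\near q, g q = h q) -> mdir w g q = mdir w h q.
Proof.
move=> gh; apply/matrixP => i j; rewrite !mxE; apply: cdir_near_eq.
by apply: filterS gh => x ->.
Qed.

Lemma mdiffD g h q : mdiff g q -> mdiff h q -> mdiff (fun x => g x + h x) q.
Proof.
move=> dg dh i j; rewrite (_ : (fun _ => _) = fun x => g x i j + h x i j).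
  exact: cdiffD.
by apply/funext => x; rewrite mxE.
Qed.

Lemma mdirD w g h q : mdiff g q -> mdiff h q ->
  mdir w (fun x => g x + h x) q = mdir w g q + mdir w h q.
Proof.
move=> dg dh; apply/matrixP => i j; rewrite !mxE -cdirD //.
by congr (cdir w _ q); apply/funext => x; rewrite mxE.
Qed.

Lemma mdiffZ c g q : cdiff c q -> mdiff g q -> mdiff (fun x => c x *: g x) q.
Proof.
move=> dc dg i j; rewrite (_ : (fun _ => _) = fun x => c x * g x i j).
  exact: cdiffM.
by apply/funext => x; rewrite mxE.
Qed.

Lemma mdirZ w c g q : cdiff c q -> mdiff g q ->
  mdir w (fun x => c x *: g x) q = cdir w c q *: g q + c q *: mdir w g q.
Proof.
move=> dc dg; apply/matrixP => i j; rewrite !mxE -cdirM //.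
by congr (cdir w _ q); apply/funext => x; rewrite mxE.
Qed.

Lemma mdirZc w (c : R[i]) g q : mdiff g q ->
  mdir w (fun x => c *: g x) q = c *: mdir w g q.
Proof.
by move=> dg; rewrite (mdirZ w (cdiff_cst c q) dg) cdir_cst scale0r add0r.
Qed.

Lemma mdiffZc (c : R[i]) g q : mdiff g q -> mdiff (fun x => c *: g x) q.
Proof. by move=> dg; apply: mdiffZ => //; exact: cdiff_cst. Qed.

Lemma mdiffN g q : mdiff g q -> mdiff (fun x => - g x) q.
Proof.
move=> dg; rewrite (_ : (fun _ => _) = fun x => (-1) *: g x); first exact: mdiffZc.
by apply/funext => x; rewrite scaleN1r.
Qed.

Lemma mdirN w g q : mdiff g q -> mdir w (fun x => - g x) q = - mdir w g q.
Proof.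
move=> dg; rewrite -scaleN1r -mdirZc //; congr (mdir w _ q).
by apply/funext => x; rewrite scaleN1r.
Qed.

Lemma mdiffB g h q : mdiff g q -> mdiff h q -> mdiff (fun x => g x - h x) q.
Proof. by move=> dg dh; apply: mdiffD => //; exact: mdiffN. Qed.

Lemma mdirB w g h q : mdiff g q -> mdiff h q ->
  mdir w (fun x => g x - h x) q = mdir w g q - mdir w h q.
Proof. by move=> dg dh; rewrite mdirD ?mdirN //; exact: mdiffN. Qed.

Lemma mdiff_sum (I : Type) (r : seq I) (F : I -> plane -> 'M[R[i]]_(a, b)) q :
  (forall i, mdiff (F i) q) -> mdiff (fun x => \sum_(i <- r) F i x) q.
Proof.
move=> FP i j; rewrite (_ : (fun _ => _) = fun x => \sum_(l <- r) F l x i j).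
  by apply: cdiff_sum => l; exact: FP.
by apply/funext => x; rewrite summxE.
Qed.

Lemma mdir_conj w g q : mdiff g q ->
  mdir w (fun x => Defs.conjmx (g x)) q = Defs.conjmx (mdir (conjc w.1, conjc w.2) g q).
Proof.
move=> dg; apply/matrixP => i j; rewrite !mxE -cdir_conj //.
by congr (cdir w _ q); apply/funext => x; rewrite mxE.
Qed.

Lemma mCk_mdiff k U g q : mCk k.+1 U g -> U q -> mdiff g q.
Proof. by move=> gk Uq i j; exact: cCk_cdiff (gk i j) Uq. Qed.

Lemma mCk_mdir k U w g : open U -> mCk k.+1 U g -> mCk k U (mdir w g).
Proof.
move=> oU gk i j; have [h1 h2] := cCk_cdir w oU (gk i j).
by split; [apply: Ck_eq_on h1 | apply: Ck_eq_on h2] => // x Ux; rewrite mxE.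
Qed.

Lemma mCkW k U g : mCk k.+1 U g -> mCk k U g.
Proof. by move=> gk i j; have [h1 h2] := gk i j; split; exact: CkW. Qed.

Lemma mdirC w w' U g q : open U -> mCk 2 U g -> U q ->
  mdir w (mdir w' g) q = mdir w' (mdir w g) q.
Proof.
move=> oU gk Uq; apply/matrixP => i j; rewrite !mxE.
transitivity (cdir w (cdir w' (fun x => g x i j)) q).
  by congr (cdir w _ q); apply/funext => x; rewrite mxE.
rewrite (cdirC w w' oU (gk i j) Uq).
by congr (cdir w' _ q); apply/funext => x; rewrite mxE.
Qed.

End Rules.

Section Conjugation.
Variables (a b : nat).
Implicit Types (u v : 'M[R[i]]_(a, b)).

Lemma conjmxK u : Defs.conjmx (Defs.conjmx u) = u.
Proof. by apply/matrixP => i j; rewrite !mxE conjcK. Qed.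

Lemma conjmxD u v : Defs.conjmx (u + v) = Defs.conjmx u + Defs.conjmx v.
Proof. by apply/matrixP => i j; rewrite !mxE conjcD. Qed.

Lemma conjmxZ (c : R[i]) u : Defs.conjmx (c *: u) = conjc c *: Defs.conjmx u.
Proof. by apply/matrixP => i j; rewrite !mxE conjcM. Qed.

Lemma conjmx_sum (I : Type) (r : seq I) (F : I -> 'M[R[i]]_(a, b)) :
  Defs.conjmx (\sum_(i <- r) F i) = \sum_(i <- r) Defs.conjmx (F i).
Proof.
apply/matrixP => i j; rewrite mxE !summxE conjc_sum.
by apply: eq_bigr => l _; rewrite mxE.
Qed.

End Conjugation.

Lemma lip_conjmx m (u v : 'cV[R[i]]_m.+1) :
  lip (Defs.conjmx u) (Defs.conjmx v) = conjc (lip u v).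
Proof.
rewrite /lip conjcD conjcN conjcM conjc_sum !mxE; congr (_ + _).
by apply: eq_bigr => j _; rewrite !mxE conjcM.
Qed.

Section LorentzProduct.
Variable m : nat.
Implicit Types (g h : plane -> 'cV[R[i]]_m.+1).

Lemma cdiff_lip g h q : mdiff g q -> mdiff h q ->
  cdiff (fun x => lip (g x) (h x)) q.
Proof.
move=> dg dh; apply: cdiffD.
  rewrite (_ : (fun _ => _) = fun x => -1 * (g x 0 0 * h x 0 0)).
    by apply: cdiffM; [exact: cdiff_cst | exact: cdiffM].
  by apply/funext => x; rewrite mulN1r.
by apply: cdiff_sum => i; exact: cdiffM.
Qed.

Lemma cdir_lip w g h q : mdiff g q -> mdiff h q ->
  cdir w (fun x => lip (g x) (h x)) q =
  lip (mdir w g q) (h q) + lip (g q) (mdir w h q).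
Proof.
move=> dg dh.
rewrite /lip cdirD; first last.
- by apply: cdiff_sum => i; exact: cdiffM.
- rewrite (_ : (fun _ => _) = fun x => -1 * (g x 0 0 * h x 0 0)).
    by apply: cdiffM; [exact: cdiff_cst | exact: cdiffM].
  by apply/funext => x; rewrite mulN1r.
rewrite cdir_sum; last by move=> i; exact: cdiffM.
rewrite (_ : (fun x => - _) = fun x => -1 * (g x 0 0 * h x 0 0)); last first.
  by apply/funext => x; rewrite mulN1r.
rewrite cdirZ; last exact: cdiffM.
rewrite cdirM // addrACA -big_split/= mulN1r opprD !mxE; congr (_ + _).
by apply: eq_bigr => i _; rewrite cdirM // !mxE.
Qed.

(** The derivative of a constant product vanishes; the product rule moves the
    derivative to the other factor. *)
Lemma lip_mdir_cst w g h q (c : R[i]) : mdiff g q -> mdiff h q ->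
  (\near q, lip (g q) (h q) = c) ->
  lip (mdir w g q) (h q) = - lip (g q) (mdir w h q).
Proof.
move=> dg dh ghc; apply/eqP; rewrite -addr_eq0 -cdir_lip //.
by rewrite (cdir_near_eq w ghc) cdir_cst.
Qed.

End LorentzProduct.

End VectorDerivatives.

(** * Frames built on two null vectors *)

Section FrameGram.
Variables (R : realType) (n : nat).
Local Notation vec := 'cV[R[i]]_(4 + n).
Local Notation ip := (@lip _ (3 + n)).

Lemma sqrt2_sqr : sqrt2 R * sqrt2 R = 2.
Proof.
have h : (Num.sqrt 2 : R) * Num.sqrt 2 = 2 by rewrite -expr2 sqr_sqrtr.
by rewrite /sqrt2 -rmorphM /= h; apply: complex_ext; rewrite /= ?addr0.
Qed.

Lemma sqrt2_neq0 : sqrt2 R != 0.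
Proof.
apply/eqP => h; have := sqrt2_sqr; rewrite h mul0r => /esym/eqP.
by rewrite pnatr_eq0.
Qed.

Lemma knormE (k : 'I_n -> R[i]) : knorm k ^+ 2 = \sum_j k j * conjc (k j).
Proof.
rewrite /knorm -rmorphXn /= sqr_sqrtr; last by apply: sumr_ge0 => j _; exact: sqr_ge0.
rewrite rmorph_sum /=; apply: eq_bigr => j _.
case: (k j) => a b; rewrite /ComplexField.Normc.normc sqr_sqrtr ?addr_ge0 ?sqr_ge0 //.
by apply: complex_ext => /=; ring.
Qed.

(** [P] and [Q] stand for [Y_z] and [Y_zbar].  Keeping them as independent
    arguments lets the same matrix describe the frame and its derivative. *)
Definition frame_cols (Y N P Q : vec) : 4.-tuple vec :=
  [tuple (sqrt2 R)^-1 *: (Y + N); (sqrt2 R)^-1 *: (- Y + N); P + Q; 'i *: (P - Q)].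

Definition frame_mx (Y N P Q : vec) (ps : 'I_n -> vec) : 'M[R[i]]_(4 + n) :=
  \matrix_(i, j) (match fintype.split j : 'I_4 + 'I_n with inl a => tnth (frame_cols Y N P Q) a
                                   | inr l => ps l end) i 0.

Lemma col_frame_mx (Y N P Q : vec) (ps : 'I_n -> vec) l : col l (frame_mx Y N P Q ps) =
  match fintype.split l : 'I_4 + 'I_n with inl a => tnth (frame_cols Y N P Q) a | inr l => ps l end.
Proof. by apply/colP => r; rewrite !mxE. Qed.

Section DerivativeOfFrame.
Variables (Y N P Q : R * R -> vec) (ps : 'I_n -> R * R -> vec) (q : R * R).
Hypotheses (dY : mdiff Y q) (dN : mdiff N q) (dP : mdiff P q) (dQ : mdiff Q q).
Hypothesis dps : forall j, mdiff (ps j) q.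

Lemma frame_mx_entry (Y0 N0 P0 Q0 : vec) (ps0 : 'I_n -> vec) i j :
  frame_mx Y0 N0 P0 Q0 ps0 i j =
  match fintype.split j : 'I_4 + 'I_n with
  | inl a => nth 0 [:: (sqrt2 R)^-1 *: (Y0 + N0); (sqrt2 R)^-1 *: (- Y0 + N0);
                       P0 + Q0; 'i *: (P0 - Q0)] a
  | inr l => ps0 l end i 0.
Proof. by rewrite mxE; case: (fintype.split j) => // a; rewrite (tnth_nth 0). Qed.

Lemma mdiff_frame_mx : mdiff (fun x => frame_mx (Y x) (N x) (P x) (Q x) (fun j => ps j x)) q.
Proof.
move=> i j.
rewrite (_ : (fun x => _) = fun x =>
  (match fintype.split j : 'I_4 + 'I_n with
  | inl a => nth 0 [:: (sqrt2 R)^-1 *: (Y x + N x); (sqrt2 R)^-1 *: (- Y x + N x);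
                       P x + Q x; 'i *: (P x - Q x)] a
  | inr l => ps l x end) i 0); last by apply/funext => x; rewrite frame_mx_entry.
case: (fintype.split j : 'I_4 + 'I_n) => [a|l]; last exact: dps.
case: a => [[|[|[|[|//]]]] la] /=; move: i 0; rewrite -/(mdiff _ q).
- by apply: mdiffZc; exact: mdiffD.
- by apply: mdiffZc; apply: mdiffD => //; exact: mdiffN.
- exact: mdiffD.
- by apply: mdiffZc; exact: mdiffB.
Qed.

Lemma mdir_frame_mx w :
  mdir w (fun x => frame_mx (Y x) (N x) (P x) (Q x) (fun j => ps j x)) q =
  frame_mx (mdir w Y q) (mdir w N q) (mdir w P q) (mdir w Q q) (fun j => mdir w (ps j) q).
Proof.
apply/matrixP => i j; rewrite frame_mx_entry mxE.
rewrite (_ : (fun x => _) = fun x =>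
  (match fintype.split j : 'I_4 + 'I_n with
  | inl a => nth 0 [:: (sqrt2 R)^-1 *: (Y x + N x); (sqrt2 R)^-1 *: (- Y x + N x);
                       P x + Q x; 'i *: (P x - Q x)] a
  | inr l => ps l x end) i 0); last by apply/funext => x; rewrite frame_mx_entry.
have cE (g : R * R -> vec) : cdir w (fun x => g x i 0) q = mdir w g q i 0 by rewrite mxE.
case: (fintype.split j : 'I_4 + 'I_n) => [a|l]; last exact: cE.
case: a => [[|[|[|[|//]]]] la] /=; rewrite cE.
- by rewrite mdirZc ?mdirD //; exact: mdiffD.
- rewrite mdirZc ?mdirD ?mdirN //; first exact: mdiffN.
  by apply: mdiffD => //; exact: mdiffN.
- by rewrite mdirD.
- by rewrite mdirZc ?mdirB //; exact: mdiffB.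
Qed.

End DerivativeOfFrame.

Section Blocks.
Variables (s : R[i]) (k beta : 'I_n -> R[i]) (b : 'I_n -> 'I_n -> R[i]).

Lemma mxA_ul a c : mxA s k beta b (lshift n a) (lshift n c) = mxA1 s k a c.
Proof. exact: block_mxEul. Qed.
Lemma mxA_ur a l : mxA s k beta b (lshift n a) (rshift 4 l) = mxB1 k beta a l.
Proof. exact: block_mxEur. Qed.
Lemma mxA_dl l c : mxA s k beta b (rshift 4 l) (lshift n c) = mxB2 k beta l c.
Proof. exact: block_mxEdl. Qed.
Lemma mxA_dr l l' : mxA s k beta b (rshift 4 l) (rshift 4 l') = b l' l.
Proof. by rewrite /mxA block_mxEdr mxE. Qed.

End Blocks.

Definition lsign (T : nzRingType) (a : 'I_4) : T := if a == 0 then -1 else 1.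

(** The primed vectors stand for the [z]-derivatives of the unprimed ones, the
    derivative of [Y] being [P]. *)
Variables (Y N P Q N' P' Q' : vec) (ps ps' : 'I_n -> vec).
Variables (s : R[i]) (k beta : 'I_n -> R[i]) (b : 'I_n -> 'I_n -> R[i]).
Let K := knorm k ^+ 2.
Hypotheses (YP : ip Y P = 0) (YQ : ip Y Q = 0) (NP : ip N P = 0) (NQ : ip N Q = 0).
Hypotheses (PP : ip P P = 0) (PQ : ip P Q = 2^-1).
Hypotheses (YN' : ip Y N' = 0) (NN' : ip N N' = 0) (PN' : ip P N' = - (s / 2))
  (QN' : ip Q N' = - K).
Hypotheses (YP' : ip Y P' = 0) (NP' : ip N P' = s / 2) (PP' : ip P P' = 0) (QP' : ip Q P' = 0).
Hypotheses (YQ' : ip Y Q' = - 2^-1) (NQ' : ip N Q' = K) (PQ' : ip P Q' = 0) (QQ' : ip Q Q' = 0).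
Hypotheses (pP : forall j, ip (ps j) P = 0) (pN' : forall j, ip (ps j) N' = 2 * beta j)
  (pP' : forall j, ip (ps j) P' = k j) (pQ' : forall j, ip (ps j) Q' = 0).
Hypotheses (Yp' : forall j, ip Y (ps' j) = 0) (Np' : forall j, ip N (ps' j) = - (2 * beta j))
  (Pp' : forall j, ip P (ps' j) = - k j) (Qp' : forall j, ip Q (ps' j) = 0).

Let ii : 'i * 'i = -1 :> R[i].
Proof. by rewrite -expr2 sqrCi. Qed.

Let lin := (lipDl, lipDr, lipBl, lipBr, lipZl, lipZr, lipNl, lipNr).

Lemma frame_gram_ul (a c : 'I_4) :
  ip (tnth (frame_cols Y N P Q) a) (tnth (frame_cols P N' P' Q') c) =
  lsign _ a * mxA1 s k a c.
Proof.
have r0 := sqrt2_neq0; have r2 := sqrt2_sqr.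
rewrite mxE !(tnth_nth 0) /lsign -val_eqE /= /s1 /s2 /s3 /s4 -/K.
case: a c => [[|[|[|[|//]]]] la] [[|[|[|[|//]]]] lc] /=;
  rewrite !lin ?(lipC Q P) ?(lipC P Y) ?YP ?YQ ?NP ?NQ ?PP ?PQ ?YN' ?NN' ?PN' ?QN' ?YP' ?NP' ?PP' ?QP' ?YQ' ?NQ' ?PQ' ?QQ'; by field.
Qed.

Lemma frame_gram_ur (a : 'I_4) j :
  ip (tnth (frame_cols Y N P Q) a) (ps' j) = lsign _ a * mxB1 k beta a j.
Proof.
have r0 := sqrt2_neq0; have r2 := sqrt2_sqr.
rewrite mxE !(tnth_nth 0) /lsign -val_eqE /=.
case: a => [[|[|[|[|//]]]] la] /=;
  rewrite !lin ?Yp' ?Np' ?Pp' ?Qp' -?r2; by field.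
Qed.

Lemma frame_gram_dl j (c : 'I_4) :
  ip (ps j) (tnth (frame_cols P N' P' Q') c) = mxB2 k beta j c.
Proof.
have r0 := sqrt2_neq0; have r2 := sqrt2_sqr.
rewrite mxE !(tnth_nth 0) /=.
case: c => [[|[|[|[|//]]]] la] /=;
  rewrite !lin ?pP ?pN' ?pP' ?pQ' -?r2; by field.
Qed.

Hypothesis pp' : forall i j, ip (ps i) (ps' j) = b j i.

Lemma frame_gram :
  (frame_mx Y N P Q ps)^T *m I1 R[i] (3 + n) *m frame_mx P N' P' Q' ps' =
  I1 R[i] (3 + n) *m mxA s k beta b.
Proof.
apply/matrixP => i j; rewrite (@lip_gram _ (3 + n)) (@I1_mulE _ (3 + n)).
rewrite !col_frame_mx -[in RHS](@splitK 4 n i) -[in RHS](@splitK 4 n j).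
case: (fintype.split i) => [a|l] /=; case: (fintype.split j) => [c|l'] /=.
- by rewrite frame_gram_ul mxA_ul.
- by rewrite frame_gram_ur mxA_ur.
- by rewrite frame_gram_dl mxA_dl mul1r.
- by rewrite pp' mxA_dr mul1r.
Qed.

End FrameGram.

Section FrameOrthonormal.
Variables (R : realType) (n : nat).
Local Notation vec := 'cV[R[i]]_(4 + n).
Local Notation ip := (@lip _ (3 + n)).
Variables (Y N P Q : vec) (ps : 'I_n -> vec).
Hypotheses (YY : ip Y Y = 0) (NN : ip N N = 0) (NY : ip N Y = -1).
Hypotheses (YP : ip Y P = 0) (YQ : ip Y Q = 0) (NP : ip N P = 0) (NQ : ip N Q = 0).
Hypotheses (PP : ip P P = 0) (PQ : ip P Q = 2^-1) (QQ : ip Q Q = 0).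
Hypotheses (pY : forall j, ip (ps j) Y = 0) (pN : forall j, ip (ps j) N = 0).
Hypotheses (pP : forall j, ip (ps j) P = 0) (pQ : forall j, ip (ps j) Q = 0).
Hypothesis pp : forall i j, ip (ps i) (ps j) = (i == j)%:R.

Let lin := (lipDl, lipDr, lipBl, lipBr, lipZl, lipZr, lipNl, lipNr).

Let gram4 (a c : 'I_4) :
  ip (tnth (frame_cols Y N P Q) a) (tnth (frame_cols Y N P Q) c) = (if a == 0 then -1 else 1) * (a == c)%:R.
Proof.
have r0 := sqrt2_neq0 R; have r2 := sqrt2_sqr R.
have ii : 'i * 'i = -1 :> R[i] by rewrite -expr2 sqrCi.
have rx x : (sqrt2 R)^-1 * ((sqrt2 R)^-1 * x) = 2^-1 * x by rewrite mulrA -invfM r2.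
have ix x : 'i * ('i * x) = - x :> R[i] by rewrite mulrA ii mulN1r.
rewrite !(tnth_nth 0) -!val_eqE /=.
case: a c => [[|[|[|[|//]]]] la] [[|[|[|[|//]]]] lc] /=;
  rewrite !lin ?(lipC Q P) ?(lipC P Y) ?(lipC Q Y) ?(lipC P N) ?(lipC Q N) ?(lipC Y N)
    ?YY ?NN ?NY ?YP ?YQ ?NP ?NQ ?PP ?PQ ?QQ ?(mulrDr, mulrN) ?rx ?ix; by field.
Qed.

Let gram1 (a : 'I_4) j : ip (ps j) (tnth (frame_cols Y N P Q) a) = 0.
Proof.
rewrite !(tnth_nth 0); case: a => [[|[|[|[|//]]]] la] /=;
  by rewrite !lin ?pY ?pN ?pP ?pQ ?(oppr0, addr0, mulr0).
Qed.

Lemma frame_orthonormal :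
  (frame_mx Y N P Q ps)^T *m I1 R[i] (3 + n) *m frame_mx Y N P Q ps = I1 R[i] (3 + n).
Proof.
apply/matrixP => i j; rewrite (@lip_gram _ (3 + n)).
have -> : I1 R[i] (3 + n) = I1 R[i] (3 + n) *m 1%:M by rewrite mulmx1.
rewrite (@I1_mulE _ (3 + n)) mxE !col_frame_mx.
rewrite -[in RHS](@splitK 4 n i) -[in RHS](@splitK 4 n j).
case: (fintype.split i) => [a|l] /=; case: (fintype.split j) => [c|l'] /=.
- by rewrite gram4 -!val_eqE.
- by rewrite lipC gram1 (_ : (_ == rshift 4 l') = false) ?mulr0 //; apply/negbTE;
    rewrite -val_eqE /=; have := ltn_ord a; lia.
- by rewrite gram1 (_ : (_ == lshift n c) = false) ?mulr0 //; apply/negbTE;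
    rewrite -val_eqE /=; have := ltn_ord c; lia.
- by rewrite pp mul1r -!val_eqE /= eqn_add2l.
Qed.

End FrameOrthonormal.

(** * Structure equations of a surface in the light cone *)

Section WirtingerConjugation.
Variable R : realType.
Local Notation plane := (R * R)%type.

(** The directions of [d/dz = (d/du - i d/dv) / 2] and
    [d/dzbar = (d/du + i d/dv) / 2]. *)
Definition dz_dir : R[i] * R[i] := (2^-1, - (2^-1 * 'i)).
Definition dzbar_dir : R[i] * R[i] := (2^-1, 2^-1 * 'i).

Lemma conj_dz_dir : (conjc dz_dir.1, conjc dz_dir.2) = dzbar_dir.
Proof.
have h2 : conjc (2^-1 : R[i]) = 2^-1 by rewrite conjc_inv conjc_nat.
have hi : conjc 'i = - 'i :> R[i].
  by rewrite -complexiE; apply: complex_ext; rewrite /= ?oppr0.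
rewrite -[LHS]/(conjc 2^-1, conjc (- (2^-1 * 'i))) conjcN conjcM.
by rewrite h2 hi mulrN opprK.
Qed.

Lemma conj_dzbar_dir : (conjc dzbar_dir.1, conjc dzbar_dir.2) = dz_dir.
Proof.
by rewrite -conj_dz_dir -[LHS]/(conjc (conjc _), conjc (conjc _)) !conjcK -surjective_pairing.
Qed.

Lemma conj_mdir_dz a b (g : plane -> 'M[R[i]]_(a, b)) q : mdiff g q ->
  Defs.conjmx (mdir dz_dir g q) = mdir dzbar_dir (fun x => Defs.conjmx (g x)) q.
Proof. by move=> dg; rewrite mdir_conj // conj_dzbar_dir. Qed.

Lemma conj_mdir_dzbar a b (g : plane -> 'M[R[i]]_(a, b)) q : mdiff g q ->
  Defs.conjmx (mdir dzbar_dir g q) = mdir dz_dir (fun x => Defs.conjmx (g x)) q.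
Proof. by move=> dg; rewrite mdir_conj // conj_dz_dir. Qed.

Lemma conj_mdir_dz_real a b (g : plane -> 'M[R[i]]_(a, b)) q : mdiff g q ->
  (forall x, Defs.conjmx (g x) = g x) ->
  Defs.conjmx (mdir dz_dir g q) = mdir dzbar_dir g q.
Proof.
move=> dg gr; rewrite conj_mdir_dz //.
by congr (mdir _ _ q); apply/funext => x; rewrite gr.
Qed.

End WirtingerConjugation.

Section StructureEquations.
Local Opaque mdir lip cdir Defs.conjmx.
Variables (R : realType) (n : nat).
Local Notation m := (3 + n)%N.
Local Notation plane := (R * R)%type.
Local Notation vec := 'cV[R[i]]_m.+1.

Variables (U : set plane) (oU : open U).
Variables (y nn : plane -> vec) (psi : 'I_n -> plane -> vec) (kappa : plane -> vec).
Variables (s : plane -> R[i]) (k beta : plane -> 'I_n -> R[i]).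
Local Notation D := (mdir (dz_dir R)).
Local Notation E := (mdir (dzbar_dir R)).
Local Notation yz := (D y).
Local Notation yb := (E y).
Local Notation yzz := (D (D y)).
Local Notation yzb := (E (D y)).

Hypothesis y_smooth : mCk 3 U y.
Hypothesis y_real : forall q, Defs.conjmx (y q) = y q.
Hypothesis psi_diff : forall q j, U q -> mdiff (psi j) q.
Hypothesis yy : forall q, U q -> lip (y q) (y q) = 0.
Hypothesis yzyz : forall q, U q -> lip (yz q) (yz q) = 0.
Hypothesis yzyb : forall q, U q -> lip (yz q) (yb q) = 2^-1.
Hypothesis ny : forall q, U q -> lip (nn q) (y q) = -1.
Hypothesis nyz : forall q, U q -> lip (nn q) (yz q) = 0.
Hypothesis nyb : forall q, U q -> lip (nn q) (yb q) = 0.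
Hypothesis nnn : forall q, U q -> lip (nn q) (nn q) = 0.
Hypothesis n_span : forall q, U q -> exists a b c d : R[i],
  nn q = a *: y q + b *: yz q + c *: yb q + d *: (yzb q + Defs.conjmx (yzb q)).
Hypothesis py : forall q j, U q -> lip (psi j q) (y q) = 0.
Hypothesis pyz : forall q j, U q -> lip (psi j q) (yz q) = 0.
Hypothesis pyb : forall q j, U q -> lip (psi j q) (yb q) = 0.
Hypothesis pn : forall q j, U q -> lip (psi j q) (nn q) = 0.
Hypothesis pp : forall q i j, U q -> lip (psi i q) (psi j q) = (i == j)%:R.
Hypothesis psi_real : forall q j, Defs.conjmx (psi j q) = psi j q.
Hypothesis yzzE : forall q, U q -> yzz q = (- (s q / 2)) *: y q + kappa q.
Hypothesis kappaE : forall q, U q -> kappa q = \sum_j k q j *: psi j q.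
Hypothesis beta_kappa : forall q j, U q -> lip (E kappa q) (psi j q) = beta q j.

Let lip_deriv w f g (c : R[i]) q : U q -> mdiff f q -> mdiff g q ->
  (forall x, U x -> lip (f x) (g x : vec) = c) ->
  lip (mdir w f q) (g q) = - lip (f q) (mdir w g q).
Proof.
move=> Uq df dg fg; apply: (lip_mdir_cst w df dg (c := c)).
by near=> x; apply: fg; near: x; exact: open_nbhs_nbhs.
Unshelve. all: by end_near. Qed.

Let yd q : U q -> mdiff y q. Proof. exact: mCk_mdiff y_smooth. Qed.
Let y1 w : mCk 2 U (mdir w y). Proof. exact: mCk_mdir y_smooth. Qed.
Let y1d w q : U q -> mdiff (mdir w y) q. Proof. exact: mCk_mdiff (y1 w). Qed.
Let y2 w w' : mCk 1 U (mdir w' (mdir w y)). Proof. exact: mCk_mdir (y1 w). Qed.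
Let y2d w w' q : U q -> mdiff (mdir w' (mdir w y)) q.
Proof. exact: mCk_mdiff (y2 w w'). Qed.

Let conj_yz q : U q -> Defs.conjmx (yz q) = yb q.
Proof. by move=> Uq; apply: conj_mdir_dz_real => //; exact: yd. Qed.

Let lin := (lipDl, lipDr, lipBl, lipBr, lipZl, lipZr, lipNl, lipNr).

Lemma lip_yb_yb q : U q -> lip (yb q) (yb q) = 0.
Proof. by move=> Uq; rewrite -conj_yz // lip_conjmx yzyz // conjc0. Qed.

Lemma lip_y_yz q : U q -> lip (y q) (yz q) = 0.
Proof.
move=> Uq; have := lip_deriv (dz_dir R) Uq (yd Uq) (yd Uq) yy.
rewrite (lipC (yz q)) => /eqP; rewrite -addr_eq0 -mulr2n mulrn_eq0 /= => /eqP. exact.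
Qed.

Lemma lip_y_yb q : U q -> lip (y q) (yb q) = 0.
Proof.
by move=> Uq; rewrite -conj_yz // -[y q]y_real lip_conjmx lip_y_yz // conjc0.
Qed.

Lemma yzbC q : U q -> yzb q = D (E y) q.
Proof.
move=> Uq; by apply: mdirC oU (mCkW y_smooth) Uq.
Qed.

Lemma conj_yzb q : U q -> Defs.conjmx (yzb q) = yzb q.
Proof.
move=> Uq; rewrite conj_mdir_dzbar; last exact: y1d.
rewrite (yzbC Uq); apply: mdir_near_eq; near=> x; apply: conj_yz.
by near: x; exact: open_nbhs_nbhs.
Unshelve. all: by end_near. Qed.

Lemma lip_yzz_y q : U q -> lip (yzz q) (y q) = 0.
Proof.
move=> Uq; rewrite (lip_deriv (dz_dir R) Uq (y1d _ Uq) (yd Uq) (c := 0)).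
  by rewrite yzyz // oppr0.
by move=> x Ux; rewrite lipC lip_y_yz.
Qed.

Lemma lip_yzb_y q : U q -> lip (yzb q) (y q) = - 2^-1.
Proof.
move=> Uq; rewrite (lip_deriv (dzbar_dir R) Uq (y1d _ Uq) (yd Uq) (c := 0)).
  by rewrite yzyb.
by move=> x Ux; rewrite lipC lip_y_yz.
Qed.

Let half0 (x : R[i]) : x = - x -> x = 0.
Proof. by move=> /eqP; rewrite -addr_eq0 -mulr2n mulrn_eq0 /= => /eqP. Qed.

Lemma lip_yzz_yz q : U q -> lip (yzz q) (yz q) = 0.
Proof.
move=> Uq; apply: half0; rewrite {1}(lip_deriv (dz_dir R) Uq (y1d _ Uq) (y1d _ Uq) yzyz).
by rewrite lipC.
Qed.

Lemma lip_yzb_yz q : U q -> lip (yzb q) (yz q) = 0.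
Proof.
move=> Uq; apply: half0; rewrite {1}(lip_deriv (dzbar_dir R) Uq (y1d _ Uq) (y1d _ Uq) yzyz).
by rewrite lipC.
Qed.

Lemma lip_yzb_yb q : U q -> lip (yzb q) (yb q) = 0.
Proof.
by move=> Uq; rewrite -conj_yzb // -conj_yz // lip_conjmx lip_yzb_yz // conjc0.
Qed.

Lemma lip_yzz_yb q : U q -> lip (yzz q) (yb q) = 0.
Proof.
move=> Uq; rewrite (lip_deriv (dz_dir R) Uq (y1d _ Uq) (y1d _ Uq) yzyb).
by rewrite -yzbC // lipC lip_yzb_yz // oppr0.
Qed.

Let kk q := \sum_j k q j * conjc (k q j).

Lemma kappa_y q : U q -> lip (kappa q) (y q) = 0.
Proof.
move=> Uq; rewrite kappaE // lip_suml big1 // => j _.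
by rewrite lipZl py // mulr0.
Qed.

(** [lip Y_zzbar Y_zzbar] is computed by moving derivatives, as
    [lip Y_zz Y_zbarzbar], which the normal part [kappa] of [Y_zz] determines. *)
Lemma lip_yzb_yzb q : U q -> lip (yzb q) (yzb q) = kk q.
Proof.
move=> Uq.
have tE : E yzz q = D yzb q by apply: mdirC oU (y1 (dz_dir R)) Uq.
have e1 := lip_deriv (dzbar_dir R) Uq (y2d _ _ Uq) (y1d _ Uq) lip_yzz_yb.
have e2 := lip_deriv (dz_dir R) Uq (y2d _ _ Uq) (y1d _ Uq) lip_yzb_yb.
rewrite -(yzbC Uq) in e2.
rewrite -tE in e2.
have {}e2 := etrans (esym e1) e2.
have {e1}e2 := oppr_inj e2.
rewrite -e2.
have -> : E (E y) q = Defs.conjmx (yzz q).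
  rewrite conj_mdir_dz; last exact: y1d.
  apply: mdir_near_eq; near=> x; apply/esym/conj_yz.
  by near: x; exact: open_nbhs_nbhs.
have ky := kappa_y Uq.
have yk : lip (y q) (Defs.conjmx (kappa q)) = 0.
  by rewrite -[y q]y_real lip_conjmx lipC ky conjc0.
rewrite (yzzE Uq) conjmxD conjmxZ y_real !lin (yy Uq) yk ky !(mulr0, addr0, add0r).
have -> : Defs.conjmx (kappa q) = \sum_j conjc (k q j) *: psi j q.
  by rewrite (kappaE Uq) conjmx_sum; apply: eq_bigr => j _; rewrite conjmxZ psi_real.
rewrite (kappaE Uq) lip_suml; apply: eq_bigr => j _.
by rewrite lipZl lip_orthonormal // => l; exact: pp.
Unshelve. all: by end_near. Qed.

(** The product with [Y_zbar] kills the coefficient of [Y_z] and conversely, the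
    product with [Y] fixes that of [Y_zzbar], and [lip N N = 0] gives that of [Y] by
    [lip_yzb_yzb]. *)
Lemma nE q : U q -> nn q = 2 *: yzb q + (2 * kk q) *: y q.
Proof.
move=> Uq; have [a [b [c [d' e]]]] := n_span Uq.
rewrite (conj_yzb Uq) -mulr2n -scaler_nat scalerA in e; move: (d' * _) e => d e.
have half : (2^-1 : R[i]) != 0 by rewrite invr_eq0 pnatr_eq0.
have h2 : (2 : R[i]) != 0 by rewrite pnatr_eq0.
have := nyz Uq; rewrite e !lin (lip_y_yz Uq) (yzyz Uq) (lipC (yb q)) (yzyb Uq) (lip_yzb_yz Uq).
rewrite !mulr0 !add0r addr0 => /eqP; rewrite mulf_eq0 (negPf half) orbF => /eqP c0.
have := nyb Uq; rewrite e !lin (lip_y_yb Uq) (yzyb Uq) (lip_yb_yb Uq) (lip_yzb_yb Uq).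
rewrite !mulr0 !add0r !addr0 => /eqP; rewrite mulf_eq0 (negPf half) orbF => /eqP b0.
rewrite b0 c0 !scale0r !addr0 in e.
have := ny Uq; rewrite e !lin yy // lip_yzb_y // mulr0 add0r mulrN => /oppr_inj d2.
have {}d2 : d = 2 by rewrite -[d](mulfK half) d2 invrK mul1r.
have := nnn Uq; rewrite e d2 !lin yy // lip_yzb_y // (lipC (y q)) lip_yzb_y // lip_yzb_yzb //.
have -> : a * (a * 0) + a * (2 * - 2^-1) + (2 * (a * - 2^-1) + 2 * (2 * kk q)) = 2 * (2 * kk q - a).
  by field.
move=> /eqP; rewrite mulf_eq0 (negPf h2) subr_eq0 => /eqP <-.
by rewrite b0 c0 !scale0r !addr0 addrC.
Qed.

Let kk_cdiff q : U q -> cdiff kk q.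
Proof.
move=> Uq; have := cdiff_lip (y2d (dz_dir R) (dzbar_dir R) Uq) (y2d (dz_dir R) (dzbar_dir R) Uq).
apply: cdiff_near_eq; near=> x; apply: lip_yzb_yzb.
by near: x; exact: open_nbhs_nbhs.
Unshelve. all: by end_near. Qed.

Let two_kk_cdiff q : U q -> cdiff (fun x => 2 * kk x) q.
Proof. by move=> Uq; apply: cdiffM; [exact: cdiff_cst | exact: kk_cdiff]. Qed.

Let nE_near q : U q -> \near q, 2 *: yzb q + (2 * kk q) *: y q = nn q.
Proof.
move=> Uq; near=> x; apply/esym/nE.
by near: x; exact: open_nbhs_nbhs.
Unshelve. all: by end_near. Qed.

(** The differentiability of [N] comes from the formula [nE]. *)
Lemma nn_diff q : U q -> mdiff nn q.
Proof.
move=> Uq; apply: mdiff_near_eq (nE_near Uq) _.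
apply: mdiffD; first by apply: mdiffZc; exact: y2d.
by apply: mdiffZ; [exact: two_kk_cdiff | exact: yd].
Qed.

Lemma lip_n_yzb q : U q -> lip (nn q) (yzb q) = kk q.
Proof.
move=> Uq; have h2 : (2 : R[i]) != 0 by rewrite pnatr_eq0.
have := nnn Uq; rewrite {2}nE // !lin ny // => e; apply: (mulfI h2).
by apply/eqP; rewrite -subr_eq0 -[X in _ == X]e mulrN1.
Qed.

Lemma lip_n_yzz q : U q -> lip (nn q) (yzz q) = s q / 2.
Proof.
move=> Uq; rewrite yzzE // !lin ny // kappaE // lip_sumr big1 ?addr0.
  by rewrite mulrN1 opprK.
by move=> j _; rewrite lipZr (lipC (nn q)) pn // mulr0.
Qed.

Lemma lip_nz_y q : U q -> lip (D nn q) (y q) = 0.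
Proof. by move=> Uq; rewrite (lip_deriv (dz_dir R) Uq (nn_diff Uq) (yd Uq) ny) nyz ?oppr0. Qed.

Lemma lip_nz_yz q : U q -> lip (D nn q) (yz q) = - (s q / 2).
Proof. by move=> Uq; rewrite (lip_deriv (dz_dir R) Uq (nn_diff Uq) (y1d _ Uq) nyz) lip_n_yzz. Qed.

Lemma lip_nz_yb q : U q -> lip (D nn q) (yb q) = - kk q.
Proof.
by move=> Uq; rewrite (lip_deriv (dz_dir R) Uq (nn_diff Uq) (y1d _ Uq) nyb) -(yzbC Uq) lip_n_yzb.
Qed.

Lemma lip_nz_n q : U q -> lip (D nn q) (nn q) = 0.
Proof.
move=> Uq; apply: half0.
by rewrite {1}(lip_deriv (dz_dir R) Uq (nn_diff Uq) (nn_diff Uq) nnn) lipC.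
Qed.

Lemma lip_p_yzz q j : U q -> lip (psi j q) (yzz q) = k q j.
Proof.
move=> Uq; rewrite (yzzE Uq) (kappaE Uq) !lin (py _ Uq) mulr0 add0r.
by apply: lip_orthonormal => l; exact: pp.
Qed.

Lemma lip_p_yzb q j : U q -> lip (psi j q) (yzb q) = 0.
Proof.
move=> Uq; have h2 : (2 : R[i]) != 0 by rewrite pnatr_eq0.
have := pn j Uq; rewrite nE // !lin py // mulr0 addr0 => /eqP.
by rewrite mulf_eq0 (negPf h2) => /eqP.
Qed.

Lemma lip_pz_y q j : U q -> lip (D (psi j) q) (y q) = 0.
Proof.
move=> Uq; rewrite (lip_deriv (dz_dir R) Uq (psi_diff _ Uq) (yd Uq) (c := 0)).
  by rewrite pyz // oppr0.
by move=> x; exact: py.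
Qed.

Lemma lip_pz_yz q j : U q -> lip (D (psi j) q) (yz q) = - k q j.
Proof.
move=> Uq; rewrite (lip_deriv (dz_dir R) Uq (psi_diff _ Uq) (y1d _ Uq) (c := 0)).
  by rewrite lip_p_yzz.
by move=> x; exact: pyz.
Qed.

Lemma lip_pz_yb q j : U q -> lip (D (psi j) q) (yb q) = 0.
Proof.
move=> Uq; rewrite (lip_deriv (dz_dir R) Uq (psi_diff _ Uq) (y1d _ Uq) (c := 0)).
  by rewrite -(yzbC Uq) lip_p_yzb // oppr0.
by move=> x; exact: pyb.
Qed.

Let kappa_diff q : U q -> mdiff kappa q.
Proof.
move=> Uq.
have : mdiff (fun x => \sum_j lip (psi j x) (yzz x) *: psi j x) q.
  apply: mdiff_sum => j; apply: mdiffZ; last exact: psi_diff.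
  by apply: cdiff_lip; [exact: psi_diff | exact: y2d].
apply: mdiff_near_eq; near=> x.
have Ux : U x by near: x; exact: open_nbhs_nbhs.
by rewrite kappaE //; apply: eq_bigr => j _; rewrite lip_p_yzz.
Unshelve. all: by end_near. Qed.

(** [Y_zzzbar] and [kappa_zbar] have the same normal components, because
    [Y_zz - kappa] is a multiple of [Y] and [Y_zbar] is tangential. *)
Lemma lip_yzzb_p q j : U q -> lip (E yzz q) (psi j q) = beta q j.
Proof.
move=> Uq; pose r x := yzz x - kappa x.
have dr : mdiff r q by apply: mdiffB; [exact: y2d | exact: kappa_diff].
have rE x : U x -> r x = (- (s x / 2)) *: y x by move=> Ux; rewrite /r yzzE // addrK.
have r0 x : U x -> lip (r x) (psi j x) = 0.
  by move=> Ux; rewrite rE // lipZl lipC py // mulr0.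
have := lip_deriv (dzbar_dir R) Uq dr (psi_diff j Uq) r0.
rewrite {1}/r mdirB; [|exact: y2d|exact: kappa_diff].
rewrite (rE _ Uq) lipBl lipZl (beta_kappa _ Uq).
have py' x : U x -> lip (y x) (psi j x) = 0 by move=> Ux; rewrite lipC py.
have := lip_deriv (dzbar_dir R) Uq (yd Uq) (psi_diff j Uq) py'.
rewrite (lipC (yb q)) (pyb _ Uq) => /esym/eqP; rewrite oppr_eq0 => /eqP ->.
by rewrite mulr0 oppr0 => /eqP; rewrite subr_eq0 => /eqP.
Qed.

Lemma lip_nz_p q j : U q -> lip (D nn q) (psi j q) = 2 * beta q j.
Proof.
move=> Uq; rewrite -(mdir_near_eq _ (nE_near Uq)) mdirD; first last.
- by apply: mdiffZ; [exact: two_kk_cdiff | exact: yd].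
- by apply: mdiffZc; exact: y2d.
rewrite mdirZc; last exact: y2d.
rewrite mdirZ; [|exact: two_kk_cdiff|exact: yd].
have <- : E yzz q = D yzb q by apply: mdirC oU (y1 (dz_dir R)) Uq.
rewrite !lin (lip_yzzb_p _ Uq) (lipC (y q)) (py _ Uq) (lipC (yz q)) (pyz _ Uq).
by rewrite !mulr0 !addr0.
Qed.

Lemma lip_pz_n q j : U q -> lip (D (psi j) q) (nn q) = - (2 * beta q j).
Proof.
move=> Uq; rewrite (lip_deriv (dz_dir R) Uq (psi_diff _ Uq) (nn_diff Uq) (c := 0)).
  by rewrite lipC lip_nz_p.
by move=> x; exact: pn.
Qed.

Lemma lip_pz_p_skew q i j : U q ->
  lip (D (psi i) q) (psi j q) + lip (D (psi j) q) (psi i q) = 0.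
Proof.
move=> Uq; rewrite (lip_deriv (dz_dir R) Uq (psi_diff _ Uq) (psi_diff _ Uq) (c := (i == j)%:R)).
  by rewrite lipC addNr.
by move=> x; exact: pp.
Qed.

Let Fm x := frame_mx (y x) (nn x) (yz x) (yb x) (fun j => psi j x).

Lemma frame_diff q : U q -> mdiff Fm q.
Proof.
move=> Uq; apply: mdiff_frame_mx; [exact: yd|exact: nn_diff|exact: y1d|exact: y1d|].
by move=> j; exact: psi_diff.
Qed.

(** Since the frame is an isometry, its transpose times [I1] is [I1] times its
    inverse: this is the [dz] part of the Maurer-Cartan form. *)
Lemma frame_equation q : U q ->
  (Fm q)^T *m I1 R[i] m *m mdir (dz_dir R) Fm q =
  I1 R[i] m *m mxA (s q) (k q) (beta q) (fun j l => lip (D (psi j) q) (psi l q)).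
Proof.
move=> Uq; rewrite mdir_frame_mx; first last.
- exact: y1d.
- exact: y1d.
- exact: nn_diff.
- exact: yd.
rewrite -(yzbC Uq).
apply: frame_gram; rewrite ?knormE -?/(kk q).
- exact: lip_y_yz.
- exact: nyz.
- exact: yzyz.
- exact: yzyb.
- by rewrite lipC; exact: lip_nz_y.
- by rewrite lipC; exact: lip_nz_n.
- by rewrite lipC; exact: lip_nz_yz.
- by rewrite lipC; exact: lip_nz_yb.
- by rewrite lipC; exact: lip_yzz_y.
- exact: lip_n_yzz.
- by rewrite lipC; exact: lip_yzz_yz.
- by rewrite lipC; exact: lip_yzz_yb.
- by rewrite lipC; exact: lip_yzb_y.
- exact: lip_n_yzb.
- by rewrite lipC; exact: lip_yzb_yz.
- by rewrite lipC; exact: lip_yzb_yb.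
- by move=> j; exact: pyz.
- by move=> j; rewrite lipC; exact: lip_nz_p.
- by move=> j; exact: lip_p_yzz.
- by move=> j; exact: lip_p_yzb.
- by move=> j; rewrite lipC; exact: lip_pz_y.
- by move=> j; rewrite lipC; exact: lip_pz_n.
- by move=> j; rewrite lipC; exact: lip_pz_yz.
- by move=> j; rewrite lipC; exact: lip_pz_yb.
- by move=> i j; rewrite lipC.
Qed.

End StructureEquations.

(** * Real and complex vectors *)

Section RealAndComplexVectors.
Variable R : realType.

Lemma cplxE a b (u : 'M[R[i]]_(a, b)) : u = cplx (Remx u) + 'i *: cplx (Immx u).
Proof.
apply/matrixP => i j; rewrite !mxE -complexiE; apply: complex_ext.
  by rewrite ReD ReM /= !(mul0r, mulr0) subr0 addr0.
by rewrite ImD ImM /= !(mul0r, mulr0, mul1r) ?(add0r, addr0).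
Qed.

Lemma conjmx_cplx a b (A : 'M[R]_(a, b)) : Defs.conjmx (cplx A) = cplx A.
Proof. by apply/matrixP => i j; rewrite !mxE conjc_real. Qed.

Lemma Remx_cplx a b (A : 'M[R]_(a, b)) : Remx (cplx A) = A.
Proof. by apply/matrixP => i j; rewrite !mxE. Qed.

Lemma cplx_Remx a b (u : 'M[R[i]]_(a, b)) :
  cplx (Remx u) = 2^-1 *: (u + Defs.conjmx u).
Proof.
apply/matrixP => i j; rewrite !mxE; have h2 : (2 : R[i]) != 0 by rewrite pnatr_eq0.
apply: (mulfI h2); rewrite mulrA mulfV // mul1r; case: (u i j) => x y.
by apply: complex_ext; rewrite ?(ReD, ImD, ReM, ImM) /=; ring.
Qed.

Lemma cplx_Immx a b (u : 'M[R[i]]_(a, b)) :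
  cplx (Immx u) = (- 'i / 2) *: (u - Defs.conjmx u).
Proof.
apply/matrixP => i j; rewrite !mxE; have h2 : (2 : R[i]) != 0 by rewrite pnatr_eq0.
apply: (mulfI h2); rewrite [RHS]mulrA [X in _ = X * _](mulrC 2) divfK // -complexiE; case: (u i j) => x y.
by apply: complex_ext; rewrite ?(ReD, ImD, ReM, ImM) /=; ring.
Qed.

Lemma cplx_real a b (u : 'M[R[i]]_(a, b)) : Defs.conjmx u = u -> cplx (Remx u) = u.
Proof.
move=> ur; have uu : u + u = 2 *: u by rewrite scaler_nat mulr2n.
by rewrite cplx_Remx ur uu scalerA mulVf ?scale1r ?pnatr_eq0.
Qed.

Lemma cplxD a b (A B : 'M[R]_(a, b)) : cplx (A + B) = cplx A + cplx B.
Proof. exact: map_mxD. Qed.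

Lemma cplxZ a b (c : R) (A : 'M[R]_(a, b)) : cplx (c *: A) = c%:C *: cplx A.
Proof. exact: map_mxZ. Qed.

Lemma cplxM a b c (A : 'M[R]_(a, b)) (B : 'M[R]_(b, c)) :
  cplx (A *m B) = cplx A *m cplx B.
Proof. exact: map_mxM. Qed.

Lemma cplx_inj a b (A B : 'M[R]_(a, b)) : cplx A = cplx B -> A = B.
Proof. by move=> /(congr1 (@Remx _ _ _)); rewrite !Remx_cplx. Qed.

Lemma cplx_I1 m : cplx (I1 R m) = I1 R[i] m.
Proof.
apply/matrixP => i j; rewrite !mxE; case: (i == j); case: (i == 0) => //=.
by rewrite !mulr1n; apply: complex_ext; rewrite /= ?oppr0.
Qed.

Lemma lip_cplx m (x y : 'cV[R]_m.+1) : lip (cplx x) (cplx y) = (lip x y)%:C.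
Proof.
rewrite /lip !mxE [RHS]rmorphD rmorphN rmorphM rmorph_sum /=; congr (_ + _).
by apply: eq_bigr => j _; rewrite !mxE -rmorphM.
Qed.

Lemma mCk_cplx a b k (U : set (R * R)) (f : R * R -> 'M[R]_(a, b)) :
  open U -> Ck k U f -> mCk k U (fun q => cplx (f q)).
Proof.
move=> oU fk i j; have fij := Ck_entry i j oU fk; split.
  by apply: Ck_eq_on fij => // x Ux; rewrite mxE.
apply: Ck_eq_on (Ck_scale 0 oU fij) => // x Ux.
by rewrite mxE scale0r.
Qed.

End RealAndComplexVectors.

(** * Derivatives in a coordinate *)

Section Charts.
Variables (R : realType) (M : riemann_surface R) (z : chart R M).
Local Notation U := (z @` cdom z).

Lemma chart_image q : U q -> z (cinv z q) = q /\ cdom z (cinv z q).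
Proof. by move=> [p zp <-]; rewrite cmapK. Qed.

Lemma DzE a b (g : M -> 'M[R[i]]_(a, b)) p :
  Dz z g p = mdir (dz_dir R) (fun q => g (cinv z q)) (z p).
Proof.
apply/matrixP => i j; rewrite !mxE /cdir /cderive /dreal.
move: ('D__ _ _ +i* 'D__ _ _) ('D__ _ _ +i* 'D__ _ _) => x y /=.
by rewrite mulrDr mulrN mulrA mulNr.
Qed.

Lemma DzbarE a b (g : M -> 'M[R[i]]_(a, b)) p :
  Dzbar z g p = mdir (dzbar_dir R) (fun q => g (cinv z q)) (z p).
Proof.
apply/matrixP => i j; rewrite !mxE /cdir /cderive /dreal.
move: ('D__ _ _ +i* 'D__ _ _) ('D__ _ _ +i* 'D__ _ _) => x y /=.
by rewrite mulrDr mulrA.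
Qed.

Lemma near_chart p : cdom z p -> \forall q \near z p, U q.
Proof. by move=> zp; apply: open_nbhs_nbhs; split; [exact: cimg_open | exists p]. Qed.

Lemma near_chart_eq T (g h : R * R -> T) p :
  cdom z p -> (forall q, U q -> g q = h q) -> \forall q \near z p, g q = h q.
Proof. by move=> zp gh; apply: filterS (near_chart zp) => q; exact: gh. Qed.

Lemma mdir_Dz a b w (g : M -> 'M[R[i]]_(a, b)) p : cdom z p ->
  mdir w (fun q => Dz z g (cinv z q)) (z p) =
  mdir w (mdir (dz_dir R) (fun q => g (cinv z q))) (z p).
Proof.
move=> zp; apply: mdir_near_eq; apply: near_chart_eq => // q Uq.
by rewrite DzE (chart_image Uq).1.
Qed.

Lemma smooth_on_chart (W : normedModType R) (A : set M) (g : M -> W) k :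
  coordinate z -> cdom z `<=` A -> smooth_on A g -> Ck k U (fun q => g (cinv z q)).
Proof.
move=> zc zA /(_ z zc k); congr (Ck _ _ _).
by rewrite (_ : cdom z `&` A = cdom z) //; apply/seteqP; split=> [p []//|p zp]; split=> //; exact: zA.
Qed.

End Charts.

Section WirtingerDerivatives.
Variable R : realType.
Local Notation plane := (R * R)%type.

(** The decomposition [dh = h_z dz + h_zbar dzbar]. *)
Lemma cderive_wirtinger (v q : plane) h : cdiff h q ->
  cderive v h q = (v.1 +i* v.2) * cdir (dz_dir R) h q +
    conjc (v.1 +i* v.2) * cdir (dzbar_dir R) h q.
Proof.
move=> dh; rewrite cderive_cdir // /cdir.
move: (cderive _ _ _) (cderive _ _ _) => x y; rewrite /dz_dir /dzbar_dir.
have h2 : (2 : R[i]) != 0 by rewrite pnatr_eq0.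
have -> : conjc (v.1 +i* v.2) = v.1%:C - 'i * v.2%:C.
  by rewrite -complexiE; apply: complex_ext; rewrite ?(ReD, ImD) ?conjcN /=; ring.
have -> : v.1 +i* v.2 = v.1%:C + 'i * v.2%:C.
  by rewrite -complexiE; apply: complex_ext; rewrite ?(ReD, ImD) /=; ring.
have ix (a : R[i]) : 'i * ('i * a) = - a by rewrite mulrA -expr2 sqrCi mulN1r.
transitivity (v.1%:C * y - 'i * ('i * (v.2%:C * x))); first by rewrite ix opprK.
rewrite -[RHS]/((v.1%:C + 'i * v.2%:C) * (2^-1 * y + - (2^-1 * 'i) * x) +
  (v.1%:C - 'i * v.2%:C) * (2^-1 * y + (2^-1 * 'i) * x)).
by field.
Qed.

(** For a real function [h_zbar] is the conjugate of [h_z]. *)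
Lemma derive_real_mx a b (G : plane -> 'M[R]_(a, b)) v q :
  mdiff (fun x => cplx (G x)) q ->
  cplx ('D_v G q) = (v.1 +i* v.2) *: mdir (dz_dir R) (fun x => cplx (G x)) q +
    conjc (v.1 +i* v.2) *: Defs.conjmx (mdir (dz_dir R) (fun x => cplx (G x)) q).
Proof.
move=> dG; rewrite conj_mdir_dz_real //; last by move=> x; exact: conjmx_cplx.
have dGij i j : differentiable (fun x => G x i j) q.
  have [d _] := dG i j; rewrite (_ : (fun x => _) = (fun x => complex.Re (cplx (G x) i j))) //.
  by apply/funext => x; rewrite mxE.
have dGv : derivable G q v by apply/derivable_mxP => i j; exact: diff_derivable.
apply/matrixP => i j; rewrite (derive_mx dGv) ![in RHS]mxE -cderive_wirtinger //.
rewrite !mxE; apply: complex_ext => /=.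
  by congr ('D_v _ q); apply/funext => x; rewrite mxE.
rewrite (_ : (fun x => _) = cst 0); first by rewrite derive_cst.
by apply/funext => x; rewrite mxE.
Qed.

End WirtingerDerivatives.

(** * Null vectors and spans *)

Section LightCone.
Variables (R : realType) (m : nat).
Implicit Types x y : 'cV[R]_m.+1.

(** Two null vectors of negative product lie in the same half of the cone:
    [x_0 y - y_0 x] has time component zero, hence nonnegative square. *)
Lemma lightcone_same_sign x y : lip x x = 0 -> lip y y = 0 -> lip x y < 0 ->
  0 < x 0 0 -> 0 < y 0 0.
Proof.
move=> xx yy xy x0; pose w := x 0 0 *: y - y 0 0 *: x.
have w0 : w 0 0 = 0 by rewrite !mxE mulrC subrr.
have ww : 0 <= lip w w.
  rewrite /lip w0 mulr0 oppr0 add0r; apply: sumr_ge0 => j _.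
  by rewrite -expr2 sqr_ge0.
move: ww; rewrite !(lipBl, lipBr, lipZl, lipZr) xx yy (lipC y x) !mulr0 => ww.
have {ww} ww : 0 <= y 0 0 * (x 0 0 * - lip x y) by nra.
have p : 0 < x 0 0 * - lip x y by rewrite mulr_gt0 // oppr_gt0.
have y0 : 0 <= y 0 0 by rewrite pmulr_lge0 in ww.
rewrite lt_neqAle y0 andbT; apply/eqP => y00.
have y_0 : y = 0 by apply: lip_self_le0; rewrite ?yy.
by move: xy; rewrite y_0 lip0r ltxx.
Qed.

End LightCone.

Section SpanOfFour.
Variables (F : fieldType) (V : vectType F).

Lemma span4P (v v1 v2 v3 v4 : V) : v \in <<[:: v1; v2; v3; v4]>>%VS ->
  exists a b c d, v = a *: v1 + b *: v2 + c *: v3 + d *: v4.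
Proof.
rewrite !span_cons span_nil addv0.
case/memv_addP => _ /vlineP[a ->] [_ /memv_addP[_ /vlineP[b ->] [_ /memv_addP[_ /vlineP[c ->] [_ /vlineP[d ->] ->]] ->]] ->].
by exists a, b, c, d; rewrite !addrA.
Qed.

Lemma mem_span4 (v1 v2 v3 v4 : V) (a b c d : F) :
  a *: v1 + b *: v2 + c *: v3 + d *: v4 \in <<[:: v1; v2; v3; v4]>>%VS.
Proof.
by rewrite !rpredD // rpredZ // memv_span // !inE eqxx ?orbT.
Qed.

End SpanOfFour.

(** * From an immersion to its frame *)

Lemma combination_rearrange (T : comNzRingType) m p (A u u' w w' : 'M[T]_(m, p))
    (a b c d h e : T) :
  a *: A + b *: (h *: (u + u')) + c *: (e *: (u - u')) + d *: (h *: (w + w')) =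
  a *: A + (b * h + c * e) *: u + (b * h - c * e) *: u' + (d * h) *: (w + w').
Proof. by apply/matrixP => i j; rewrite !mxE; ring. Qed.

(** Expresses a vector of the real span [V] through [Y_z] and [Y_zbar], which
    satisfy simpler relations than their real and imaginary parts. *)
Lemma cplx_combination (R : realType) m p (Y : 'M[R]_(m, p)) (u w : 'M[R[i]]_(m, p))
    (a b c d : R) :
  cplx (a *: Y + b *: Remx u + c *: Immx u + d *: Remx w) =
  a%:C *: cplx Y + (b%:C / 2 + c%:C * (- 'i / 2)) *: u +
  (b%:C / 2 - c%:C * (- 'i / 2)) *: Defs.conjmx u +
  (d%:C / 2) *: (w + Defs.conjmx w).
Proof.
rewrite !cplxD !cplxZ !cplx_Remx cplx_Immx; exact: combination_rearrange.
Qed.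

Lemma cols4E (T : Type) m (a b c d : 'cV[T]_m) i (j : 'I_4) :
  cols4 a b c d i j = nth a [:: a; b; c; d] j i 0.
Proof.
rewrite mxE; case: splitP => l jl; rewrite mxE; case: splitP => l' ll';
  by rewrite jl ll' (ord1 l').
Qed.

Lemma cplx_tr (R : realType) m p (A : 'M[R]_(m, p)) : cplx (A^T) = (cplx A)^T.
Proof. by apply/matrixP => i j; rewrite !mxE. Qed.

(** The change of basis from [(Y, N)] to [((Y + N) / sqrt 2, (- Y + N) / sqrt 2)],
    a rotation by [pi / 4], completed by the identity. *)
Definition null_to_orthonormal (R : realType) : 'M[R]_(2 + 2) :=
  block_mx ((Num.sqrt 2)^-1 *: block_mx 1%:M (- 1%:M) 1%:M 1%:M : 'M[R]_(1 + 1)) 0 0 1%:M.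

Lemma cols4_null_to_orthonormal (R : realType) m (a b c d : 'cV[R]_m) :
  cols4 a b c d *m null_to_orthonormal R =
  cols4 ((Num.sqrt 2)^-1 *: (a + b)) ((Num.sqrt 2)^-1 *: (- a + b)) c d.
Proof.
pose ab : 'M[R]_(m, 1 + 1) := row_mx a b; pose cd : 'M[R]_(m, 1 + 1) := row_mx c d.
transitivity (row_mx (ab *m ((Num.sqrt 2)^-1 *: block_mx 1%:M (- 1%:M) 1%:M 1%:M)) cd).
  transitivity (row_mx ab cd *m null_to_orthonormal R); first by [].
  by rewrite mul_row_block !mulmx0 mulmx1 add0r addr0.
rewrite -scalemxAr mul_row_block !mulmx1 mulmxN mulmx1.
by rewrite scale_row_mx.
Qed.

Lemma det_null_to_orthonormal (R : realType) : \det (null_to_orthonormal R) = 1.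
Proof.
rewrite det_ublock det1 mulr1 detZ.
rewrite (_ : \det _ = 2); last first.
  have -> : block_mx 1%:M (- 1%:M) 1%:M 1%:M =
      block_mx 1%:M 0 1%:M 1%:M *m block_mx 1%:M (- 1%:M) 0 2%:M :> 'M[R]_(1 + 1).
    rewrite mulmx_block !(mulmx1, mul1mx, mulmx0, mul0mx, addr0, add0r); congr block_mx.
    by apply/matrixP => i j; rewrite !ord1 !mxE eqxx; ring.
  have d1 := det_lblock (1%:M : 'M[R]_1) 1%:M 1%:M.
  have d2 := det_ublock (1%:M : 'M[R]_1) (- 1%:M) 2%:M.
  by rewrite det_mulmx [X in X * _]d1 [X in _ * X]d2 !det1 det_scalar expr1 !mul1r.
by rewrite exprVn sqr_sqrtr // mulVf // pnatr_eq0.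
Qed.

Lemma cplx_sum_conj (R : realType) m p (u : 'M[R[i]]_(m, p)) :
  cplx (Remx (u + Defs.conjmx u)) = u + Defs.conjmx u.
Proof. by apply: cplx_real; rewrite conjmxD conjmxK addrC. Qed.

Lemma cplx_diff_conj (R : realType) m p (u : 'M[R[i]]_(m, p)) :
  cplx (Remx ('i *: (u - Defs.conjmx u))) = 'i *: (u - Defs.conjmx u).
Proof.
apply: cplx_real; apply/matrixP => i j; rewrite !mxE -complexiE.
by case: (u i j) => a b; apply: complex_ext => /=; ring.
Qed.

Section RealFunctions.
Variables (R : realType) (M : riemann_surface R) (z : chart R M) (m p : nat).
Variables (Y : M -> 'M[R]_(m, p)) (x : M).
Hypothesis dY : differentiable (fun q => Y (cinv z q)) (z x).

Lemma dcplx_cplx v : dcplx z v (cplx \o Y) x = cplx (dreal z v Y x).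
Proof.
apply/matrixP => i j; rewrite !mxE /dreal (derive_entry _ _ _ dY).
apply: complex_ext => /=.
  by congr ('D_v _ _); apply/funext => q; rewrite /= mxE.
rewrite (_ : _ \o _ = cst 0) ?derive_cst //.
by apply/funext => q; rewrite /= mxE.
Qed.

Lemma Dz_cplx :
  Dz z (cplx \o Y) x = 2^-1 *: (cplx (du z Y x) - 'i *: cplx (dv z Y x)).
Proof. by rewrite /Dz !dcplx_cplx. Qed.

Lemma Dzbar_cplx :
  Dzbar z (cplx \o Y) x = 2^-1 *: (cplx (du z Y x) + 'i *: cplx (dv z Y x)).
Proof. by rewrite /Dzbar !dcplx_cplx. Qed.

Lemma Remx_DzD : Remx (Dz z (cplx \o Y) x + Dzbar z (cplx \o Y) x) = du z Y x.
Proof.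
rewrite Dz_cplx Dzbar_cplx -scalerDr addrACA addNr addr0.
have uu (u : 'M[R[i]]_(m, p)) : u + u = 2 *: u by rewrite scaler_nat mulr2n.
by rewrite uu scalerA mulVf ?pnatr_eq0 // scale1r Remx_cplx.
Qed.

Lemma Remx_DzB :
  Remx ('i *: (Dz z (cplx \o Y) x - Dzbar z (cplx \o Y) x)) = dv z Y x.
Proof.
rewrite Dz_cplx Dzbar_cplx -scalerBr.
have -> (T : fieldType) (a b : 'M[T]_(m, p)) : a - b - (a + b) = - (2 *: b).
  by apply/matrixP => i j; rewrite !mxE; ring.
rewrite -scaleNr !scalerA (_ : 'i * _ * _ * _ = 1) ?scale1r ?Remx_cplx //.
have ii : 'i * 'i = -1 :> R[i] by rewrite -expr2 sqrCi.
transitivity (- ('i * 'i) : R[i]); last by rewrite ii opprK.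
by field.
Qed.

End RealFunctions.

Section FromImmersionToFrame.
Local Opaque mdir lip frame_mx.
Variables (R : realType) (n : nat) (M : riemann_surface R).
Local Notation vec := 'cV[R]_(4 + n).
Local Notation ip := (@lip _ (3 + n)).
Variables (y : M -> set vec) (z : chart R M) (Y N : M -> vec)
  (psi : M -> 'M[R]_(4 + n, n)) (s : M -> R[i]) (kappa : M -> 'cV[R[i]]_(4 + n))
  (k beta : M -> 'I_n -> R[i]) (b : M -> 'I_n -> 'I_n -> R[i]).
Hypotheses (cy : conformal_immersion y) (zc : coordinate z)
  (cl : canonical_lift y z Y) (ld : lift_dual z Y N)
  (nf : oriented_normal_frame z Y N psi) (sh : schwarzian_hopf z Y s kappa)
  (sf : structure_functions z Y psi kappa k beta b).

Local Notation U := (z @` cdom z).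
Local Notation D := (mdir (dz_dir R)).
Local Notation E := (mdir (dzbar_dir R)).
Let yc q : 'cV[R[i]]_(4 + n) := cplx (Y (cinv z q)).
Let nc q : 'cV[R[i]]_(4 + n) := cplx (N (cinv z q)).
Let ps (j : 'I_n) q : 'cV[R[i]]_(4 + n) := cplx (col j (psi (cinv z q))).
Let kap q := kappa (cinv z q).

Let oU : open U. Proof. exact: cimg_open. Qed.

Let y_smooth : mCk 3 U yc.
Proof.
apply: mCk_cplx => //; case: cl => [[_ Ys _] _].
exact: smooth_on_chart Ys.
Qed.

Let psi_diff q j : U q -> mdiff (ps j) q.
Proof.
case: nf => ps_smooth _; apply: mCk_mdiff (_ : mCk 1 U (ps j)).
apply: mCk_cplx => //; rewrite (_ : (fun q => _) = fun q => psi (cinv z q) *m delta_mx j 0).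
  by apply: Ck_mulmxr => //; exact: smooth_on_chart ps_smooth.
by apply/funext => q0; rewrite colE.
Qed.

Let DzYE p : Dz z (cplx \o Y) p = D yc (z p). Proof. exact: DzE. Qed.
Let DzbarYE p : Dzbar z (cplx \o Y) p = E yc (z p). Proof. exact: DzbarE. Qed.
Let DzbarDzYE p : cdom z p -> Dzbar z (Dz z (cplx \o Y)) p = E (D yc) (z p).
Proof. by move=> zp; rewrite DzbarE mdir_Dz. Qed.
Let DzDzYE p : cdom z p -> Dz z (Dz z (cplx \o Y)) p = D (D yc) (z p).
Proof. by move=> zp; rewrite DzE mdir_Dz. Qed.

Let yy q : U q -> ip (yc q) (yc q) = 0.
Proof.
move=> /chart_image[_ zp]; case: cl => [[_ _ /(_ _ zp)[[Y0 _] _]] _].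
by rewrite (@lip_cplx _ (3 + n)) Y0.
Qed.

Let yzyz q : U q -> ip (D yc q) (D yc q) = 0.
Proof.
move=> /chart_image[zq zp]; have [_ /(_ _ _ z cl.1 zc _ zp zp)[]] := cy.
by rewrite !DzYE zq.
Qed.

Let yzyb q : U q -> ip (D yc q) (E yc q) = 2^-1.
Proof. by move=> /chart_image[zq zp]; have := cl.2 _ zp; rewrite DzYE DzbarYE zq. Qed.

Let ny q : U q -> ip (nc q) (yc q) = -1.
Proof.
move=> /chart_image[zq zp]; have [_ _ _ _ e] := ld zp.
by rewrite (@lip_cplx _ (3 + n)) e; apply: complex_ext; rewrite /= ?oppr0.
Qed.

Let nyz q : U q -> ip (nc q) (D yc q) = 0.
Proof. by move=> /chart_image[zq zp]; have [_ e _ _ _] := ld zp; rewrite DzYE zq in e. Qed.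

Let nyb q : U q -> ip (nc q) (E yc q) = 0.
Proof. by move=> /chart_image[zq zp]; have [_ _ e _ _] := ld zp; rewrite DzbarYE zq in e. Qed.

Let nnn q : U q -> ip (nc q) (nc q) = 0.
Proof.
by move=> /chart_image[zq zp]; have [_ _ _ e _] := ld zp; rewrite (@lip_cplx _ (3 + n)) e.
Qed.

Let y_real q : Defs.conjmx (yc q) = yc q. Proof. exact: conjmx_cplx. Qed.

Let conj_yz q : U q -> Defs.conjmx (D yc q) = E yc q.
Proof.
move=> Uq; apply: conj_mdir_dz_real; first exact: mCk_mdiff y_smooth Uq.
by move=> x; exact: conjmx_cplx.
Qed.

Let n_span q : U q -> exists a b c d : R[i],
  nc q = a *: yc q + b *: D yc q + c *: E yc q + d *: (E (D yc) q + Defs.conjmx (E (D yc) q)).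
Proof.
move=> Uq; have [zq zp] := chart_image Uq; have [Ns _ _ _ _] := ld zp.
have [a0 [b0 [c0 [d0 e]]]] := span4P Ns.
rewrite DzYE DzbarDzYE // zq in e.
exists a0%:C, (b0%:C / 2 + c0%:C * (- 'i / 2)), (b0%:C / 2 - c0%:C * (- 'i / 2)), (d0%:C / 2).
by rewrite /nc e cplx_combination conj_yz.
Qed.

Let perp_cplx p (w : vec) (x : 'cV[R[i]]_(4 + n)) : perp (Vspan z Y p) w ->
  in_cplx [set a | a \in Vspan z Y p] x -> ip (cplx w) x = 0.
Proof.
move=> wp [xr xi]; rewrite [x]cplxE lipDr lipZr !(@lip_cplx _ (3 + n)) !wp //.
by rewrite mulr0 addr0.
Qed.

Let psi_perp p j : cdom z p -> perp (Vspan z Y p) (col j (psi p)).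
Proof. by case: nf => _ h /h[]. Qed.

Let Y_span p : Y p \in Vspan z Y p.
Proof. by rewrite memv_span // inE eqxx. Qed.

Let Yz_span p : in_cplx [set a | a \in Vspan z Y p] (Dz z (cplx \o Y) p).
Proof. by split; rewrite /= memv_span // !inE eqxx ?orbT. Qed.

Let N_span p : cdom z p -> N p \in Vspan z Y p.
Proof. by move=> /ld[]. Qed.

Let py q j : U q -> ip (ps j q) (yc q) = 0.
Proof.
by move=> /chart_image[zq zp]; rewrite (@lip_cplx _ (3 + n)) (psi_perp j zp (Y_span _)).
Qed.

Let pyz q j : U q -> ip (ps j q) (D yc q) = 0.
Proof.
move=> /chart_image[zq zp]; have := perp_cplx (psi_perp j zp) (Yz_span _).
by rewrite DzYE zq.
Qed.

Let pyb q j : U q -> ip (ps j q) (E yc q) = 0.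
Proof.
by move=> Uq; rewrite -conj_yz // -[ps j q]conjmx_cplx lip_conjmx pyz // conjc0.
Qed.

Let pn q j : U q -> ip (ps j q) (nc q) = 0.
Proof.
by move=> /chart_image[zq zp]; rewrite (@lip_cplx _ (3 + n)) (psi_perp j zp (N_span zp)).
Qed.

Let pp q i j : U q -> ip (ps i q) (ps j q) = (i == j)%:R.
Proof.
move=> /chart_image[zq zp]; case: nf => _ /(_ _ zp)[_ h _].
by rewrite (@lip_cplx _ (3 + n)) h rmorph_nat.
Qed.

Let psi_real q j : Defs.conjmx (ps j q) = ps j q.
Proof. exact: conjmx_cplx. Qed.

Let yzzE q : U q -> D (D yc) q = (- (s (cinv z q) / 2)) *: yc q + kap q.
Proof.
move=> /chart_image[zq zp]; have [e _] := sh zp.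
rewrite -[X in D (D yc) X]zq -(DzDzYE zp); exact: e.
Qed.

Let kappaE q : U q -> kap q = \sum_j k (cinv z q) j *: ps j q.
Proof. by move=> /chart_image[zq zp]; have [e _ _] := sf zp. Qed.

Let beta_kappa q j : U q -> ip (E kap q) (ps j q) = beta (cinv z q) j.
Proof.
move=> Uq; have [zq zp] := chart_image Uq; have [_ [_ e] _] := sf zp.
have := perp_cplx (psi_perp j zp) e; rewrite DzbarE zq lipBr lip_orthonormal.
  by move=> /eqP; rewrite subr_eq0 lipC => /eqP.
by move=> l; exact: pp.
Qed.

Let b_psi q j l : U q -> ip (D (ps j) q) (ps l q) = b (cinv z q) j l.
Proof.
move=> Uq; have [zq zp] := chart_image Uq; have [_ _ /(_ j)[_ e]] := sf zp.
have := perp_cplx (psi_perp l zp) e; rewrite DzE zq lipBr lip_orthonormal.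
  by move=> /eqP; rewrite subr_eq0 lipC => /eqP.
by move=> l'; exact: pp.
Qed.

Let Fc q := frame_mx (yc q) (nc q) (D yc q) (E yc q) (fun j => ps j q).

Let Fc_diff q : U q -> mdiff Fc q.
Proof.
by move=> Uq; apply: (frame_diff oU y_smooth y_real psi_diff yy yzyz yzyb ny nyz nyb nnn
  n_span py pp psi_real yzzE kappaE).
Qed.

Let Fc_equation q : U q ->
  (Fc q)^T *m I1 R[i] (3 + n) *m D Fc q =
  I1 R[i] (3 + n) *m mxA (s (cinv z q)) (k (cinv z q)) (beta (cinv z q)) (b (cinv z q)).
Proof.
move=> Uq; rewrite (frame_equation oU y_smooth y_real psi_diff yy yzyz yzyb ny nyz nyb nnn
  n_span py pyz pyb pn pp psi_real yzzE kappaE beta_kappa Uq).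
congr (_ *m mxA _ _ _ _); apply/funext => j; apply/funext => l; exact: b_psi.
Qed.

Let G p := adapted_frame z Y N psi p.

Let cplx_G q : U q -> cplx (G (cinv z q)) = Fc q.
Proof.
move=> Uq; have [zq zp] := chart_image Uq.
have := cplx_sum_conj (D yc q); have := cplx_diff_conj (D yc q).
rewrite conj_yz // => e4 e3.
rewrite /G /adapted_frame DzYE DzbarYE zq; apply/matrixP => i j.
rewrite frame_mx_entry mxE mxE; case: (fintype.split j : 'I_4 + 'I_n) => [a|l]; last first.
  by rewrite !mxE.
rewrite cols4E; case: a => [[|[|[|[|//]]]] la] /=.
- by rewrite !mxE rmorphM fmorphV rmorphD.
- by rewrite !mxE rmorphM fmorphV rmorphD rmorphN.
- by move/matrixP/(_ i 0): e3; rewrite [X in X = _]mxE.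
- by move/matrixP/(_ i 0): e4; rewrite [X in X = _]mxE.
Qed.

Let Fc_orthonormal q : U q ->
  (Fc q)^T *m I1 R[i] (3 + n) *m Fc q = I1 R[i] (3 + n).
Proof.
move=> Uq; apply: frame_orthonormal; rewrite ?nnn ?ny ?nyz ?nyb ?yzyz ?yzyb ?yy //.
- exact: (@lip_y_yz R n _ oU _ y_smooth yy _ Uq).
- exact: (@lip_y_yb R n _ oU _ y_smooth y_real yy _ Uq).
- exact: (@lip_yb_yb R n _ _ y_smooth y_real yzyz _ Uq).
- by move=> j; exact: py.
- by move=> j; exact: pn.
- by move=> j; exact: pyz.
- by move=> j; exact: pyb.
- by move=> i j; exact: pp.
Qed.

Let cdom_image p : cdom z p -> U (z p). Proof. by exists p. Qed.

Let cplx_Gz p : cdom z p -> cplx (G p) = Fc (z p).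
Proof. by move=> zp; rewrite -{1}(cmapK zp) (cplx_G (cdom_image zp)). Qed.

Let G_isometry p : cdom z p -> isometries (G p).
Proof.
move=> zp; apply/isometriesP; apply: cplx_inj; rewrite !cplxM cplx_tr cplx_I1.
by rewrite (cplx_Gz zp); exact: Fc_orthonormal (cdom_image zp).
Qed.

Let G_derivative p v : cdom z p ->
  cplx (dreal z v G p) = (v.1 +i* v.2) *: D Fc (z p) +
    conjc (v.1 +i* v.2) *: Defs.conjmx (D Fc (z p)).
Proof.
move=> zp; have e : \forall q \near z p, Fc q = cplx (G (cinv z q)).
  by apply: near_chart_eq => // q Uq; rewrite (cplx_G Uq).
rewrite (mdir_near_eq (dz_dir R) e); apply: derive_real_mx.
exact: mdiff_near_eq e (Fc_diff (cdom_image zp)).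
Qed.

Lemma adapted_frame_mc_form : mc_form z G s k beta b.
Proof.
move=> p zp; have Uq := cdom_image zp; split=> [j l|v dz dzbar A].
  rewrite -[p](cmapK zp) -!(b_psi _ _ Uq).
  exact: (lip_pz_p_skew oU psi_diff pp j l Uq).
have GI := G_isometry zp.
have FA : cplx (invmx (G p)) *m D Fc (z p) = A.
  rewrite invmx_isometry // !cplxM cplx_tr cplx_I1 (cplx_Gz zp) -!mulmxA.
  rewrite (mulmxA _ (I1 _ _) (D _ _)) Fc_equation // cmapK // mulmxA.
  by rewrite I1_sqr mul1mx.
rewrite /maurer_cartan cplxM G_derivative // mulmxDr -!scalemxAr FA.
congr (_ *: _ + _ *: _).
rewrite -FA /Defs.conjmx map_mxM /=; congr (_ *m _).
by rewrite -[RHS]/(Defs.conjmx _) conjmx_cplx.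
Qed.

Let Y_diff p : cdom z p -> differentiable (fun q => Y (cinv z q)) (z p).
Proof.
move=> zp; case: cl => [[_ Ys _] _].
exact: Ck_differentiable (smooth_on_chart 1 zc (fun _ h => h) Ys) (cdom_image zp).
Qed.

(** The frame differs from the basis [Y, N, Y_u, Y_v, psi_j] by a matrix of
    determinant one, which transfers the orientation hypothesis to it. *)
Lemma adapted_frameE p : cdom z p ->
  G p = row_mx (Vbasis z Y N p) (psi p) *m block_mx (null_to_orthonormal R) 0 0 1%:M.
Proof.
move=> zp; rewrite /G /adapted_frame Remx_DzD ?Remx_DzB; try exact: Y_diff.
transitivity (row_mx (Vbasis z Y N p *m null_to_orthonormal R) (psi p)).
  by rewrite cols4_null_to_orthonormal.
by rewrite mul_row_block !mulmx0 mulmx1 add0r addr0.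
Qed.

Lemma adapted_frame_SOplus p : cdom z p -> @SOplus R (3 + n) (G p).
Proof.
move=> zp; have Uq := cdom_image zp; apply: SOplus_criterion; first exact: G_isometry.
  rewrite adapted_frameE // det_mulmx (@det_ublock _ 4 n) det_null_to_orthonormal det1 !mulr1.
  by case: nf => _ /(_ _ zp)[].
have [[_ _ /(_ _ zp)[[Y0 Ypos] _]] _] := cl; have [_ _ _ N0 NY] := ld zp.
have Npos : 0 < N p 0 0.
  by apply: (lightcone_same_sign Y0 N0 _ Ypos); rewrite lipC NY ltrN10.
rewrite adapted_frameE //.
have -> : row_mx (Vbasis z Y N p) (psi p) *m block_mx (null_to_orthonormal R) 0 0 1%:M =
    row_mx (Vbasis z Y N p *m null_to_orthonormal R) (psi p).
  by rewrite mul_row_block !mulmx0 mulmx1 add0r addr0.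
rewrite cols4_null_to_orthonormal.
have -> (T : Type) (A : 'M[T]_(4 + n, 4)) (B : 'M[T]_(4 + n, n)) : row_mx A B 0 0 = A 0 0.
  by have := row_mxEl A B 0 0; congr (_ = _); congr (row_mx A B 0 _); exact: val_inj.
rewrite cols4E !mxE mulr_gt0 ?addr_gt0 // invr_gt0 sqrtr_gt0.
Qed.

End FromImmersionToFrame.

Lemma mxB2E (R : realType) n (k beta : 'I_n -> R[i]) :
  mxB2 k beta = - ((mxB1 k beta)^T *m I1 R[i] 3).
Proof.
apply/matrixP => i j; rewrite /I1 mul_mx_diag !mxE -val_eqE.
by case: j => [[|[|[|[|//]]]] lj] /=; ring.
Qed.

Theorem immersion_frame (R : realType) (n : nat)
    (M : riemann_surface R) (y : M -> set 'cV[R]_(4 + n))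
    (z : chart R M) (Y N : M -> 'cV[R]_(4 + n))
    (psi : M -> 'M[R]_(4 + n, n))
    (s : M -> R[i]) (kappa : M -> 'cV[R[i]]_(4 + n))
    (k beta : M -> 'I_n -> R[i]) (b : M -> 'I_n -> 'I_n -> R[i]) :
  conformal_immersion y -> coordinate z ->
  canonical_lift y z Y -> lift_dual z Y N ->
  oriented_normal_frame z Y N psi ->
  schwarzian_hopf z Y s kappa ->
  structure_functions z Y psi kappa k beta b ->
  [/\ forall p, cdom z p ->
        @SOplus R (3 + n) (adapted_frame z Y N psi p),
      mc_form z (adapted_frame z Y N psi) s k beta b &
      forall p, cdom z p ->
        mxB2 (k p) (beta p) = - ((mxB1 (k p) (beta p))^T *m I1 R[i] 3)].
Proof.
move=> cy zc cl ld nf sh sf; split; last by move=> p _; exact: mxB2E.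
  by move=> p; apply: adapted_frame_SOplus; eassumption.
by apply: adapted_frame_mc_form; eassumption.
Qed.

(** * Changes of coordinate *)

Section RealProductRule.
Variables (R : realType) (m : nat).
Local Notation plane := (R * R)%type.
Implicit Types (f g : plane -> 'cV[R]_m.+1).

Lemma mdiff_cplx a b (f : plane -> 'M[R]_(a, b)) q :
  differentiable f q -> mdiff (fun x => cplx (f x)) q.
Proof.
move=> df i j; have dij := differentiable_entry i j df; split.
  by rewrite (_ : (fun _ => _) = fun x => f x i j) //; apply/funext => x; rewrite mxE.
rewrite (_ : (fun _ => _) = cst 0); first exact: differentiable_cst.
by apply/funext => x; rewrite mxE.
Qed.

Lemma mdir_cplx a b (f : plane -> 'M[R]_(a, b)) v q : differentiable f q ->
  mdir (v.1%:C, v.2%:C) (fun x => cplx (f x)) q = cplx ('D_v f q).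
Proof.
move=> df; apply/matrixP => i j; rewrite !mxE (derive_entry _ _ _ df).
rewrite -cderive_cdir; last exact: mdiff_cplx.
apply: complex_ext => /=.
  by congr ('D_v _ _); apply/funext => x; rewrite mxE.
rewrite (_ : (fun _ => _) = cst 0) ?derive_cst //.
by apply/funext => x; rewrite mxE.
Qed.

Lemma lip_derive_cst f g v q (c : R) : differentiable f q -> differentiable g q ->
  (\near q, lip (f q) (g q) = c) ->
  lip ('D_v f q) (g q) = - lip (f q) ('D_v g q).
Proof.
move=> df dg fg; apply: complexI; rewrite [RHS]rmorphN /= -!lip_cplx -!mdir_cplx //.
apply: (lip_mdir_cst _ (mdiff_cplx df) (mdiff_cplx dg) (c := c%:C)).
by apply: filterS fg => x e; rewrite lip_cplx e.
Qed.

End RealProductRule.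

Section Transition.
Local Opaque derive.
Variables (R : realType) (M : riemann_surface R).
Implicit Types (z : chart R M) (p : M).

Lemma near_cinv z (A : set M) p : cdom z p -> open A -> A p ->
  \forall q \near z p, A (cinv z q).
Proof.
move=> zp oA Ap; have zc : {for z p, continuous (cinv z)} by apply: cinv_continuous; exists p.
apply: zc; rewrite cmapK //; exact: open_nbhs_nbhs.
Qed.

Lemma derive_comp (V W X : normedModType R) (g : V -> W) (h : W -> X) q v :
  differentiable g q -> differentiable h (g q) ->
  'D_v (h \o g) q = 'D_('D_v g q) h (g q).
Proof.
move=> dg dh; rewrite (deriveE v (differentiable_comp dg dh)) (deriveE v dg) (deriveE _ dh).
by rewrite (diff_comp dg dh).
Qed.

Lemma holomorphic_comp (h g : R * R -> R * R) q :
  holomorphic_at g q -> holomorphic_at h (g q) -> holomorphic_at (h \o g) q.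
Proof.
move=> [dg hg] [dh hh]; split; first exact: differentiable_comp.
have E v := etrans (derive_comp v dg dh) (@derive_plane R _ h ('D_v g q) (g q) dh).
have E0 := E (0, 1); have {E}E1 := E (1, 0).
move: E0 E1 hg hh.
move: ('D_(0, 1) (h \o g) q) ('D_(1, 0) (h \o g) q) ('D_(0, 1) g q) ('D_(1, 0) g q)
  ('D_(0, 1) h (g q)) ('D_(1, 0) h (g q)) => x1 x2 x3 [a b] x4 [c d] -> -> -> -> /=.
rewrite -[LHS]/(- b * c + a * - d, - b * d + a * c).
rewrite -[RHS]/(- (a * d + b * c), a * c + b * - d).
by congr (_, _); ring.
Qed.

Lemma near_eq_holomorphic (g h : R * R -> R * R) q : (\near q, g q = h q) ->
  holomorphic_at g q -> holomorphic_at h q.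
Proof.
move=> gh [dg hg]; split; first exact: near_eq_differentiable gh dg.
by rewrite -!(near_eq_derive _ gh).
Qed.

(** Any two coordinates, not necessarily in the atlas, are compatible: they are
    compared through a chart of the atlas around the given point. *)
Lemma transition_holomorphic z z' p : coordinate z -> coordinate z' ->
  cdom z p -> cdom z' p -> holomorphic_at (z \o cinv z') (z' p).
Proof.
move=> zc zc' zp zp'; have [c ca cp] := rs_cover p.
have [_ h1] := zc' c ca p cp zp'; have [h2 _] := zc c ca p cp zp.
have h3 : holomorphic_at ((z \o cinv c) \o (c \o cinv z')) (z' p).
  apply: (holomorphic_comp h1).
  have -> : (c \o cinv z') (z' p) = c p by rewrite /= (cmapK zp').
  exact: h2.
apply: near_eq_holomorphic h3; have := near_cinv zp' (cdom_open c) cp.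
by apply: filterS => q cq /=; rewrite cmapK.
Qed.

Lemma dreal_transition (W : normedModType R) (g : M -> W) z z' p v :
  coordinate z -> coordinate z' -> cdom z p -> cdom z' p ->
  differentiable (fun q => g (cinv z q)) (z p) ->
  dreal z' v g p = dreal z ('D_v (z \o cinv z') (z' p)) g p.
Proof.
move=> zc zc' zp zp' dg; have [dt _] := transition_holomorphic zc zc' zp zp'.
have e : \forall q \near z' p, ((fun q => g (cinv z q)) \o (z \o cinv z')) q = (g \o cinv z') q.
  by have := near_cinv zp' (cdom_open z) zp; apply: filterS => q zq /=; rewrite cmapK.
rewrite /dreal -(near_eq_derive _ e) (derive_comp _ dt) /= cmapK //.
Qed.

(** The derivative [a + i b] of a change of coordinate is nonzero because composing
    with the inverse change gives the identity. *)
Lemma transition_derivative z z' p : coordinate z -> coordinate z' ->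
  cdom z p -> cdom z' p ->
  exists a b, [/\ 'D_(1, 0) (z \o cinv z') (z' p) = (a, b),
    'D_(0, 1) (z \o cinv z') (z' p) = (- b, a) & a ^+ 2 + b ^+ 2 != 0].
Proof.
move=> zc zc' zp zp'; have [dt ht] := transition_holomorphic zc zc' zp zp'.
have [dt' _] := transition_holomorphic zc' zc zp' zp.
move: ht; case wE: ('D_((1, 0) : R * R) (z \o cinv z') (z' p)) => [a b] ht.
exists a, b; split=> //; apply/eqP => /eqP.
rewrite paddr_eq0 ?sqr_ge0 // !sqrf_eq0 => /andP[/eqP a0 /eqP b0].
have {a0 b0} wE : 'D_((1, 0) : R * R) (z \o cinv z') (z' p) = 0 by rewrite wE a0 b0.
have e : \forall q \near z' p, ((z' \o cinv z) \o (z \o cinv z')) q = q.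
  have := near_cinv zp' (cdom_open z) zp; have := near_chart zp'; apply: filterS2 => q Uq zq /=.
  by rewrite cmapK // (chart_image Uq).1.
have dt'' : differentiable (z' \o cinv z) ((z \o cinv z') (z' p)).
  by rewrite (_ : _ (z' p) = z p) //= cmapK.
have := near_eq_derive ((1, 0) : R * R) e.
rewrite derive_id (derive_comp _ dt dt'') wE derive0.
by move=> /(congr1 fst)/= /esym/eqP; rewrite oner_eq0.
Qed.

End Transition.

(** * Oriented spans and Lorentz frames *)

Lemma ospan_mulmx (R : realType) m (B : 'M[R]_(m, 4)) (C : 'M[R]_4) :
  0 < \det C -> ospan (B *m C) = ospan B.
Proof.
move=> C0; have Cu : C \in unitmx by rewrite unitmxE unitfE gt_eqF.
apply/seteqP; split=> _ [A /= A0 <-].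
  by exists (C *m A); rewrite /= ?det_mulmx ?mulr_gt0 ?mulmxA.
exists (invmx C *m A); rewrite /= ?det_mulmx ?det_inv ?mulr_gt0 ?invr_gt0 //.
by rewrite mulmxA -(mulmxA B) mulmxV // mulmx1.
Qed.

Lemma pclassZ (R : realType) m (t : R) (x : 'cV[R]_m) : t != 0 ->
  pclass (t *: x) = pclass x.
Proof.
move=> t0; apply/seteqP; split=> _ [r /= r0 <-].
  by exists (r * t); rewrite /= ?mulf_neq0 // scalerA.
by exists (r / t); rewrite /= ?mulf_neq0 ?invr_eq0 // scalerA divfK.
Qed.

Section LorentzFrames.
Variables (R : realType) (m : nat).
Implicit Types (A : 'M[R]_m.+2) (u : 'cV[R]_m.+2).

Lemma lip_col A i j : isometries A ->
  lip (col i A) (col j A) = (if i == 0 then -1 else 1) * (i == j)%:R.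
Proof.
by move=> AI; rewrite !colE AI lip_delta_l mxE eqxx andbT.
Qed.

Lemma lip_col_eq0 A u : isometries A -> (forall i, lip (col i A) u = 0) -> u = 0.
Proof.
move=> AI Au; have Au0 : A^T *m I1 R m.+1 *m u = 0.
  by apply/matrixP => i j; rewrite lip_gram mxE (ord1 j) col_id Au.
have : invmx A *m u = 0 by rewrite invmx_isometry // -!mulmxA (mulmxA A^T) Au0 mulmx0.
move/(congr1 (mulmx A)); rewrite mulmx0 mulmxA mulmxV ?mul1mx //.
exact: isometry_unit.
Qed.

(** The vector [A e_0 - A e_1] is null and nonzero, so its time component cannot
    change sign along the identity component. *)
Lemma SOplus_null_lightcone A : SOplus A -> lightcone (col 0 A - col 1 A).
Proof.
move=> SA; have AI := SOplus_isometry SA.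
have null (B : 'M[R]_m.+2) : isometries B -> lip (col 0 B - col 1 B) (col 0 B - col 1 B) = 0.
  by move=> BI; rewrite !(lipBl, lipBr) !lip_col //=; ring.
split; first exact: null.
rewrite !mxE.
apply: (@connected_gt0 _ _ _ (fun B : 'M[R]_m.+2 => B 0 0 - B 0 1) 1%:M A _ _ _ _ _ SA).
- exact: component_connected.
- by move=> B; apply: continuousB; exact: coord_continuous.
- move=> B /SOplus_isometry BI; apply/eqP => B0.
  have e : col 0 B - col 1 B = 0 by apply: lip_self_le0; rewrite ?null // !mxE.
  have := lip0l (col 0 B); rewrite -e lipBl !lip_col //= => /eqP.
  by rewrite mulr0 subr0 mulr1 oppr_eq0 oner_eq0.
- exact: SOplus1.
- by rewrite !mxE subr0 ltr01.
Qed.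

End LorentzFrames.

Section FrameDecomposition.
Variables (R : realType) (n : nat).
Local Notation ip := (@lip _ (3 + n)).
Variable A : 'M[R]_(4 + n).
Hypothesis AI : @isometries R (3 + n) A.

Let e (a : 'I_4) := col (lshift n a) A.
Let ps (j : 'I_n) := col (rshift 4 j) A.

Lemma ip_phi a c : ip (e a) (e c) = (if a == 0 then -1 else 1) * (a == c)%:R.
Proof. by rewrite lip_col // -!val_eqE. Qed.

Lemma ip_phi_psi a j : ip (e a) (ps j) = 0.
Proof.
have ne : (lshift n a == rshift 4 j) = false.
  by apply/negbTE; rewrite -val_eqE /=; have := ltn_ord a; lia.
by rewrite lip_col // ne mulr0.
Qed.

Lemma frame_decomposition u : (forall j, ip (ps j) u = 0) ->
  u = - ip (e 0) u *: e 0 + ip (e 1) u *: e 1 + ip (e 2) u *: e 2 + ip (e 3) u *: e 3.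
Proof.
move=> pu; apply/eqP; rewrite -subr_eq0; apply/eqP; apply: (lip_col_eq0 AI) => i.
have <- := @splitK 4 n i; case: (@fintype.split 4 n i) => [a|j] /=; last first.
  rewrite -/(ps j) !(lipBr, lipDr, lipZr) pu !(lipC (ps j)) !ip_phi_psi.
  by rewrite !mulr0 !addr0 subr0.
rewrite -/(e a) !(lipBr, lipDr, lipZr) !ip_phi -!val_eqE.
have [-> | [-> | [-> | ->]]] : a = 0 \/ a = 1 \/ a = 2 \/ a = 3.
  case: a => [[|[|[|[|//]]]] la]; [left | right; left | do 2 right; left | do 3 right];
    exact: val_inj.
all: rewrite /=; ring.
Qed.

End FrameDecomposition.

Lemma det_mx2 (T : comNzRingType) (A : 'M[T]_2) :
  \det A = A 0 0 * A 1 1 - A 0 1 * A 1 0.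
Proof.
rewrite (expand_det_row _ 0) !big_ord_recl big_ord0 addr0 /cofactor !det_mx11 !mxE.
rewrite /= expr0 expr1 mul1r mulN1r mulrN.
by congr (_ * A _ _ - A _ _ * A _ _); apply/val_inj.
Qed.

Lemma cols4_row (T : Type) m (a b c d : 'cV[T]_m) :
  cols4 a b c d = row_mx a (row_mx b (row_mx c d)) :> 'M[T]_(m, 1 + (1 + 2)).
Proof.
apply/matrixP => i j; rewrite cols4E !mxE.
by case: splitP => l -> /=; rewrite ?(ord1 l) // !mxE; case: splitP => l' -> /=;
  rewrite ?(ord1 l') // !mxE; case: splitP => l'' -> /=; rewrite (ord1 l'').
Qed.

(** The matrix of the second basis in the first one is block triangular with
    diagonal blocks [r], [r^-1] and a similitude of the plane. *)
Lemma ospan_lightlike_basis (R : realType) m (Y N P Q : 'cV[R]_m)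
    (r al ga de a b c d : R) : 0 < r -> a ^+ 2 + b ^+ 2 != 0 ->
  ospan (cols4 (r *: Y) (al *: Y + r^-1 *: N + ga *: P + de *: Q)
    (c *: Y + (a *: P + b *: Q)) (d *: Y + (- b *: P + a *: Q))) =
  ospan (cols4 Y N P Q).
Proof.
move=> r0 ab.
pose S : 'M[R]_(1 + 1) := block_mx a%:M (- b)%:M b%:M a%:M.
pose C2 : 'M[R]_(1 + 2) := block_mx (r^-1)%:M 0 (col_mx ga%:M de%:M : 'cV_(1 + 1)) S.
pose C : 'M[R]_(1 + (1 + 2)) :=
  block_mx r%:M (row_mx al%:M (row_mx c%:M d%:M : 'rV_(1 + 1))) 0 C2.
have detC : 0 < \det C.
  have detS : \det S = a ^+ 2 + b ^+ 2.
    have e0 : 0 = lshift 1 (ord0 : 'I_1) :> 'I_2 by exact: val_inj.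
    have e1 : 1 = rshift 1 (ord0 : 'I_1) :> 'I_2 by exact: val_inj.
    have [S00 S01] : S 0 0 = a /\ S 0 1 = - b.
      by rewrite e0 e1 /S block_mxEul block_mxEur !mxE.
    have [S10 S11] : S 1 0 = b /\ S 1 1 = a.
      by rewrite e0 e1 /S block_mxEdl block_mxEdr !mxE.
    by rewrite det_mx2 S00 S01 S10 S11; ring.
  rewrite det_ublock [X in _ * X]det_lblock !det_scalar1 mulrA mulfV ?gt_eqF // mul1r.
  by rewrite [X in 0 < X]detS lt_neqAle eq_sym ab addr_ge0 ?sqr_ge0.
rewrite -[RHS](ospan_mulmx (cols4 Y N P Q) detC); congr ospan.
pose PQ : 'M[R]_(m, 1 + 1) := row_mx P Q.
transitivity (row_mx Y (row_mx N PQ) *m C); last by rewrite cols4_row.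
rewrite cols4_row mul_row_block mulmx0 addr0 mul_mx_row mul_row_block mul_row_col !mulmx0 add0r.
have -> : Y *m row_mx c%:M d%:M = row_mx (c *: Y) (d *: Y).
  by have := mul_mx_row Y (c%:M : 'M[R]_1) (d%:M : 'M[R]_1); rewrite !mul_mx_scalar.
have -> : PQ *m S = row_mx (a *: P + b *: Q) (- b *: P + a *: Q).
  by rewrite mul_row_block !mul_mx_scalar.
rewrite !mul_mx_scalar add_row_mx !addrA.
have -> : row_mx (c *: Y) (d *: Y) + row_mx (a *: P + b *: Q) (- b *: P + a *: Q) =
    row_mx (c *: Y + a *: P + b *: Q) (d *: Y - b *: P + a *: Q).
  by rewrite add_row_mx !addrA scaleNr.
by rewrite scaleNr.
Qed.

(** * Conformality and the Laplacian in real terms *)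

Section WirtingerGram.
Variables (R : realType) (m : nat).
Implicit Types P Q : 'cV[R]_m.+1.

Lemma lip_wirtinger P Q : lip P P = lip Q Q -> lip P Q = 0 ->
  lip (2^-1 *: (cplx P - 'i *: cplx Q)) (2^-1 *: (cplx P - 'i *: cplx Q)) = 0 /\
  lip (2^-1 *: (cplx P - 'i *: cplx Q)) (2^-1 *: (cplx P + 'i *: cplx Q)) =
    (lip P P / 2)%:C.
Proof.
move=> PP PQ; have ii : 'i * 'i = -1 :> R[i] by rewrite -expr2 sqrCi.
have QP : lip (cplx Q) (cplx P) = 0 by rewrite lipC lip_cplx PQ.
rewrite !(lipBl, lipBr, lipDr, lipZl, lipZr) QP !lip_cplx PQ -PP.
rewrite !mulr0 sub0r add0r subr0 addr0 rmorphM fmorphV rmorph_nat /=.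
move: (_%:C) => x; have ix : 'i * (2^-1 * ('i * x)) = - (2^-1 * x).
  by rewrite mulrCA (mulrA 'i) ii mulN1r mulrN.
by rewrite !mulrN ix opprK subrr mulr0; split=> //; field.
Qed.

End WirtingerGram.

Lemma Remx_wirtinger (R : realType) m p (A B : 'M[R]_(m, p)) :
  Remx (2^-1 *: (cplx A - 'i *: cplx B)) = 2^-1 *: A.
Proof.
apply/matrixP => i j; rewrite !mxE; move: (A i j) (B i j) => a b.
have h2 : 2^-1 = (2^-1 : R)%:C by rewrite fmorphV rmorph_nat.
rewrite h2 -complexiE !(ReM, ReD, ImM, ImD, =^~rmorphN) /=.
by field.
Qed.

Lemma Immx_wirtinger (R : realType) m p (A B : 'M[R]_(m, p)) :
  Immx (2^-1 *: (cplx A - 'i *: cplx B)) = (- 2^-1) *: B.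
Proof.
apply/matrixP => i j; rewrite !mxE; move: (A i j) (B i j) => a b.
have h2 : 2^-1 = (2^-1 : R)%:C by rewrite fmorphV rmorph_nat.
rewrite h2 -complexiE !(ReM, ReD, ImM, ImD, =^~rmorphN) /=.
by field.
Qed.

Lemma Remx_wirtinger2 (R : realType) m p (A B C D : 'M[R]_(m, p)) :
  Remx (2^-1 *: (2^-1 *: (cplx A + 'i *: cplx B) -
    'i *: (2^-1 *: (cplx C + 'i *: cplx D)))) = 4^-1 *: (A + D).
Proof.
apply/matrixP => i j; rewrite !mxE.
move: (A i j) (B i j) (C i j) (D i j) => a b c d.
have h2 : 2^-1 = (2^-1 : R)%:C by rewrite fmorphV rmorph_nat.
rewrite h2 -complexiE !(ReM, ReD, ImM, ImD, =^~rmorphN) /=.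
by field.
Qed.

Section Laplacian.
Local Opaque mdir derive.
Variables (R : realType) (M : riemann_surface R) (z : chart R M) (m p : nat).

(** [4 Y_zzbar] is the Laplacian of [Y]. *)
Lemma Remx_DzbarDz (Y : M -> 'M[R]_(m, p)) x : cdom z x ->
  Ck 2 (z @` cdom z) (fun q => Y (cinv z q)) ->
  Remx (Dzbar z (Dz z (cplx \o Y)) x) = 4^-1 *: (du z (du z Y) x + dv z (dv z Y) x).
Proof.
move=> zx Y2; have oU := @cimg_open _ _ z; have Ux : (z @` cdom z) (z x) by exists x.
have dY q : (z @` cdom z) q -> differentiable (fun q => Y (cinv z q)) q.
  exact: Ck_differentiable Y2.
have dE v : \forall q \near z x, 'D_v (fun q => Y (cinv z q)) q = dreal z v Y (cinv z q).
  by apply: (near_chart_eq zx) => q Uq; rewrite /dreal (chart_image Uq).1.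
have ddY v : differentiable (fun q => dreal z v Y (cinv z q)) (z x).
  apply: near_eq_differentiable (dE v) _.
  exact: Ck_differentiable (Ck_derive v Y2) Ux.
have DzYE : \forall q \near z x,
    2^-1 *: (cplx (dreal z (1, 0) Y (cinv z q)) - 'i *: cplx (dreal z (0, 1) Y (cinv z q))) =
    Dz z (cplx \o Y) (cinv z q).
  apply: (near_chart_eq zx) => q Uq.
  have dq : differentiable (fun q => Y (cinv z q)) (z (cinv z q)).
    by rewrite (chart_image Uq).1; exact: dY.
  exact: esym (Dz_cplx dq).
rewrite DzbarE -(mdir_near_eq _ DzYE).
have dc v : mdiff (fun q => cplx (dreal z v Y (cinv z q))) (z x).
  by apply: mdiff_cplx; exact: ddY.
rewrite mdirZc; last by apply: mdiffB; [exact: dc | apply: mdiffZc; exact: dc].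
rewrite mdirB; [|exact: dc | by apply: mdiffZc; exact: dc].
rewrite mdirZc; last exact: dc.
have mE v : mdir (dzbar_dir R) (fun q => cplx (dreal z v Y (cinv z q))) (z x) =
    2^-1 *: (cplx (du z (dreal z v Y) x) + 'i *: cplx (dv z (dreal z v Y) x)).
  rewrite -(DzbarE z (cplx \o dreal z v Y)); exact: Dzbar_cplx.
apply: etrans (Remx_wirtinger2 _ _ _ _).
by congr (Remx (_ *: (_ - _ *: _))); [exact: (mE (1, 0)) | exact: (mE (0, 1))].
Qed.

End Laplacian.

(** * From a frame to an immersion *)

Section Coefficients.
Variables (R : realType) (n : nat) (s : R[i]) (k : 'I_n -> R[i]).
Local Notation K := (complex.Re (knorm k ^+ 2)).
Local Notation r := ((Num.sqrt 2)^-1 : R).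

(** The first two combinations are the entries of [d (phi_1 - phi_2)], the last two
    those of the Laplacian of [phi_1 - phi_2]. *)
Lemma coefficient_relations :
  [/\ s1 s k + s3 s k = r%:C, s2 s k + s4 s k = - ('i * r%:C),
      s1 s k + 'i * s2 s k = ((1 - 2 * K) * r)%:C &
      s3 s k + 'i * s4 s k = ((1 + 2 * K) * r)%:C].
Proof.
have r0 := sqrt2_neq0 R; have ii : 'i * 'i = -1 :> R[i] by rewrite -expr2 sqrCi.
have -> : ((1 - 2 * K) * r)%:C = (1 - 2 * K%:C) / sqrt2 R.
  by rewrite rmorphM rmorphB rmorphM rmorph1 rmorph_nat fmorphV.
have -> : ((1 + 2 * K) * r)%:C = (1 + 2 * K%:C) / sqrt2 R.
  by rewrite rmorphM rmorphD rmorphM rmorph1 rmorph_nat fmorphV.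
have -> : r%:C = (sqrt2 R)^-1 by rewrite fmorphV.
have -> : K%:C = knorm k ^+ 2 by rewrite /knorm -rmorphXn.
rewrite /s1 /s2 /s3 /s4; split; try by field.
  transitivity ((1 - s - 2 * knorm k ^+ 2) / (2 * sqrt2 R) -
    ('i * 'i) / (2 * sqrt2 R) * (1 + s - 2 * knorm k ^+ 2)); first by field.
  by rewrite ii; field.
transitivity ((1 + s + 2 * knorm k ^+ 2) / (2 * sqrt2 R) -
  ('i * 'i) / (2 * sqrt2 R) * (1 - s + 2 * knorm k ^+ 2)); first by field.
by rewrite ii; field.
Qed.

Lemma sqrt2_inv : Num.sqrt 2 = 2 * r.
Proof.
have r0 : Num.sqrt 2 != 0 :> R by rewrite sqrtr_eq0 -ltNge.
by rewrite -{2}(sqr_sqrtr (ler0n R 2)) expr2 mulfK.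
Qed.

Lemma coefficient_relations_real :
  [/\ complex.Re (s1 s k) = r - complex.Re (s3 s k),
      complex.Im (s1 s k) = - complex.Im (s3 s k),
      complex.Re (s2 s k) = - complex.Re (s4 s k),
      complex.Im (s2 s k) = - r - complex.Im (s4 s k) &
      complex.Re (s1 s k) - complex.Im (s2 s k) = (1 - 2 * K) * r /\
      complex.Re (s3 s k) - complex.Im (s4 s k) = (1 + 2 * K) * r].
Proof.
have [] := coefficient_relations; rewrite -complexiE.
move: (s1 s k) (s2 s k) (s3 s k) (s4 s k) ((1 - 2 * K) * r) ((1 + 2 * K) * r) r.
move=> [a1 c1] [a2 c2] [a3 c3] [a4 c4] r1 r2 r' [<- h2] [h3 e2] [e3 _] [e4 _] /=.
rewrite mul1r mul0r sub0r in e3; rewrite mul1r mul0r sub0r in e4.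
rewrite mul0r mulr0 subr0 oppr0 in h3; rewrite mul0r mul1r add0r in e2.
by rewrite -e2 -e3 -e4 !addrK; split=> //; apply/eqP; rewrite -addr_eq0 ?h2 ?h3.
Qed.

End Coefficients.

Section FrameOfSurface.
Local Opaque lip derive mdir mxA.
Variables (R : realType) (n : nat) (M : riemann_surface R) (z : chart R M).
Variables (F : M -> 'M[R]_(4 + n)) (s : M -> R[i]) (k beta : M -> 'I_n -> R[i])
  (b : M -> 'I_n -> 'I_n -> R[i]).
Hypotheses (zc : coordinate z) (zT : cdom z = setT) (Fs : smooth_on setT F)
  (FSO : forall p, @SOplus R (3 + n) (F p)) (mcF : mc_form z F s k beta b).
Local Notation ip := (@lip _ (3 + n)).
Local Notation vec := 'cV[R]_(4 + n).
Local Notation A p := (mxA (s p) (k p) (beta p) (b p)).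

Let e (a : 'I_4) p : vec := col (lshift n a) (F p).
Let ps (j : 'I_n) p : vec := col (rshift 4 j) (F p).
Let x p : vec := e 0 p - e 1 p.

Let zin p : cdom z p. Proof. by rewrite zT. Qed.

Let FI p : @isometries R (3 + n) (F p). Proof. exact: SOplus_isometry. Qed.

Let F_Ck r w : coordinate w -> Ck r (w @` cdom w) (fun q => F (cinv w q)).
Proof. by move=> wc; apply: smooth_on_chart Fs. Qed.

Let F_diff w p : coordinate w -> cdom w p -> differentiable (fun q => F (cinv w q)) (w p).
Proof. by move=> wc wp; apply: Ck_differentiable (F_Ck 1 wc) _; exists p. Qed.

Let col_Ck r w i : coordinate w -> Ck r (w @` cdom w) (fun q => col i (F (cinv w q))).
Proof.
move=> wc; have -> : (fun q => col i (F (cinv w q))) = fun q => F (cinv w q) *m delta_mx i 0.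
  by apply/funext => q; rewrite colE.
by apply: Ck_mulmxr; [exact: cimg_open | exact: F_Ck].
Qed.

Let col_diff w i p : coordinate w -> cdom w p ->
  differentiable (fun q => col i (F (cinv w q))) (w p).
Proof. by move=> wc wp; apply: Ck_differentiable (col_Ck 1 i wc) _; exists p. Qed.

Let mc_entry p v i j : maurer_cartan z F p v i j =
  2 * (v.1 * complex.Re (A p i j) - v.2 * complex.Im (A p i j)).
Proof.
have [_ /(_ v)/matrixP/(_ i j)] := mcF (zin p).
move=> /(congr1 (@complex.Re R)) /=; move: (A p) => B; rewrite !mxE /= => ->.
by case: (B i j) => a c /=; ring.
Qed.

Let dreal_col v i p : dreal z v (fun q => col i (F q)) p = col i (dreal z v F p).
Proof.
apply/matrixP => r c; rewrite mxE /dreal.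
have dF := F_diff zc (zin p); have dc := col_diff i zc (zin p).
rewrite (derive_entry _ _ _ dF) (derive_entry _ _ _ dc).
have -> : (fun q => col i (F (cinv z q)) r c) = fun q => F (cinv z q) r i.
  by apply/funext => q; rewrite mxE.
by [].
Qed.

(** Follows from [F^T I1 F = I1] and [dF = F alpha].  The products of the [phi_a] and
    [psi_j] with each other's derivatives are its instances. *)
Lemma lip_frame_derivative p v i j :
  ip (col i (F p)) (dreal z v (fun q => col j (F q)) p) =
  (if i == 0 then -1 else 1) *
    (2 * (v.1 * complex.Re (A p i j) - v.2 * complex.Im (A p i j))).
Proof.
rewrite dreal_col -mc_entry -(@I1_mulE _ (3 + n)) -(@lip_gram _ (3 + n)).
congr (fun_of_matrix _ i j).
have /isometriesP E := FI p; rewrite -[in RHS]E.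
have Fu := isometry_unit (FI p).
by rewrite -[RHS]mulmxA /maurer_cartan (mulKVmx Fu).
Qed.

Lemma lip_phi_dphi p v a c : ip (e a p) (dreal z v (e c) p) =
  (if a == 0 then -1 else 1) * (2 * (v.1 * complex.Re (mxA1 (s p) (k p) a c)
    - v.2 * complex.Im (mxA1 (s p) (k p) a c))).
Proof. by rewrite /e lip_frame_derivative mxA_ul -!val_eqE. Qed.

Lemma lip_psi_dphi p v j c : ip (ps j p) (dreal z v (e c) p) =
  2 * (v.1 * complex.Re (mxB2 (k p) (beta p) j c) - v.2 * complex.Im (mxB2 (k p) (beta p) j c)).
Proof. by rewrite /e /ps lip_frame_derivative mxA_dl mul1r. Qed.

Lemma lip_phi_dpsi p v a j : ip (e a p) (dreal z v (ps j) p) =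
  (if a == 0 then -1 else 1) * (2 * (v.1 * complex.Re (mxB1 (k p) (beta p) a j)
    - v.2 * complex.Im (mxB1 (k p) (beta p) a j))).
Proof. by rewrite /e /ps lip_frame_derivative mxA_ur -!val_eqE. Qed.

Let dreal_x p v : dreal z v x p = dreal z v (e 0) p - dreal z v (e 1) p.
Proof.
have d0 := @diff_derivable _ _ _ _ _ v (col_diff (lshift n 0) zc (zin p)).
have d1 := @diff_derivable _ _ _ _ _ v (col_diff (lshift n 1) zc (zin p)).
exact: (deriveB d0 d1).
Qed.

Lemma dreal_null_vector p v :
  dreal z v x p = Num.sqrt 2 *: (v.1 *: e 2 p + v.2 *: e 3 p).
Proof.
rewrite (@frame_decomposition R n (F p) (FI p) (dreal z v x p)).
  rewrite -!/(e _ _) !dreal_x !lipBr !lip_phi_dphi !mxE /=.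
  transitivity (0 *: e 0 p + 0 *: e 1 p + (Num.sqrt 2 * v.1) *: e 2 p +
      (Num.sqrt 2 * v.2) *: e 3 p); last by rewrite !scale0r !add0r scalerDr !scalerA.
  have [h1 h2 h3 h4 _] := coefficient_relations_real (s p) (k p).
  by rewrite sqrt2_inv !raddfN /= h1 h2 h3 h4; congr (_ *: _ + _ *: _ + _ *: _ + _ *: _); ring.
move=> j; rewrite -/(ps j p) dreal_x lipBr !lip_psi_dphi !mxE /=; ring.
Qed.

Lemma lip_null_dnull p v : ip (x p) (dreal z v x p) = 0.
Proof.
by rewrite dreal_null_vector /x /e !(lipBl, lipZr, lipDr) !ip_phi //=; ring.
Qed.

Lemma lip_null_dpsi p v j : ip (x p) (dreal z v (ps j) p) = 0.
Proof. rewrite lipBl !lip_phi_dpsi !mxE /= !raddfN /=; ring. Qed.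

Lemma lip_null_dphi2 p v : ip (x p) (dreal z v (e 2) p) = - (Num.sqrt 2 * v.1).
Proof.
have [h1 h2 h3 h4 _] := coefficient_relations_real (s p) (k p).
by rewrite lipBl !lip_phi_dphi !mxE /= sqrt2_inv ?h1 ?h2 ?h3 ?h4; ring.
Qed.

Lemma lip_null_dphi3 p v : ip (x p) (dreal z v (e 3) p) = - (Num.sqrt 2 * v.2).
Proof.
have [h1 h2 h3 h4 _] := coefficient_relations_real (s p) (k p).
by rewrite lipBl !lip_phi_dphi !mxE /= sqrt2_inv ?h1 ?h2 ?h3 ?h4; ring.
Qed.

Lemma lip_phi2_dpsi p v j : ip (e 2 p) (dreal z v (ps j) p) =
  - (2 * complex.Re ((v.1 +i* v.2) * k p j)).
Proof.
rewrite lip_phi_dpsi !mxE /= raddfN ReM /=. ring.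
Qed.

Lemma lip_phi3_dpsi p v j : ip (e 3 p) (dreal z v (ps j) p) =
  2 * complex.Im ((v.1 +i* v.2) * k p j).
Proof.
rewrite lip_phi_dpsi !mxE /= -complexiE ImM; case: (k p j) => c d /=; ring.
Qed.

Let y p := pclass (x p).

Lemma null_vector_lightcone p : lightcone (x p).
Proof.
have := SOplus_null_lightcone (FSO p).
rewrite /x /e (_ : lshift n 0 = 0); last exact: val_inj.
rewrite (_ : lshift n 1 = 1) //; exact: val_inj.
Qed.

Lemma lift_positive_multiple (B : set M) (Y : M -> vec) p :
  local_lift y B Y -> B p -> exists2 t, 0 < t & Y p = t *: x p.
Proof.
move=> [_ _ lY] /lY[[_ Y0] yE]; have : y p (Y p) by rewrite yE; exists 1; rewrite /= ?oner_eq0 ?scale1r.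
move=> [t _ tx]; exists t => //; have [_ x0] := null_vector_lightcone p.
by move: Y0; rewrite -tx mxE pmulr_lgt0.
Qed.

Section OtherCoordinate.
Variables (w : chart R M) (B : set M) (Y : M -> vec) (p : M).
Hypotheses (wc : coordinate w) (lY : local_lift y B Y) (Bp : B p) (wp : cdom w p).
Variable t : R.
Hypothesis Yt : Y p = t *: x p.
Local Notation dtau v := ('D_v (z \o cinv w) (w p)).

Lemma lift_diff : differentiable (fun q => Y (cinv w q)) (w p).
Proof. by case: lY => _ /(_ w wc 1%N)[Yd _] _; apply: Yd; exists p. Qed.

(** Near [p] the lift is a multiple of [x], hence orthogonal to [g]; so the
    derivative falls on [g], and only the value [t] at [p] of the factor enters. *)
Lemma lip_lift_derivative (g : M -> vec) v :
  differentiable (fun q => g (cinv w q)) (w p) ->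
  differentiable (fun q => g (cinv z q)) (z p) ->
  (forall q, ip (x q) (g q) = 0) ->
  ip (dreal w v Y p) (g p) = - t * ip (x p) (dreal z (dtau v) g p).
Proof.
move=> dg dg' xg; rewrite -(dreal_transition v zc wc (zin p) wp dg').
have [oB _ _] := lY.
have near0 : \forall q \near w p, ip (Y (cinv w q)) (g (cinv w q)) = 0.
  apply: filterS (near_cinv wp oB Bp) => q Bq.
  have [r _ ->] := lift_positive_multiple lY Bq; by rewrite lipZl xg mulr0.
have := lip_derive_cst v lift_diff dg near0; rewrite (cmapK wp) Yt lipZl mulNr.
exact.
Qed.

Let e_diff a : differentiable (fun q => e a (cinv w q)) (w p).
Proof. exact: col_diff. Qed.
Let e_diffz a : differentiable (fun q => e a (cinv z q)) (z p).
Proof. exact: col_diff. Qed.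

Lemma lip_lift_derivative_psi v j : ip (ps j p) (dreal w v Y p) = 0.
Proof.
rewrite lipC lip_lift_derivative ?lip_null_dpsi ?mulr0 //; try exact: col_diff.
by move=> q; rewrite lipBl !ip_phi_psi // subrr.
Qed.

(** The derivative of [t x] along [v] is [t] times the derivative of [x], up to a
    multiple of [x]; reading it off the products with the frame avoids
    differentiating the factor [t]. *)
Lemma lift_derivative v : exists c, dreal w v Y p =
  c *: x p + (t * Num.sqrt 2) *: ((dtau v).1 *: e 2 p + (dtau v).2 *: e 3 p).
Proof.
have D2 : ip (e 2 p) (dreal w v Y p) = t * Num.sqrt 2 * (dtau v).1.
  rewrite lipC lip_lift_derivative ?lip_null_dphi2 ?mulrN ?mulNr ?opprK ?mulrA //.
  by move=> q; rewrite lipBl !ip_phi //= !mulr0 subrr.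
have D3 : ip (e 3 p) (dreal w v Y p) = t * Num.sqrt 2 * (dtau v).2.
  rewrite lipC lip_lift_derivative ?lip_null_dphi3 ?mulrN ?mulNr ?opprK ?mulrA //.
  by move=> q; rewrite lipBl !ip_phi //= !mulr0 subrr.
have D01 : ip (e 0 p) (dreal w v Y p) = ip (e 1 p) (dreal w v Y p).
  have h : ip (dreal w v Y p) (x p) = 0.
    have dx := differentiableB (e_diff 0) (e_diff 1).
    have dxz := differentiableB (e_diffz 0) (e_diffz 1).
    have xx q : ip (x q) (x q) = 0 by have [] := null_vector_lightcone q.
    by rewrite (@lip_lift_derivative x v dx dxz xx) lip_null_dnull mulr0.
  by apply/eqP; rewrite -subr_eq0 -lipBl lipC; apply/eqP.
exists (- ip (e 0 p) (dreal w v Y p)).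
rewrite {1}(@frame_decomposition R n (F p) (FI p) _ (lip_lift_derivative_psi v)).
rewrite -!/(e _ _) D2 D3 -D01; move: (ip _ _) => u.
by rewrite /x scalerBr (scalerDr (t * _)) !scalerA !scaleNr opprK !addrA.
Qed.

End OtherCoordinate.

(** The number [a + i b'] is the derivative of the change of coordinate. *)
Lemma lift_frame (w : chart R M) (B : set M) (Y : M -> vec) p :
  coordinate w -> local_lift y B Y -> B p -> cdom w p ->
  exists t a b' c d, [/\ 0 < t, Y p = t *: x p, a ^+ 2 + b' ^+ 2 != 0,
    'D_(1, 0) (z \o cinv w) (w p) = (a, b') /\ 'D_(0, 1) (z \o cinv w) (w p) = (- b', a) &
    du w Y p = c *: x p + (t * Num.sqrt 2) *: (a *: e 2 p + b' *: e 3 p) /\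
    dv w Y p = d *: x p + (t * Num.sqrt 2) *: (- b' *: e 2 p + a *: e 3 p)].
Proof.
move=> wc lY Bp wp; have [t t0 Yt] := lift_positive_multiple lY Bp.
have [a [b' [D1 D2 ab]]] := transition_derivative zc wc (zin p) wp.
have [c dY1] := lift_derivative wc lY Bp wp Yt (1, 0).
have [d dY2] := lift_derivative wc lY Bp wp Yt (0, 1).
by exists t, a, b', c, d; split=> //; rewrite D1 in dY1; rewrite D2 in dY2.
Qed.

Let x_smooth : smooth_on setT x.
Proof.
move=> w wc r; rewrite setIT.
have -> : x \o cinv w = fun q => F (cinv w q) *m (delta_mx (lshift n 0) 0 - delta_mx (lshift n 1) 0).
  by apply/funext => q; rewrite mulmxBr -!colE.
by apply: Ck_mulmxr; [exact: cimg_open | exact: F_Ck].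
Qed.

Let lip_x_x p : ip (x p) (x p) = 0. Proof. by have [] := null_vector_lightcone p. Qed.
Let lip_x_e p : ip (x p) (e 2 p) = 0 /\ ip (x p) (e 3 p) = 0.
Proof. by rewrite !lipBl !ip_phi //= !mulr0 subrr. Qed.

Lemma lip_lift_basis p l a b' c d :
  let P := c *: x p + l *: (a *: e 2 p + b' *: e 3 p) in
  let Q := d *: x p + l *: (- b' *: e 2 p + a *: e 3 p) in
  [/\ ip P P = l ^+ 2 * (a ^+ 2 + b' ^+ 2), ip Q Q = l ^+ 2 * (a ^+ 2 + b' ^+ 2) & ip P Q = 0].
Proof.
have [x2 x3] := lip_x_e p; have xx := lip_x_x p.
have e22 : ip (e 2 p) (e 2 p) = 1 by rewrite ip_phi //= mulr1.
have e33 : ip (e 3 p) (e 3 p) = 1 by rewrite ip_phi //= mulr1.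
have e23 : ip (e 2 p) (e 3 p) = 0 by rewrite ip_phi //= mulr0.
move: (x p) (e 2 p) (e 3 p) x2 x3 xx e22 e33 e23 => X E G x2 x3 xx e22 e33 e23 P Q.
rewrite /P /Q !(lipDl, lipDr, lipZl, lipZr) (lipC E X) (lipC G X) (lipC G E) x2 x3 xx e22 e33 e23.
by split; ring.
Qed.

Lemma conformal_immersion_null_vector : conformal_immersion y.
Proof.
split=> [p|B Y w lY wc p Bp wp].
  split; first by exists (x p) => //; exact: null_vector_lightcone.
  exists setT, x; split=> //; split; [exact: openT | exact: x_smooth |].
  by move=> q _; split=> //; exact: null_vector_lightcone.
have [t [a [b' [c [d [t0 _ ab _ [du_ dv_]]]]]]] := lift_frame wc lY Bp wp.
have [PP QQ PQ] := lip_lift_basis p (t * Num.sqrt 2) a b' c d.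
have dY := lift_diff wc lY Bp wp.
rewrite -du_ -dv_ in PP QQ PQ.
have [h1 h2] := @lip_wirtinger R (3 + n) _ _ (etrans PP (esym QQ)) PQ.
rewrite (Dz_cplx dY) (Dzbar_cplx dY) h1 h2; split=> //.
rewrite ltcR PP divr_gt0 // mulr_gt0 ?exprn_gt0 ?mulr_gt0 ?sqrtr_gt0 //.
by rewrite lt_neqAle eq_sym ab addr_ge0 ?sqr_ge0.
Qed.

Section GaussMap.

Section GivenLift.
Variables (w : chart R M) (Y N : M -> vec) (p : M).
Hypotheses (wc : coordinate w) (wp : cdom w p) (clY : canonical_lift y w Y)
  (ldN : lift_dual w Y N).

Let lY : local_lift y (cdom w) Y := clY.1.
Let Y_diff q : cdom w q -> differentiable (fun q => Y (cinv w q)) (w q).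
Proof. by move=> wq; apply: lift_diff lY _ _. Qed.

Let dY_diff v : differentiable (fun q => dreal w v Y (cinv w q)) (w p).
Proof.
have [_ Ys _] := lY; have Y2 := smooth_on_chart 2 wc (fun _ h => h) Ys.
apply: near_eq_differentiable (Ck_differentiable (Ck_derive v Y2) _); last by exists p.
by apply: (near_chart_eq wp) => q Uq; rewrite /dreal (chart_image Uq).1.
Qed.

(** The second derivative along [w] contributes a multiple of the real part of
    [w^2 k_j], and the images of [d/du] and [d/dv] differ by the factor [i]. *)
Lemma lip_laplacian_psi j :
  ip (ps j p) (du w (du w Y) p + dv w (dv w Y) p) = 0.
Proof.
have dps : differentiable (fun q => ps j (cinv w q)) (w p) by exact: col_diff.
have dpsz : differentiable (fun q => ps j (cinv z q)) (z p) by exact: col_diff.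
have near0 v : \forall q \near w p, ip (dreal w v Y (cinv w q)) (ps j (cinv w q)) = 0.
  apply: filterS (near_cinv wp (cdom_open w) wp) => q wq.
  have [t _ Yt] := lift_positive_multiple lY wq.
  by rewrite lipC (lip_lift_derivative_psi wc lY wq wq Yt).
have D v := lip_derive_cst v (dY_diff v) dps (near0 v).
have {}D v : ip (dreal w v (dreal w v Y) p) (ps j p) =
    - ip (dreal w v Y p) (dreal w v (ps j) p).
  by have := D v; rewrite (cmapK wp).
have [t [a [b' [c [d [_ _ _ [D1 D2] [du_ dv_]]]]]]] := lift_frame wc lY wp wp.
have E1 := D (1, 0); have E2 := D (0, 1).
rewrite (dreal_transition _ zc wc (zin p) wp dpsz) D1 in E1.
rewrite (dreal_transition _ zc wc (zin p) wp dpsz) D2 in E2.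
have {}E1 := etrans E1 (congr1 (fun h => - ip h _) du_).
have {}E2 := etrans E2 (congr1 (fun h => - ip h _) dv_).
have add0 (A B A' B' : R) : A = A' -> B = B' -> A' + B' = 0 -> A + B = 0 by move=> -> ->.
rewrite lipC lipDl; apply: (add0 _ _ _ _ E1 E2); rewrite {E1 E2}.
have p2 v := lip_phi2_dpsi p v j; have p3 v := lip_phi3_dpsi p v j.
have px v := lip_null_dpsi p v j.
move: (p2 (a, b')) (p3 (a, b')) (px (a, b')) (p2 (- b', a)) (p3 (- b', a)) (px (- b', a)).
move: (dreal z _ _ p) (dreal z _ _ p) (x p) (e 2 p) (e 3 p) => h h' X G H.
move=> h2 h3 hx h2' h3' hx'.
rewrite !(lipDl, lipZl) h2 h3 hx h2' h3' hx'.
by rewrite !(ReM, ImM) /=; ring.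
Qed.

(** All four spanning vectors of [V] are orthogonal to the [psi_j]. *)
Lemma lip_dual_psi j : ip (ps j p) (N p) = 0.
Proof.
have [Ns _ _ _ _] := ldN wp; have [c1 [c2 [c3 [c4 ->]]]] := span4P Ns.
have [t _ Yt] := lift_positive_multiple lY wp.
have dpsi v := lip_lift_derivative_psi wc lY wp wp Yt v j.
have [_ Ys _] := lY; have Y2 := smooth_on_chart 2 wc (fun _ h => h) Ys.
rewrite (Dz_cplx (Y_diff wp)) Remx_wirtinger Immx_wirtinger (Remx_DzbarDz wp Y2).
have pY : ip (ps j p) (Y p) = 0.
  by rewrite Yt lipZr lipC lipBl !ip_phi_psi // subrr mulr0.
have p1 : ip (ps j p) (du w Y p) = 0 := dpsi (1, 0).
have p2 : ip (ps j p) (dv w Y p) = 0 := dpsi (0, 1).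
move: pY p1 p2 (lip_laplacian_psi j).
move: (Y p) (du w Y p) (dv w Y p) (du w _ p + dv w _ p) => A1 A2 A3 A4 h1 h2 h3 h4.
by rewrite !(lipDr, lipZr) h1 h2 h3 h4 !mulr0 !addr0.
Qed.

(** In the decomposition of [N] the coefficient along the dual null vector is forced
    by [ip N Y = -1], which makes the change of basis positive. *)
Lemma ospan_Vbasis : ospan (Vbasis w Y N p) = ospan (lsubmx (F p)).
Proof.
have [t [a [b' [c [d [t0 Yt ab _ [du_ dv_]]]]]]] := lift_frame wc lY wp wp.
have [_ _ _ _ NY] := ldN wp; have NE := @frame_decomposition R n (F p) (FI p) _ lip_dual_psi.
have n01 : t * (ip (e 1 p) (N p) - ip (e 0 p) (N p)) = 1.
  by rewrite -opprB -lipBl mulrN -lipZl -Yt lipC NY opprK.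
have [r rE0] : exists r : R, r = (Num.sqrt 2)^-1 by exists (Num.sqrt 2)^-1.
have [l lE] : exists l, l = t * Num.sqrt 2 by exists (t * Num.sqrt 2).
rewrite -lE in du_ dv_.
have q0 : 0 < Num.sqrt 2 :> R by rewrite sqrtr_gt0.
have r0 : r != 0 by rewrite rE0 invr_eq0 gt_eqF.
have rr : r * (r * 2) = 1 by rewrite (mulrC r 2) rE0 -sqrt2_inv mulVf ?gt_eqF.
have l0 : 0 < l by rewrite lE mulr_gt0.
have lr : l * r = t by rewrite lE rE0 mulfK ?gt_eqF.
have phiE : cols4 (r *: x p) (r *: (e 0 p + e 1 p)) (e 2 p) (e 3 p) *m null_to_orthonormal R =
    lsubmx (F p).
  rewrite cols4_null_to_orthonormal -rE0; apply/matrixP => i j; rewrite cols4E !mxE.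
  have rE u v : r * (r * (u - v) + r * (u + v)) = u by rewrite -[RHS]mul1r -rr; ring.
  have rE' u v : r * (- (r * (u - v)) + r * (u + v)) = v by rewrite -[RHS]mul1r -rr; ring.
  by case: j => [[|[|[|[|//]]]] lj] /=; rewrite !mxE ?rE ?rE'; congr (F p i _); exact: val_inj.
rewrite -phiE ospan_mulmx ?det_null_to_orthonormal ?ltr01 // /Vbasis du_ dv_.
rewrite -(@ospan_lightlike_basis R _ (r *: x p) (r *: (e 0 p + e 1 p)) (e 2 p) (e 3 p) l
  (- r * (ip (e 0 p) (N p) + ip (e 1 p) (N p))) (ip (e 2 p) (N p)) (ip (e 3 p) (N p))
  (l * a) (l * b') (c / r) (d / r)) //; last first.
  have -> : (l * a) ^+ 2 + (l * b') ^+ 2 = l ^+ 2 * (a ^+ 2 + b' ^+ 2) by ring.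
  by apply: mulf_neq0 ab; rewrite sqrf_eq0 gt_eqF.
congr (ospan (cols4 _ _ _ _)).
- by rewrite scalerA lr.
- rewrite {1}NE -!/(e _ _); move: n01.
  move: (ip (e 0 p) _) (ip (e 1 p) _) (ip (e 2 p) _) (ip (e 3 p) _) => n0 n1 n2 n3 n01.
  have li : l^-1 * r = r * (r * (n1 - n0)).
    transitivity (l^-1 * r * (l * r * (n1 - n0))); first by rewrite lr n01 mulr1.
    by field; rewrite gt_eqF.
  rewrite scalerA scalerA li /x; congr (_ + _ + _).
  rewrite scalerBr scalerDr addrACA -scalerDl -scaleNr -scalerDl.
  congr (_ *: _ + _ *: _).
    by transitivity (- (r * (r * 2)) * n0); [rewrite rr mulN1r | ring].
  by transitivity (r * (r * 2) * n1); [rewrite rr mul1r | ring].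
- by rewrite scalerA divfK // (scalerDr l) !(scalerA l).
- by rewrite scalerA divfK // (scalerDr l) !(scalerA l) mulrN.
Qed.

End GivenLift.

Section ExplicitLift.
Local Notation r := ((Num.sqrt 2)^-1 : R).
Let Y p : vec := r *: x p.
Let N p : vec := r *: (e 0 p + e 1 p).

Let q0 : 0 < Num.sqrt 2 :> R. Proof. by rewrite sqrtr_gt0. Qed.
Let r0 : 0 < r. Proof. by rewrite invr_gt0. Qed.

Let x_diff p : differentiable (fun q => x (cinv z q)) (z p).
Proof.
exact: (differentiableB (col_diff (lshift n 0) zc (zin p)) (col_diff (lshift n 1) zc (zin p))).
Qed.

Let Y_Ck i : Ck i (z @` cdom z) (fun q => Y (cinv z q)).
Proof.
apply: Ck_scale; first exact: cimg_open.
by apply: smooth_on_chart x_smooth.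
Qed.

Let Y_diff p : differentiable (fun q => Y (cinv z q)) (z p).
Proof. by apply: Ck_differentiable (Y_Ck 1) _; exists p; rewrite ?zT. Qed.

Let dY v p : dreal z v Y p = v.1 *: e 2 p + v.2 *: e 3 p.
Proof.
have dx := @diff_derivable _ _ _ _ _ v (x_diff p).
have E : dreal z v Y p = r *: dreal z v x p := deriveZ r dx.
by rewrite E dreal_null_vector scalerA mulVf ?scale1r ?gt_eqF.
Qed.

Let duY : du z Y = e 2.
Proof. by apply/funext => p; rewrite /du dY /= scale1r scale0r addr0. Qed.

Let dvY : dv z Y = e 3.
Proof. by apply/funext => p; rewrite /dv dY /= scale1r scale0r add0r. Qed.

Lemma null_vector_canonical_lift : canonical_lift y z Y.
Proof.
split.
  split; first exact: cdom_open.
    rewrite zT => w wc i; have xs := x_smooth wc i; move: xs.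
    rewrite setIT => xs; exact: (@Ck_scale R _ _ _ _ _ r (@cimg_open _ _ w) xs).
  move=> p _; have [x1 x2] := null_vector_lightcone p; split; last first.
    by rewrite /y pclassZ // gt_eqF.
  by split; [rewrite !(lipZl, lipZr) x1 !mulr0 | rewrite mxE mulr_gt0].
move=> p _; rewrite (Dz_cplx (Y_diff p)) (Dzbar_cplx (Y_diff p)) duY dvY.
have e22 : ip (e 2 p) (e 2 p) = 1 by rewrite ip_phi //= mulr1.
have e33 : ip (e 3 p) (e 3 p) = 1 by rewrite ip_phi //= mulr1.
have e23 : ip (e 2 p) (e 3 p) = 0 by rewrite ip_phi //= mulr0.
have [_ ->] := @lip_wirtinger R (3 + n) _ _ (etrans e22 (esym e33)) e23.
by rewrite e22 div1r fmorphV rmorph_nat.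
Qed.

(** In complex terms [N = 2 Y_zzbar + 2 k^2 Y]: it places [N] in the span [V]. *)
Let laplacianY p : du z (du z Y) p + dv z (dv z Y) p =
  2 *: N p - (4 * complex.Re (knorm (k p) ^+ 2)) *: Y p.
Proof.
rewrite duY dvY /du /dv; set h := dreal _ _ _ _ + _.
have hpsi j : ip (ps j p) h = 0.
  by rewrite lipDr !lip_psi_dphi !mxE /= -complexiE ImM /=; ring.
have [_ _ _ _ [h1 h2]] := coefficient_relations_real (s p) (k p).
have h0' : ip (e 0 p) h = - (2 * ((1 - 2 * complex.Re (knorm (k p) ^+ 2)) * r)).
  by rewrite lipDr !lip_phi_dphi !mxE /= -h1; ring.
have h1' : ip (e 1 p) h = 2 * ((1 + 2 * complex.Re (knorm (k p) ^+ 2)) * r).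
  by rewrite lipDr !lip_phi_dphi !mxE /= -h2; ring.
have h2' : ip (e 2 p) h = 0 by rewrite lipDr !lip_phi_dphi !mxE /=; ring.
have h3' : ip (e 3 p) h = 0 by rewrite lipDr !lip_phi_dphi !mxE /=; ring.
rewrite (@frame_decomposition R n (F p) (FI p) h hpsi) -!/(e _ _) h0' h1' h2' h3'.
rewrite /N /Y /x.
move: (complex.Re _) r (e 0 p) (e 1 p) (e 2 p) (e 3 p) => K r' X E G H.
by apply/matrixP => i j; rewrite !mxE; ring.
Qed.

Lemma null_vector_lift_dual : lift_dual z Y N.
Proof.
move=> p _; have Y2 := Y_Ck 2.
have rr : r * (r * 2) = 1 by rewrite (mulrC r 2) -sqrt2_inv mulVf ?gt_eqF.
have N2 : ip (N p) (e 2 p) = 0.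
  by rewrite lipZl lipDl !ip_phi //= !mulr0 addr0 mulr0.
have N3 : ip (N p) (e 3 p) = 0.
  by rewrite lipZl lipDl !ip_phi //= !mulr0 addr0 mulr0.
rewrite (Dz_cplx (Y_diff p)) (Dzbar_cplx (Y_diff p)) duY dvY; split.
- have NE : N p = (2 * complex.Re (knorm (k p) ^+ 2)) *: Y p +
      0 *: Remx (Dz z (cplx \o Y) p) + 0 *: Immx (Dz z (cplx \o Y) p) +
      2 *: Remx (Dzbar z (Dz z (cplx \o Y)) p).
    rewrite (Remx_DzbarDz (zin p) Y2) laplacianY.
    move: (Remx _) (Immx _) (complex.Re _) (N p) (Y p) => A1 A2 K X G.
    by apply/matrixP => i j; rewrite !mxE; field.
  rewrite {1}NE; exact: mem_span4.
- rewrite lipZr lipBr lipZr !(@lip_cplx _ (3 + n)) N2 N3.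
  by rewrite !(mulr0, subr0).
- rewrite lipZr lipDr lipZr !(@lip_cplx _ (3 + n)) N2 N3.
  by rewrite !(mulr0, addr0).
- by rewrite !(lipZl, lipZr, lipDl, lipDr) !ip_phi //=; ring.
- rewrite !(lipZl, lipZr, lipDl, lipBr) !ip_phi //=.
  transitivity (- (r * (r * 2))); first by ring.
  by rewrite rr.
Qed.

End ExplicitLift.

Lemma gauss_map_null_vector p : gauss_map y p = ospan (lsubmx (F p)).
Proof.
apply/seteqP; split=> [E [w [Y [N [wc wp clY ldN]]]]|E Ep].
  by rewrite (ospan_Vbasis wc wp clY ldN).
have cl := null_vector_canonical_lift; have ld := null_vector_lift_dual.
exists z; do 2 eexists; split; [exact: zc | exact: zin | exact: cl | exact: ld |].
by rewrite (ospan_Vbasis zc (zin p) cl ld).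
Qed.

End GaussMap.

End FrameOfSurface.

Theorem frame_immersion (R : realType) (n : nat) (U : riemann_surface R) (z : chart R U)
    (f : U -> set 'M[R]_(4 + n, 4)) (F : U -> 'M[R]_(4 + n))
    (s : U -> R[i]) (k beta : U -> 'I_n -> R[i]) (b : U -> 'I_n -> 'I_n -> R[i]) :
  coordinate z -> cdom z = [set: U] -> frame_on [set: U] f F -> mc_form z F s k beta b ->
  let phi (j : 'I_4) (p : U) : 'cV[R]_(4 + n) := col (lshift n j) (F p) in
  let y (p : U) := pclass (phi 0 p - phi 1 p) in
  conformal_immersion y /\ forall p, f p = gauss_map y p.
Proof.
move=> zc zT [Fs Ff] mcF phi y.
have FSO p : @SOplus R (3 + n) (F p) by case: (Ff p I).
split; first exact: (conformal_immersion_null_vector zc zT Fs FSO mcF).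
move=> p; have [_ ->] := Ff p I.
exact: esym (gauss_map_null_vector zc zT Fs FSO mcF p).
Qed.

Theorem theorem2p2 (R : realType) (n : nat) :
  (forall (M : riemann_surface R) (y : M -> set 'cV[R]_(4 + n))
      (z : chart R M) (Y N : M -> 'cV[R]_(4 + n))
      (psi : M -> 'M[R]_(4 + n, n))
      (s : M -> R[i]) (kappa : M -> 'cV[R[i]]_(4 + n))
      (k beta : M -> 'I_n -> R[i]) (b : M -> 'I_n -> 'I_n -> R[i]),
    conformal_immersion y ->
    coordinate z -> contractible R (cdom z) ->
    canonical_lift y z Y -> lift_dual z Y N ->
    oriented_normal_frame z Y N psi ->
    schwarzian_hopf z Y s kappa ->
    structure_functions z Y psi kappa k beta b ->
    [/\ forall p, cdom z p ->
          @SOplus R (3 + n) (adapted_frame z Y N psi p),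
        mc_form z (adapted_frame z Y N psi) s k beta b &
        forall p, cdom z p ->
          mxB2 (k p) (beta p) = - ((mxB1 (k p) (beta p))^T *m I1 R[i] 3)]) /\
  (forall (U : riemann_surface R) (z : chart R U)
      (f : U -> set 'M[R]_(4 + n, 4)) (F : U -> 'M[R]_(4 + n))
      (s : U -> R[i]) (k beta : U -> 'I_n -> R[i])
      (b : U -> 'I_n -> 'I_n -> R[i]),
    contractible R [set: U] ->
    coordinate z -> cdom z = [set: U] ->
    conformal_map f ->
    frame_on [set: U] f F ->
    mc_form z F s k beta b ->
    let phi (j : 'I_4) (p : U) : 'cV[R]_(4 + n) := col (lshift n j) (F p) in
    let y (p : U) := pclass (phi 0 p - phi 1 p) in
    conformal_immersion y /\ forall p, f p = gauss_map y p).
Proof.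
split.
  move=> M y z Y N psi s kappa k beta b cy zc _ cl ld nf sh sf.
  exact: immersion_frame cy zc cl ld nf sh sf.
move=> U z f F s k beta b _ zc zT _ fF mcF.
exact: frame_immersion zc zT fF mcF.
Qed.
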